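(* Let $X$ be a Calabi-Yau manifold of complex dimension $n$ with Ricci-flat Kähler metric $g$, complex structure $J$ and Kähler form $\omega(Y,Z)=g(Y,JZ)$. Let $j:\Lambda\hookrightarrow X$ be a Lagrangian embedding of a connected manifold $\Lambda$, let $H\in\Gamma(N\Lambda)$ be the mean curvature vector field of $j$ with respect to $g$, and let $\mu_\Lambda$ be the Maslov form of $j$. Then, as $1$-forms on $\Lambda$, $$\mu_\Lambda=\frac{1}{\pi}\, i_H\omega ,$$ that is, $\mu_\Lambda(Y)=\frac1\pi\,\omega(H,Y)$ for every vector $Y$ tangent to $\Lambda$.
   Context: A Calabi-Yau manifold of complex dimension $n$ is a compact Kähler manifold $(X,g,J)$ with vanishing first Chern class, where $g$ is the Ricci-flat Kähler metric; its holonomy group is contained in $SU(n)$. The Kähler form is $\omega(Y,Z):=g(Y,JZ)$. Lagrangian means $\dim_{\mathbb R}\Lambda=n$ and $j^*\omega=0$. $N\Lambda$ is the normal bundle of $\Lambda$ in $X$. Mean curvature: the second fundamental form is $\sigma(Y,Z)=\nabla^g_YZ-\nabla^{j^*g}_YZ\in N\Lambda$ for $Y,Z\in\Gamma(T\Lambda)$, where $\nabla^g$ and $\nabla^{j^*g}$ are the Levi-Civita connections of $g$ and of $j^*g$. The mean curvature vector field is its trace $H=\sum_{i=1}^n\sigma(e_i,e_i)$ for a local orthonormal frame $(e_i)$ of $T\Lambda$ (no factor $1/n$). Maslov form: fix a point $p\in\Lambda$ and, for each $q\in\Lambda$, a path $\gamma_q$ in $\Lambda$ from $p$ to $q$. Let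 $(\mathcal D_\gamma)_q\subset T_qX$ be the image of $T_p\Lambda$ under parallel transport along $\gamma_q$ with respect to the Levi-Civita connection of $g$; it is a Lagrangian subspace of $T_qX$. Choose a unitary automorphism $A_q$ of $(T_qX,J_q,g_q)$ with $T_q\Lambda=A_q(\mathcal D_\gamma)_q$. The Maslov map is $\mathcal M:\Lambda\to S^1=U(1)$, $\mathcal M(q)=\det^2(A_q):=(\det_{\mathbb C}A_q)^2$; it does not depend on the choice of the paths $\gamma_q$ or of the $A_q$. With $\alpha=\frac{1}{2\pi}d\theta$ the normalized invariant $1$-form on $S^1$, the Maslov form is $\mu_\Lambda:=\mathcal M^*\alpha$ (it does not depend on $p$). *)

(* Defs.v *)
From mathcomp Require Import all_boot all_order all_algebra.
From mathcomp Require Import complex.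
From mathcomp Require Import all_classical all_reals all_analysis.
Import Order.TTheory GRing.Theory Num.Theory.
Import numFieldNormedType.Exports.

Set Implicit Arguments.
Unset Strict Implicit.
Unset Printing Implicit Defensive.

Local Open Scope classical_set_scope.
Local Open Scope ring_scope.

Fixpoint Ck {R : realType} {V W : normedModType R} (k : nat) (U : set V)
    (f : V -> W) : Prop :=
  if k is k'.+1 then
    (forall x, U x -> differentiable f x) /\ (forall v, Ck k' U ('D_v f))
  else forall x, U x -> {for x, continuous f}.

(* Only used for open U. *)
Definition smooth_on {R : realType} {V W : normedModType R} (U : set V)
    (f : V -> W) : Prop := forall k, Ck k U f.

(* A smooth m-manifold with a chosen smooth atlas and, for each point x, a
   chosen chart [chart_at x] around x. [chart_map i] is meaningful on [dom i], and
   [chart_inv i], its inverse, on the open set [chart_map i @` dom i]. *)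
Record manifold (R : realType) (m : nat) := Manifold {
  points :> topologicalType;
  chart : Type;
  dom : chart -> set points;
  chart_map : chart -> points -> 'rV[R]_m;
  chart_inv : chart -> 'rV[R]_m -> points;
  chart_at : points -> chart;
  manifold_hausdorff : hausdorff_space points;
  manifold_second_countable : @second_countable points;
  dom_open : forall i, open (dom i);
  chart_map_open : forall i, open (chart_map i @` dom i);
  chart_mapK : forall i x, dom i x -> chart_inv i (chart_map i x) = x;
  chart_map_continuous : forall i x, dom i x -> {for x, continuous (chart_map i)};
  chart_inv_continuous : forall i u, (chart_map i @` dom i) u ->
    {for u, continuous (chart_inv i)};
  dom_chart_at : forall x, dom (chart_at x) x;
  transition_smooth : forall i k,
    smooth_on (chart_map i @` (dom i `&` dom k)) (chart_map k \o chart_inv i)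
}.

(* The tangent space T_x M is 'rV[R]_m, a vector being given by its components
   in the chart [chart_at x]. Linear maps act on the right of row vectors.
   [dcoord i x] sends a tangent vector at x to its components in the chart i,
   and [dparam i x] is the inverse change of components (x in [dom i]). *)
Section Tangent.
Variables (R : realType) (m : nat) (M : manifold R m).

Definition dcoord (i : chart M) (x : M) : 'M[R]_m :=
  jacobian (chart_map i \o chart_inv (chart_at x)) (chart_map (chart_at x) x).

Definition dparam (i : chart M) (x : M) : 'M[R]_m :=
  jacobian (chart_map (chart_at x) \o chart_inv i) (chart_map i x).

Definition smooth_vector_field (U : set M) (Z : M -> 'rV[R]_m) : Prop :=
  forall i, smooth_on (chart_map i @` (dom i `&` U))
    (fun u => Z (chart_inv i u) *m dcoord i (chart_inv i u)).

(* A 1-form is given by its components at x in the chart [chart_at x];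
   [form_coord b i] is the row of functions b(d/du_a) in the chart i. *)
Definition form_coord (b : M -> 'rV[R]_m) (i : chart M) (u : 'rV[R]_m) :
    'rV[R]_m :=
  b (chart_inv i u) *m (dparam i (chart_inv i u))^T.

Definition smooth_form (b : M -> 'rV[R]_m) : Prop :=
  forall i, smooth_on (chart_map i @` dom i) (form_coord b i).

(* [c] is only constrained near [0, 1], its interval of definition. *)
Definition smooth_curve (c : R -> M) : Prop :=
  exists O : set R, [/\ open O,
    (forall t, 0 <= t <= 1 -> O t),
    (forall t, O t -> {for t, continuous c}) &
    forall i, smooth_on (O `&` c @^-1` dom i) (chart_map i \o c)].

(* A piecewise smooth path from p to q: a list of consecutive smooth curves
   parametrized by [0, 1]. *)
Fixpoint piecewise_smooth (p : M) (s : seq (R -> M)) (q : M) : Prop :=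
  if s is c :: s' then
    [/\ smooth_curve c, c 0 = p & piecewise_smooth (c 1) s' q]
  else p = q.

Definition velocity (c : R -> M) (t : R) : 'rV[R]_m :=
  'D_1 (chart_map (chart_at (c t)) \o c) t.

End Tangent.

Definition pd {R : realType} {m : nat} {W : normedModType R}
    (f : 'rV[R]_m -> W) (a : 'I_m) (u : 'rV[R]_m) : W :=
  'D_(delta_mx 0 a) f u.

Section Maps.
Variables (R : realType) (l m : nat) (N : manifold R l) (M : manifold R m).

Definition smooth_map (F : N -> M) : Prop :=
  continuous F /\
  forall k i, smooth_on (chart_map k @` (dom k `&` F @^-1` dom i))
    (chart_map i \o F \o chart_inv k).

Definition dmap (F : N -> M) (q : N) : 'M[R]_(l, m) :=
  jacobian (chart_map (chart_at (F q)) \o F \o chart_inv (chart_at q))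
    (chart_map (chart_at q) q).

Definition embedding (F : N -> M) : Prop :=
  [/\ smooth_map F, injective F, (forall q, row_free (dmap F q)) &
    forall U : set N, open U -> exists2 W : set M, open W & U = F @^-1` W].

End Maps.

Section Riemannian.
Variables (R : realType) (m : nat) (M : manifold R m).
(* Gram matrices of the inner products on the tangent spaces. *)
Variable g : M -> 'M[R]_m.

Definition inner (x : M) (v w : 'rV[R]_m) : R := (v *m g x *m w^T) 0 0.

(* The matrix (g_ab) of the metric in the chart i. *)
Definition gram (i : chart M) (u : 'rV[R]_m) : 'M[R]_m :=
  dparam i (chart_inv i u) *m g (chart_inv i u) *m (dparam i (chart_inv i u))^T.

Definition riemannian_metric : Prop :=
  [/\ forall x, (g x)^T = g x,
      forall x v, v != 0 -> 0 < inner x v v &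
      forall i, smooth_on (chart_map i @` dom i) (gram i)].

(* Christoffel symbols of the Levi-Civita connection:
   [christoffel i u c a b] is Gamma^c_ab in the chart i. *)
Definition christoffel (i : chart M) (u : 'rV[R]_m) (c a b : 'I_m) : R :=
  2^-1 * \sum_d invmx (gram i u) c d *
    (pd (gram i) a u b d + pd (gram i) b u a d - pd (gram i) d u a b).

Definition christoffel_map (i : chart M) (u v w : 'rV[R]_m) : 'rV[R]_m :=
  \row_c \sum_a \sum_b christoffel i u c a b * v 0 a * w 0 b.

Definition ricci (i : chart M) (u : 'rV[R]_m) : 'M[R]_m :=
  \matrix_(b, c) \sum_a
    (pd (fun u' => christoffel i u' a b c) a u
     - pd (fun u' => christoffel i u' a a c) b u
     + \sum_e (christoffel i u a a e * christoffel i u e b c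
               - christoffel i u a b e * christoffel i u e a c)).

Definition ricci_flat : Prop :=
  forall i u, (chart_map i @` dom i) u -> ricci i u = 0.

(* Levi-Civita derivative in the direction Y, tangent at q, of a vector field V
   along a map F : N -> M (so V x is tangent to M at F x). The choice F = id
   gives the Levi-Civita derivative of a vector field on M. *)
Definition nabla (l : nat) (N : manifold R l) (F : N -> M) (Y : 'rV[R]_l)
    (V : N -> 'rV[R]_m) (q : N) : 'rV[R]_m :=
  let k := chart_at q in
  let i := chart_at (F q) in
  'D_Y (fun u => V (chart_inv k u) *m dcoord i (F (chart_inv k u))) (chart_map k q)
  + christoffel_map i (chart_map i (F q)) (Y *m dmap F q) (V q).

(* The same along a curve; V s is tangent to M at c s. *)
Definition curve_field_coord (c : R -> M) (V : R -> 'rV[R]_m) (t s : R) :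
    'rV[R]_m :=
  V s *m dcoord (chart_at (c t)) (c s).

Definition nabla_curve (c : R -> M) (V : R -> 'rV[R]_m) (t : R) : 'rV[R]_m :=
  let i := chart_at (c t) in
  'D_1 (curve_field_coord c V t) t
  + christoffel_map i (chart_map i (c t)) (velocity c t) (V t).

Definition parallel_along (c : R -> M) (V : R -> 'rV[R]_m) : Prop :=
  forall t, 0 <= t <= 1 ->
    derivable (curve_field_coord c V t) t 1 /\ nabla_curve c V t = 0.

(* P is the matrix of the parallel transport T_(c 0) M -> T_(c 1) M. *)
Definition transport_curve (c : R -> M) (P : 'M[R]_m) : Prop :=
  forall v, exists V : R -> 'rV[R]_m,
    [/\ parallel_along c V, V 0 = v & V 1 = v *m P].

Fixpoint transport (s : seq (R -> M)) (P : 'M[R]_m) : Prop :=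
  if s is c :: s' then
    exists P1 P2, [/\ transport_curve c P1, transport s' P2 & P = P1 *m P2]
  else P = 1%:M.

End Riemannian.

(* R^(n + n) is identified with C^n by (x, y) |-> x + i y; [Jmx] is the
   multiplication by i, acting on the right: (x, y) *m Jmx = (- y, x). *)
Definition Jmx {R : realType} {n : nat} : 'M[R]_(n + n) :=
  block_mx 0 1%:M (- 1%:M) 0.

(* Complex determinant of A, assumed to commute with [Jmx], in which case
   A = block_mx P Q (- Q) P is the right multiplication by P + i Q. *)
Definition cdet {R : realType} {n : nat} (A : 'M[R]_(n + n)) : R[i] :=
  \det (\matrix_(a, b) Complex (ulsubmx A a b) (ursubmx A a b)).

Section Kahler.
Variables (R : realType) (n : nat) (X : manifold R (n + n)).

(* Cauchy-Riemann equations for the transition maps. Hence the complex structure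
   J acts on components by [Jmx] in every chart of the atlas. *)
Definition complex_atlas : Prop :=
  forall (i k : chart X) u, (chart_map i @` (dom i `&` dom k)) u ->
    comm_mx Jmx (jacobian (chart_map k \o chart_inv i) u).

Variable g : X -> 'M[R]_(n + n).

(* omega (v, w) = g (v, J w). *)
Definition omega (x : X) (v w : 'rV[R]_(n + n)) : R := inner g x v (w *m Jmx).

Definition omega_coord (i : chart X) (u : 'rV[R]_(n + n)) : 'M[R]_(n + n) :=
  gram g i u *m Jmx^T.

Definition omega_closed : Prop :=
  forall i u, (chart_map i @` dom i) u -> forall a b c,
    pd (omega_coord i) a u b c + pd (omega_coord i) b u c a
    + pd (omega_coord i) c u a b = 0.

Definition unitary (x : X) (A : 'M[R]_(n + n)) : Prop :=
  comm_mx A Jmx /\ A *m g x *m A^T = g x.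

Definition kahler : Prop :=
  [/\ complex_atlas, riemannian_metric g,
      forall x v w, inner g x (v *m Jmx) (w *m Jmx) = inner g x v w &
      omega_closed].

(* The Ricci form Ric (J v, w), in the chart i. *)
Definition ricci_form (i : chart X) (u : 'rV[R]_(n + n)) : 'M[R]_(n + n) :=
  Jmx *m ricci g i u.

(* By Chern-Weil theory the de Rham class of the Ricci form is 2 pi c_1(X):
   c_1(X) vanishes in real cohomology iff the Ricci form is exact. *)
Definition c1_vanishes : Prop :=
  exists b : X -> 'rV[R]_(n + n), smooth_form b /\
    forall i u, (chart_map i @` dom i) u -> forall a c,
      ricci_form i u a c = pd (form_coord b i) a u 0 c
                           - pd (form_coord b i) c u 0 a.

Definition holonomy_in_SU : Prop :=
  forall x s P, piecewise_smooth x s x -> transport g s P ->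
    unitary x P /\ cdet P = 1.

Definition calabi_yau : Prop :=
  [/\ compact [set: X], kahler, c1_vanishes, ricci_flat g & holonomy_in_SU].

End Kahler.

Section Submanifold.
Variables (R : realType) (l m : nat) (L : manifold R l) (X : manifold R m).
Variables (g : X -> 'M[R]_m) (j : L -> X).

Definition pullback_metric (q : L) : 'M[R]_l :=
  dmap j q *m g (j q) *m (dmap j q)^T.

(* sigma (Y, Z) at q, for Y tangent at q and Z a vector field near q. *)
Definition second_fundamental_form (Y : 'rV[R]_l) (Z : L -> 'rV[R]_l) (q : L) :
    'rV[R]_m :=
  nabla g j Y (fun q' => Z q' *m dmap j q') q
  - nabla pullback_metric id Y Z q *m dmap j q.

Definition orthonormal_frame (U : set L) (E : 'I_l -> L -> 'rV[R]_l) : Prop :=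
  (forall a, smooth_vector_field U (E a)) /\
  forall q, U q -> forall a b,
    inner pullback_metric q (E a q) (E b q) = (a == b)%:R.

(* The sum does not depend on the local orthonormal frame E. *)
Definition mean_curvature (H : L -> 'rV[R]_m) : Prop :=
  forall q, exists (U : set L) (E : 'I_l -> L -> 'rV[R]_l),
    [/\ open_nbhs q U, orthonormal_frame U E &
        H q = \sum_a second_fundamental_form (E a q) (E a) q].

End Submanifold.

Section Lagrangian.
Variables (R : realType) (n : nat) (L : manifold R n) (X : manifold R (n + n)).
Variables (g : X -> 'M[R]_(n + n)) (j : L -> X).

Definition lagrangian_embedding : Prop :=
  embedding j /\
  forall q v w, omega g (j q) (v *m dmap j q) (w *m dmap j q) = 0.

(* M q = det^2 (A q), where T_q L = A q (D_gamma) and D_gamma is the image of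
   T_p L under the parallel transport P q of X along the path gamma q of L. *)
Definition maslov_map (M : L -> R[i]) : Prop :=
  exists (p : L) (gamma : L -> seq (R -> L)) (P A : L -> 'M[R]_(n + n)),
    forall q, [/\ piecewise_smooth p (gamma q) q,
      transport g [seq j \o c | c <- gamma q] (P q),
      unitary g (j q) (A q),
      (dmap j q == dmap j p *m P q *m A q)%MS &
      M q = cdet (A q) ^+ 2].

End Lagrangian.

Section CircleMaps.
Variables (R : realType) (n : nat) (L : manifold R n) (M : L -> R[i]).

Definition re_coord (q : L) (u : 'rV[R]_n) : R :=
  complex.Re (M (chart_inv (chart_at q) u)).

Definition im_coord (q : L) (u : 'rV[R]_n) : R :=
  complex.Im (M (chart_inv (chart_at q) u)).

Definition circle_map_differentiable : Prop :=
  forall q, differentiable (re_coord q) (chart_map (chart_at q) q) /\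
            differentiable (im_coord q) (chart_map (chart_at q) q).

(* The pullback by M of d theta / (2 pi), where d theta = x dy - y dx on the
   unit circle. *)
Definition maslov_form (q : L) (Y : 'rV[R]_n) : R :=
  let u := chart_map (chart_at q) q in
  (2 * pi)^-1 * (re_coord q u * 'D_Y (im_coord q) u
                 - im_coord q u * 'D_Y (re_coord q) u).

End CircleMaps.

(* Main.v *)
From HB Require Import structures.
Require Import Defs.
From mathcomp Require Import all_boot all_order all_algebra.
From mathcomp Require Import perm complex.
From mathcomp Require Import all_classical all_reals all_analysis.
From mathcomp Require Import ring lra.
Import Order.TTheory GRing.Theory Num.Theory.
Import numFieldNormedType.Exports.

(** Fix q0 in L and transport the coordinate frame E of L at nearby points q back
    to j q0 along straight lines of a chart of X. Comparing with the paths of the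
    Maslov map gives a loop at j q0, whose holonomy has complex determinant 1, so
    the Maslov map near q0 is M q0 times the squared phase of the complex
    determinant zeta of the transported frame relative to the frame at q0. Hence
    the Maslov form at q0 in the direction Y is 1/pi times the imaginary part of
    d zeta (Y), i.e. of the complex trace of nabla_Y E relative to E. For a
    Lagrangian frame that imaginary part is the metric trace over a, b of
    omega (nabla_Y e_a, e_b). Since nabla is torsion free and nabla J = 0,
    omega (nabla_a e_b, e_c) is symmetric in a, b, c, so the trace equals
    omega (H, Y). *)

Set Implicit Arguments.
Unset Strict Implicit.
Unset Printing Implicit Defensive.

Local Open Scope classical_set_scope.
Local Open Scope ring_scope.

(** [maslov_map] gives paths and unitary maps chosen independently at each point, so the regularity
    of M has to be produced. A change of basis in a transported Lagrangian subspace multiplies the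
    complex determinant by a real number r of unknown size and sign. Squaring turns it into r^2, and
    since M has modulus 1, r^2 must be 1/|zeta|^2. Hence M = M q0 * zeta^2/|zeta|^2 near q0, an
    expression in zeta alone.

    The derivative of zeta is taken at q0 only, from the estimate Q = 1 + Gamma(x - x0) + o(|x -
    x0|) for the transport Q along the chart line from x to x0. Existence of Q comes from Picard
    iteration: the lines are short near x0, so the coefficients of the equation are small and the
    iteration contracts on a whole neighbourhood of the unit interval at once.

    At zeta = 1 the derivative of zeta^2/|zeta|^2 is 2 i Im(d zeta); this 2 against the 2 pi in the
    normalization of d theta leaves 1/pi. *)

Local Notation Re := complex.Re.
Local Notation Im := complex.Im.

(** * Derivatives of matrix-valued functions *)

Section Calculus.
Variable R : realType.
Implicit Types V W : normedModType R.

(** Meant for functions known only through a first-order estimate, such as [line_transport_mx]: the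
    candidate differential is supplied from outside. *)
Lemma differentiable_eps V W (f : V -> W) (L : {linear V -> W}) x :
  continuous L ->
  (forall e, 0 < e -> \forall h \near 0, `|f (h + x) - f x - L h| <= e * `|h|) ->
  differentiable f x /\ 'd f x = L :> (V -> W).
Proof.
move=> cL H.
have E : f \o shift x = cst (f x) + L +o_ 0 id.
  apply/eqaddoP => e e0; near=> h => /=.
  have -> : (f \o shift x - (cst (f x) + L)) h = f (h + x) - f x - L h.
    by rewrite !fctE opprD addrA.
  by near: h; exact: H.
have dE := diff_unique cL E.
split=> //; apply/diff_locallyP; rewrite dE; split => //.
Unshelve. all: by end_near. Qed.

Lemma differentiable_epsP V W (f : V -> W) x : differentiable f x ->
  forall e, 0 < e -> \forall h \near 0, `|f (h + x) - f x - 'd f x h| <= e * `|h|.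
Proof.
move=> /diff_locally/eqaddoP H e e0.
by apply: filterS (H e e0) => h; rewrite !fctE /= opprD addrA.
Qed.

Lemma near_eq_differentiable V W (f g : V -> W) x :
  (\near x, f x = g x) -> differentiable f x -> differentiable g x.
Proof.
move=> fg df.
have fgx := nbhs_singleton fg.
apply: (differentiable_eps (L := 'd f x) _ _).1; first exact: diff_continuous.
move=> e e0; move: fg; rewrite (near_shift 0) /= => fg.
near=> h; have <- : f (h + x) = g (h + x).
  by have := near fg h; rewrite /= -[in X in _ -> X](subr0 x); apply.
by rewrite -fgx; near: h; exact: differentiable_epsP.
Unshelve. all: by end_near. Qed.

(** Here h has a derivative in the single direction v. Restricting to the line t |-> t *: v + x
    makes it a function of one real variable, where derivability is differentiability and the usual
    chain rule applies. *)
Lemma is_derive_comp V W (W' : normedModType R) (f : W -> W') (h : V -> W) x v w :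
  differentiable f (h x) -> is_derive x v h w ->
  is_derive x v (f \o h) ('D_w f (h x)).
Proof.
move=> df [dh hw].
pose l := fun t : R => h (t *: v + x).
have l0 : l 0 = h x by rewrite /l scale0r add0r.
have dl : derivable l 0 1 by exact: (derivable1P h x v).1 dh.
have dl' : differentiable l 0 by apply/derivable1_diffP.
have lw : 'D_1 l 0 = w.
  rewrite -hw; apply: (congr1 (fun F : R -> _ => lim (F @ 0^'))); apply/funext => t.
  by rewrite /l /= addr0 scale0r add0r [t%:A]mulr1.
have df' : differentiable f (l 0) by rewrite l0.
have dfl : differentiable (f \o l) 0 by exact: differentiable_comp.
split; first by apply: (derivable1P (f \o h) x v).2; exact/derivable1_diffP.
have -> : 'D_v (f \o h) x = 'D_1 (f \o l) 0.
  apply: (congr1 (fun F : R -> _ => lim (F @ 0^'))); apply/funext => t.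
  by rewrite /l /= addr0 scale0r add0r [t%:A]mulr1.
rewrite (deriveE _ dfl) (diff_comp dl' df') /= -(deriveE _ dl') lw l0.
by rewrite deriveE.
Qed.

Lemma is_derive_mxP m n V (f : V -> 'M[R]_(m, n)) x v (d : 'M[R]_(m, n)) :
  is_derive x v f d <-> forall i j, is_derive x v (fun y => f y i j) (d i j).
Proof.
split=> [[df <-] i j|H].
  by split; [exact: (derivable_mxP _ _ _).1 | rewrite derive_mx // mxE].
have df : derivable f x v by apply/derivable_mxP => i j; case: (H i j).
split=> //; apply/matrixP => i j; rewrite derive_mx // mxE; by case: (H i j).
Qed.

Lemma differentiable_mxP m n V (f : V -> 'M[R]_(m, n)) x :
  differentiable f x <-> forall i j, differentiable (fun y => f y i j) x.
Proof.
split=> [df i j|H].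
  exact: (differentiable_comp (g := fun N : 'M[R]_(m, n) => N i j) df
            (differentiable_coord _ _ _)).
have -> : f = \sum_(i < m) \sum_(j < n) (fun y => f y i j *: delta_mx i j).
  apply/funext => y; rewrite fct_sumE {1}(matrix_sum_delta (f y)).
  by apply: eq_bigr => i _; rewrite fct_sumE.
apply: differentiable_sum => i; apply: differentiable_sum => j.
exact: differentiableZl.
Qed.

Lemma is_derive_mulmx m n p V (f : V -> 'M[R]_(m, n)) (g : V -> 'M[R]_(n, p)) x v df dg :
  is_derive x v f df -> is_derive x v g dg ->
  is_derive x v (fun y => f y *m g y) (df *m g x + f x *m dg).
Proof.
move=> /is_derive_mxP Hf /is_derive_mxP Hg; apply/is_derive_mxP => i j.
have -> : (fun y => (f y *m g y) i j) =
    \sum_(k < n) ((fun y => f y i k) * (fun y => g y k j)).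
  by apply/funext => y; rewrite mxE fct_sumE.
rewrite !mxE -big_split; apply: is_derive_sum => k.
apply: is_derive_eq (is_deriveM (Hf i k) (Hg k j)) _.
by rewrite /GRing.scale /=; ring.
Qed.

Lemma differentiable_mulmx m n p V (f : V -> 'M[R]_(m, n)) (g : V -> 'M[R]_(n, p)) x :
  differentiable f x -> differentiable g x ->
  differentiable (fun y => f y *m g y) x.
Proof.
move=> /differentiable_mxP Hf /differentiable_mxP Hg; apply/differentiable_mxP => i j.
have -> : (fun y => (f y *m g y) i j) =
    \sum_(k < n) ((fun y => f y i k) * (fun y => g y k j)).
  by apply/funext => y; rewrite mxE fct_sumE.
by apply: differentiable_sum => k; exact: differentiableM.
Qed.

Lemma is_derive_trmx m n V (f : V -> 'M[R]_(m, n)) x v df :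
  is_derive x v f df -> is_derive x v (fun y => (f y)^T) df^T.
Proof.
move=> /is_derive_mxP H; apply/is_derive_mxP => i j; rewrite mxE.
by under eq_fun do rewrite mxE; exact: H.
Qed.

Lemma is_derive_mulmxr m n p V (f : V -> 'M[R]_(m, n)) (A : 'M[R]_(n, p)) x v df :
  is_derive x v f df -> is_derive x v (fun y => f y *m A) (df *m A).
Proof.
move=> H; apply: is_derive_eq (is_derive_mulmx H (is_derive_cst A x v)) _.
by rewrite mulmx0 addr0.
Qed.

Lemma is_derive_mulmxl m n p V (f : V -> 'M[R]_(n, p)) (A : 'M[R]_(m, n)) x v df :
  is_derive x v f df -> is_derive x v (fun y => A *m f y) (A *m df).
Proof.
move=> H; apply: is_derive_eq (is_derive_mulmx (is_derive_cst A x v) H) _.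
by rewrite mul0mx add0r.
Qed.

Lemma jacobian_comp m n p (f : 'rV[R]_m -> 'rV[R]_n) (g : 'rV[R]_n -> 'rV[R]_p) u :
  differentiable f u -> differentiable g (f u) ->
  jacobian (g \o f) u = jacobian f u *m jacobian g (f u).
Proof.
move=> df dg; apply/row_matrixP => i; rewrite row_mul !rowE.
have dgf := differentiable_comp df dg.
rewrite -(deriveEjacobian _ df) -(deriveEjacobian _ dg) -(deriveEjacobian _ dgf).
by rewrite (deriveE _ dgf) (deriveE _ df) (deriveE _ dg) (diff_comp df dg).
Qed.

Lemma row_jacobian m n (f : 'rV[R]_m -> 'rV[R]_n) u i : differentiable f u ->
  row i (jacobian f u) = pd f i u.
Proof. by move=> df; rewrite /pd (deriveEjacobian _ df) -rowE. Qed.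

Lemma near_eq_jacobian m n (f g : 'rV[R]_m -> 'rV[R]_n) u :
  (\near u, f u = g u) -> differentiable f u -> jacobian f u = jacobian g u.
Proof.
move=> fg df; have dg := near_eq_differentiable fg df.
apply/row_matrixP => i.
rewrite [LHS](row_jacobian i df).
rewrite [RHS](row_jacobian i dg).
exact: (near_eq_derive _ fg).
Qed.

Lemma jacobian_id m (u : 'rV[R]_m) : jacobian id u = 1%:M.
Proof.
apply/row_matrixP => i; rewrite !rowE mulmx1.
have d : differentiable (id : 'rV[R]_m -> _) u by [].
by rewrite -(deriveEjacobian _ d) derive_id.
Qed.

Lemma deriveZr V W (f : V -> W) x a v : differentiable f x ->
  'D_(a *: v) f x = a *: 'D_v f x.
Proof. by move=> df; rewrite !deriveE // linearZ. Qed.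

Lemma derive_pd m W (f : 'rV[R]_m -> W) x v : differentiable f x ->
  'D_v f x = \sum_a v 0 a *: pd f a x.
Proof.
move=> df; rewrite deriveE // {1}(row_sum_delta v) linear_sum.
by apply: eq_bigr => a _; rewrite linearZ /pd deriveE.
Qed.

End Calculus.

(** * Symmetry of second derivatives and smooth functions *)

Section Schwarz.
Variable R : realType.
Implicit Types V W : normedModType R.

Lemma is_derive_line V (y v : V) (s : R) : is_derive s 1 (fun s => y + s *: v) v.
Proof.
have -> : (fun s : R => y + s *: v) = cst y + (fun s : R => s *: v) by [].
apply: is_derive_eq (is_deriveD (is_derive_cst y s 1) _) (add0r v).
have d : differentiable (fun s : R => s *: v) s by [].
split; first exact: diff_derivable.
by rewrite (deriveE _ d) diff_val scale1r.
Qed.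

Lemma is_derive_along V W (f : V -> W) (y v : V) (s : R) :
  differentiable f (y + s *: v) ->
  is_derive s 1 (fun s => f (y + s *: v)) ('D_v f (y + s *: v)).
Proof. by move=> df; exact: (is_derive_comp (h := fun s => _) df (is_derive_line y v s)). Qed.

Lemma MVT0 (f df : R -> R) (r : R) : 0 < r ->
  (forall s, 0 <= s <= r -> is_derive s 1 f (df s)) ->
  exists2 s, 0 <= s <= r & f r - f 0 = df s * r.
Proof.
move=> r0 H.
have [|c|s] := @MVT R f df 0 r r0.
- by move=> x; rewrite in_itv /= => /andP[x0 xr]; apply: H; rewrite !ltW.
- apply: derivable_within_continuous => x; rewrite in_itv /= => xr.
  by case: (H _ xr).
- rewrite in_itv /= => /andP[s0 sr]; rewrite subr0; exists s => //.
  by rewrite !ltW.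
Qed.

(** The left-hand side is symmetric in v and w. The mean value theorem is applied in the direction v
    to the difference along w, then in the direction w to the derivative so obtained. *)
Lemma second_difference V (f : V -> R) x v w (r : R) : 0 < r ->
  (forall s t, 0 <= s <= r -> 0 <= t <= r -> differentiable f (x + s *: v + t *: w)) ->
  (forall s t, 0 <= s <= r -> 0 <= t <= r -> differentiable ('D_v f) (x + s *: v + t *: w)) ->
  exists s t, [/\ 0 <= s <= r, 0 <= t <= r &
    f (x + r *: v + r *: w) - f (x + r *: v) - f (x + r *: w) + f x =
    'D_w ('D_v f) (x + s *: v + t *: w) * r * r].
Proof.
move=> r0 d1 d2.
have r00 : 0 <= r <= r by rewrite lexx ltW.
have z00 : 0 <= (0 : R) <= r by rewrite lexx ltW.
have sw s (t : R) : x + s *: v + t *: w = x + t *: w + s *: v by rewrite addrAC.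
have [s sr Es] := @MVT0 ((fun s => f (x + r *: w + s *: v)) - (fun s => f (x + s *: v)))
   (fun s => 'D_v f (x + r *: w + s *: v) - 'D_v f (x + s *: v)) r r0
   (fun s sr => ltac:(apply: is_deriveB; apply: is_derive_along;
      [rewrite -sw; exact: d1 |
       by have := d1 s 0 sr z00; rewrite scale0r addr0])).
have [t tr Et] := @MVT0 (fun t => 'D_v f (x + s *: v + t *: w))
   (fun t => 'D_w ('D_v f) (x + s *: v + t *: w)) r r0
   (fun t tr => is_derive_along (d2 s t sr tr)).
exists s, t; split=> //.
rewrite -Et scale0r addr0 [x + s *: v + _]addrAC -Es !fctE /= scale0r !addr0 sw.
by ring.
Qed.

Lemma near_square V (P : set V) (x v w : V) : nbhs x P ->
  exists2 r : R, 0 < r & forall s t, 0 <= s <= r -> 0 <= t <= r -> P (x + s *: v + t *: w).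
Proof.
move=> /nbhs_ballP[e /= e0 H].
pose r := e / (2 * (`|v| + `|w| + 1)).
have k0 : 0 < `|v| + `|w| + 1 by rewrite ltr_pwDr // addr_ge0.
have r0 : 0 < r by rewrite divr_gt0 // mulr_gt0.
exists r => // s t /andP[s0 sr] /andP[t0 tr]; apply: H.
rewrite -ball_normE /= -addrA opprD addrA subrr sub0r normrN.
apply: le_lt_trans (ler_normD _ _) _; rewrite !normrZ !ger0_norm //.
have : r * (`|v| + `|w|) < e.
  have -> : e = r * (2 * (`|v| + `|w| + 1)) by rewrite /r divfK // mulf_neq0 // gt_eqF.
  rewrite ltr_pM2l //; have := normr_ge0 v; have := normr_ge0 w; lra.
by apply: le_lt_trans; rewrite mulrDr lerD // ler_wpM2r.
Qed.

(** Each mixed derivative, at some point of a small square at x, equals the same second difference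
    divided by r^2; continuity at x brings both to within e / 2 of their values at x. *)
Lemma schwarz V (f : V -> R) (U : set V) x v w : open U -> U x ->
  (forall y, U y -> differentiable f y) ->
  (forall y, U y -> differentiable ('D_v f) y) ->
  (forall y, U y -> differentiable ('D_w f) y) ->
  {for x, continuous ('D_w ('D_v f))} -> {for x, continuous ('D_v ('D_w f))} ->
  'D_w ('D_v f) x = 'D_v ('D_w f) x.
Proof.
move=> oU Ux d dv dw cvw cwv; apply/eqP; rewrite -subr_eq0 -normr_le0.
apply/ler_addgt0Pr => e e0; rewrite add0r.
have e20 : 0 < e / 2 by rewrite divr_gt0.
have N : nbhs x (U `&` ([set y | `|'D_w ('D_v f) x - 'D_w ('D_v f) y| < e / 2] `&`
                       [set y | `|'D_v ('D_w f) x - 'D_v ('D_w f) y| < e / 2])).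
  apply: filterI; first exact: open_nbhs_nbhs.
  by apply: filterI; [exact: (cvgrPdist_lt _ _).1 cvw _ e20 | exact: (cvgrPdist_lt _ _).1 cwv _ e20].
have [r r0 H] := near_square v w N.
have sw s (t : R) : x + s *: w + t *: v = x + t *: v + s *: w by rewrite addrAC.
have [s [t [sr tr E1]]] := @second_difference V f x v w r r0
  (fun s t sr tr => d _ (H s t sr tr).1) (fun s t sr tr => dv _ (H s t sr tr).1).
have H' s' t' : 0 <= s' <= r -> 0 <= t' <= r -> U (x + s' *: w + t' *: v).
  by move=> a b; rewrite sw; exact: (H _ _ b a).1.
have [s' [t' [sr' tr' E2]]] := @second_difference V f x w v r r0
  (fun s t sr tr => d _ (H' s t sr tr)) (fun s t sr tr => dw _ (H' s t sr tr)).
move: E2; rewrite !sw => E2.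
have E : 'D_w ('D_v f) (x + s *: v + t *: w) = 'D_v ('D_w f) (x + t' *: v + s' *: w).
  apply: (mulIf (lt0r_neq0 r0)); apply: (mulIf (lt0r_neq0 r0)).
  apply: (etrans (esym E1)); apply: etrans E2.
  by move: (f _) (f (x + r *: v)) (f (x + _)) (f x) => ? ? ? ?; ring.
have [_ [A1 _]] := H s t sr tr; have [_ [_ A2]] := H t' s' tr' sr'.
move: A1 A2; rewrite /= E => A1 A2.
rewrite [leRHS](splitr e).
have K (a b c : R) : a - b = (a - c) - (b - c) by ring.
rewrite (K _ _ ('D_v ('D_w f) (x + t' *: v + s' *: w))).
exact: le_trans (ler_normB _ _) (lerD (ltW A1) (ltW A2)).
Qed.

End Schwarz.

Section CkTheory.
Variable R : realType.
Implicit Types V W : normedModType R.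

Lemma CkW k V W (U : set V) (f : V -> W) : Ck k.+1 U f -> Ck k U f.
Proof.
elim: k f => [|k IH] f [df Df]; first by move=> x /df/differentiable_continuous.
by split=> // v; exact: IH (Df v).
Qed.

Lemma Ck_subset k V W (U U' : set V) (f : V -> W) : U' `<=` U -> Ck k U f -> Ck k U' f.
Proof.
move=> s; elim: k f => [|k IH] f; first by move=> H x /s; exact: H.
by move=> [df Df]; split=> [x /s/df //|v]; exact: IH (Df v).
Qed.

Lemma Ck_eq k V W (U : set V) (f g : V -> W) : open U ->
  (forall x, U x -> f x = g x) -> Ck k U f -> Ck k U g.
Proof.
move=> oU; elim: k f g => [|k IH] f g fg.
  move=> cf x Ux; have N : \near x, f x = g x.
    by near do apply: fg; exact: open_nbhs_nbhs.
  have := cvg_trans (near_eq_cvg N) (cf x Ux).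
  by rewrite (fg _ Ux) => H; exact: H.
move=> [df Df].
have N x : U x -> \near x, f x = g x.
  by move=> Ux; near do apply: fg; exact: open_nbhs_nbhs.
split=> [x Ux|v]; first exact: near_eq_differentiable (N x Ux) (df _ Ux).
by apply: IH (Df v) => x Ux; exact: near_eq_derive (N x Ux).
Unshelve. all: by end_near. Qed.

Lemma Ck_local k V W (U : set V) (f : V -> W) :
  (forall x, U x -> exists2 U', U' x & Ck k U' f) -> Ck k U f.
Proof.
elim: k f => [|k IH] f H; first by move=> x /H[U' U'x]; exact.
split=> [x /H[U' U'x [df _]]|v]; first exact: df.
by apply: IH => x /H[U' U'x [_ Df]]; exists U' => //; exact: Df.
Qed.

Lemma Ck_cst k V W (U : set V) (c : W) : Ck k U (fun=> c).
Proof.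
elim: k c => [|k IH] c; first by move=> x _; exact: cvg_cst.
split=> [x _|v]; first exact: differentiable_cst.
have -> : 'D_v (fun=> c) = (fun=> 0) :> (V -> W).
  by apply/funext => x; exact: derive_cst.
exact: IH.
Qed.

Lemma CkD k V W (U : set V) (f g : V -> W) : open U ->
  Ck k U f -> Ck k U g -> Ck k U (fun x => f x + g x).
Proof.
move=> oU; elim: k f g => [|k IH] f g.
  by move=> cf cg x Ux; apply: cvgD; [exact: cf|exact: cg].
move=> [df Df] [dg Dg]; split=> [x Ux|v].
  by apply: differentiableD; [exact: df|exact: dg].
apply: Ck_eq (IH _ _ (Df v) (Dg v)) => // x Ux.
by rewrite -deriveD //; apply: diff_derivable; [exact: df|exact: dg].
Qed.

Lemma Ck_sum k V W (U : set V) n (f : 'I_n -> V -> W) : open U ->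
  (forall i, Ck k U (f i)) -> Ck k U (fun x => \sum_i f i x).
Proof.
move=> oU H; elim: n f H => [|n IH] f H.
  by under eq_fun do rewrite big_ord0; exact: Ck_cst.
by under eq_fun do rewrite big_ord_recl; apply: CkD => //; exact: IH.
Qed.

Lemma CkM k V (U : set V) (f g : V -> R) : open U ->
  Ck k U f -> Ck k U g -> Ck k U (fun x => f x * g x).
Proof.
move=> oU; elim: k f g => [|k IH] f g.
  by move=> cf cg x Ux; apply: cvgM; [exact: cf|exact: cg].
move=> Hf Hg; have [df Df] := Hf; have [dg Dg] := Hg; split=> [x Ux|v].
  by apply: differentiableM; [exact: df|exact: dg].
apply: (@Ck_eq k V R U (fun x => f x * 'D_v g x + g x * 'D_v f x)) => //.
  move=> x Ux; rewrite -[RHS]/('D_v (f * g) x) deriveM //; apply: diff_derivable; [exact: df|exact: dg].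
by apply: CkD => //; [apply: IH (CkW Hf) (Dg v) | apply: IH (CkW Hg) (Df v)].
Qed.

Lemma Ck_mxP k V m n (U : set V) (f : V -> 'M[R]_(m, n)) : open U ->
  Ck k U f <-> forall i j, Ck k U (fun x => f x i j).
Proof.
move=> oU; elim: k f => [|k IH] f; split.
- move=> cf i j x Ux; exact: (continuous_comp (g := fun M : 'M[R]_(m, n) => M i j) (cf x Ux)
    (@coord_continuous _ _ _ _ _ _)).
- move=> H x Ux A /nbhs_ballP[e /= e0 He].
  have : \forall y \near x, forall i j, ball (f x i j) e (f y i j).
    apply: filter_forall => i; apply: filter_forall => j.
    exact: H i j x Ux _ (nbhsx_ballx _ _ e0).
  by apply: filterS => y Hy; apply: He; split.
- move=> [df Df] i j; split=> [x Ux|v]; first exact: (differentiable_mxP _ _).1 (df _ Ux) i j.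
  apply: Ck_eq ((IH _).1 (Df v) i j) => // x Ux.
  by rewrite derive_mx ?mxE //; apply: diff_derivable; exact: df.
- move=> H; split=> [x Ux|v].
    by apply/differentiable_mxP => i j; case: (H i j) => + _; exact.
  apply/IH => i j; case: (H i j) => _ /(_ v); apply: Ck_eq => // x Ux.
  rewrite derive_mx ?mxE //; apply: diff_derivable; apply/differentiable_mxP => a b.
  by case: (H a b) => + _; exact.
Qed.

(** By the chain rule a derivative of the composite is a finite sum of products of a derivative of h
    with partial derivatives of f composed with h. The induction hypothesis covers the latter, and
    scalar values let [CkM] handle the products. *)
Lemma Ck_comp_scalar k V m (U : set V) (U' : set 'rV[R]_m) (h : V -> 'rV[R]_m) (f : 'rV[R]_m -> R) :
  open U -> open U' -> (forall x, U x -> U' (h x)) ->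
  Ck k U h -> Ck k U' f -> Ck k U (f \o h).
Proof.
move=> oU oU' s; elim: k f => [|k IH] f Hh Hf.
  by move=> x Ux; apply: continuous_comp; [exact: Hh | exact: Hf _ (s _ Ux)].
have Hh' := CkW Hh.
case: (Hh) => dh Dh; case: (Hf) => df Df; split=> [x Ux|v].
  by apply: differentiable_comp; [exact: dh|exact: df _ (s _ Ux)].
apply: (@Ck_eq k V R U (fun x => \sum_a 'D_v h x 0 a * (pd f a \o h) x)) => //.
  move=> x Ux.
  have [_ ->] := is_derive_comp (df _ (s _ Ux)) (derivableP (diff_derivable (v := v) (dh _ Ux))).
  by rewrite (derive_pd _ (df _ (s _ Ux))).
apply: Ck_sum => // a; apply: CkM => //; first exact: ((Ck_mxP _ _ oU).1 (Dh v)).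
by apply: IH => //; exact: Df.
Qed.

Lemma Ck_comp k V m p (U : set V) (U' : set 'rV[R]_m) (h : V -> 'rV[R]_m) (f : 'rV[R]_m -> 'rV[R]_p) :
  open U -> open U' -> (forall x, U x -> U' (h x)) ->
  Ck k U h -> Ck k U' f -> Ck k U (f \o h).
Proof.
move=> oU oU' s Hh Hf; apply/Ck_mxP => // i j.
by apply: (Ck_comp_scalar (f := fun y => f y i j) oU oU' s Hh);
  exact: (Ck_mxP _ _ oU').1 Hf i j.
Qed.

Lemma schwarz_rV m p (f : 'rV[R]_m -> 'rV[R]_p) U x v w : open U -> U x -> Ck 2 U f ->
  'D_w ('D_v f) x = 'D_v ('D_w f) x.
Proof.
move=> oU Ux Hf; apply/rowP => j.
have H v' : forall y, U y -> 'D_v' f y 0 j = 'D_v' (fun y => f y 0 j) y.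
  by move=> y Uy; rewrite derive_mx ?mxE //; apply: diff_derivable; case: Hf => + _; exact.
have H2 v' w' y : U y -> 'D_w' ('D_v' f) y 0 j = 'D_w' ('D_v' (fun y => f y 0 j)) y.
  move=> Uy; rewrite derive_mx; last first.
    by apply: diff_derivable; case: Hf => _ /(_ v')[+ _]; exact.
  rewrite mxE; apply: near_eq_derive; near do apply: H; exact: open_nbhs_nbhs.
apply: (etrans (H2 _ _ _ Ux)); apply: (etrans _ (esym (H2 _ _ _ Ux))).
have [d D] := (Ck_mxP _ _ oU).1 Hf 0 j.
apply: (schwarz oU Ux) => //.
- by case: (D v).
- by case: (D w).
- by case: (D v) => _ /(_ w); exact.
- by case: (D w) => _ /(_ v); exact.
Unshelve. all: by end_near. Qed.

End CkTheory.

(** * Charts and transition maps *)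

Section Hessian.
Variables (R : realType) (m p : nat) (f : 'rV[R]_m -> 'rV[R]_p) (U : set 'rV[R]_m).
Hypotheses (oU : open U) (Hf : Ck 2 U f).
Variable u : 'rV[R]_m.
Hypothesis Uu : U u.

Lemma C2_differentiable y : U y -> differentiable f y.
Proof. by move=> Uy; case: Hf => + _; exact. Qed.

Lemma differentiable_jacobian : differentiable (jacobian f) u.
Proof.
apply/differentiable_mxP => a b.
have [_ /(_ (delta_mx 0 a))[d _]] := Hf.
apply: (near_eq_differentiable _ ((differentiable_mxP _ _).1 (d _ Uu) 0 b)).
near=> y; have Uy : U y by near: y; exact: open_nbhs_nbhs.
by rewrite (deriveEjacobian _ (C2_differentiable Uy)) -rowE mxE.
Unshelve. all: by end_near. Qed.

(** Turns derivatives of Jacobians, which product rules create, into Hessians, to which the symmetry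
    of second derivatives applies. *)
Lemma derive_jacobian v w : w *m 'D_v (jacobian f) u = 'D_v ('D_w f) u.
Proof.
have [_ <-] := is_derive_mulmxl w (derivableP (diff_derivable (v := v) differentiable_jacobian)).
apply: near_eq_derive; near=> y; have Uy : U y by near: y; exact: open_nbhs_nbhs.
by rewrite (deriveEjacobian _ (C2_differentiable Uy)).
Unshelve. all: by end_near. Qed.

End Hessian.

Section Charts.
Variables (R : realType) (m : nat) (M : manifold R m).
Implicit Types (i k l : chart M) (x : M) (u : 'rV[R]_m).

(* Locked: unification otherwise unfolds the choice made in 'd. *)
Fact transition_jac_key : unit. Proof. exact: tt. Qed.
Definition transition_jac : chart M -> chart M -> M -> 'M[R]_m :=
  locked_with transition_jac_key
    (fun i k x => jacobian (chart_map k \o chart_inv i) (chart_map i x)).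

Lemma transition_jacE i k x :
  transition_jac i k x = jacobian (chart_map k \o chart_inv i) (chart_map i x).
Proof. by rewrite /transition_jac unlock. Qed.

Lemma chart_invK i u : (chart_map i @` dom i) u ->
  dom i (chart_inv i u) /\ chart_map i (chart_inv i u) = u.
Proof. by move=> [x ix <-]; rewrite chart_mapK. Qed.

Lemma near_chart i x (U : set M) : dom i x -> nbhs x U ->
  \forall u \near chart_map i x, (chart_map i @` (dom i `&` U)) u.
Proof.
move=> ix Ux.
have ixu : (chart_map i @` dom i) (chart_map i x) by exists x.
have c := chart_inv_continuous ixu.
have N : nbhs (chart_map i x) (chart_inv i @^-1` U).
  by apply: c; rewrite /= chart_mapK.
near=> u.
have [y iy E] : (chart_map i @` dom i) u.
  by near: u; apply: open_nbhs_nbhs; split => //; exact: chart_map_open.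
exists y => //; split=> //.
by rewrite -(chart_mapK iy) E; near: u.
Unshelve. all: by end_near. Qed.

Lemma open_chart_image i (U : set M) : open U -> open (chart_map i @` (dom i `&` U)).
Proof.
move=> oU; rewrite openE => _ [x [ix Ux] <-].
by apply: near_chart => //; exact: open_nbhs_nbhs.
Qed.

Lemma near_dom i x : dom i x -> \forall u \near chart_map i x, (chart_map i @` dom i) u.
Proof. by move=> ix; apply: open_nbhs_nbhs; split; [exact: chart_map_open | exists x]. Qed.

Lemma differentiable_transition i k x : dom i x -> dom k x ->
  differentiable (chart_map k \o chart_inv i) (chart_map i x).
Proof. by move=> ix kx; case: (transition_smooth i k 1) => + _; apply; exists x. Qed.

Lemma transition_jac_id i x : dom i x -> transition_jac i i x = 1%:M.
Proof.
move=> ix; rewrite transition_jacE; apply: (etrans _ (jacobian_id (chart_map i x))).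
apply: near_eq_jacobian; last exact: differentiable_transition.
near=> u; have [] // := @chart_invK i u; near: u; exact: near_dom.
Unshelve. all: by end_near. Qed.

Lemma transition_jac_comp i k l x : dom i x -> dom k x -> dom l x ->
  transition_jac i k x *m transition_jac k l x = transition_jac i l x.
Proof.
move=> ix kx lx.
have E : chart_map k x = (chart_map k \o chart_inv i) (chart_map i x).
  by rewrite /= chart_mapK.
rewrite !transition_jacE E; apply: (etrans (esym (jacobian_comp _ _))).
- exact: differentiable_transition.
- by rewrite -E; exact: differentiable_transition.
apply: near_eq_jacobian.
  near=> u; have [y [iy ky] <-] : (chart_map i @` (dom i `&` dom k)) u.
    by near: u; apply: near_chart => //; apply: open_nbhs_nbhs; split=> //; exact: dom_open.
  by rewrite /= !chart_mapK.
apply: differentiable_comp; first exact: differentiable_transition.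
by rewrite -E; exact: differentiable_transition.
Unshelve. all: by end_near. Qed.

Lemma transition_jacK i k x : dom i x -> dom k x ->
  transition_jac i k x *m transition_jac k i x = 1%:M.
Proof. by move=> ix kx; rewrite transition_jac_comp // transition_jac_id. Qed.

Lemma transition_jac_unit i k x : dom i x -> dom k x ->
  transition_jac i k x \in unitmx.
Proof. by move=> ix kx; have [] := mulmx1_unit (transition_jacK ix kx). Qed.

Lemma dcoordE i x : dcoord i x = transition_jac (chart_at x) i x.
Proof. by rewrite transition_jacE. Qed.

Lemma dparamE i x : dparam i x = transition_jac i (chart_at x) x.
Proof. by rewrite transition_jacE. Qed.

Lemma gram_transition (g : M -> 'M[R]_m) i k x : dom i x -> dom k x ->
  gram g i (chart_map i x) =
  transition_jac i k x *m gram g k (chart_map k x) *m (transition_jac i k x)^T.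
Proof.
move=> ix kx; rewrite /gram (chart_mapK ix) (chart_mapK kx) !dparamE.
have ax := dom_chart_at x.
rewrite -(transition_jac_comp ix kx ax) trmx_mul !mulmxA //.
Qed.

Lemma gram_chart_at (g : M -> 'M[R]_m) x : gram g (chart_at x) (chart_map (chart_at x) x) = g x.
Proof.
have ax := dom_chart_at x.
by rewrite /gram chart_mapK // dparamE transition_jac_id // trmx1 mulmx1 mul1mx.
Qed.

Lemma gram_at (g : M -> 'M[R]_m) i x : dom i x ->
  gram g i (chart_map i x) =
  transition_jac i (chart_at x) x *m g x *m (transition_jac i (chart_at x) x)^T.
Proof. by move=> ix; rewrite /gram chart_mapK // dparamE. Qed.

End Charts.

Section SmoothMaps.
Variables (R : realType) (l m : nat) (N : manifold R l) (M : manifold R m).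
Variables (F : N -> M).
Hypothesis sF : smooth_map F.
Implicit Types (k : chart N) (i : chart M) (q : N).

Definition local_map k i := chart_map i \o F \o chart_inv k.

Lemma open_local_dom k i : open (chart_map k @` (dom k `&` F @^-1` dom i)).
Proof.
apply: open_chart_image; apply: open_comp (dom_open i) => q _.
by case: sF => + _; exact.
Qed.

Lemma local_map_smooth k i : smooth_on (chart_map k @` (dom k `&` F @^-1` dom i)) (local_map k i).
Proof. by case: sF => _; exact. Qed.

Lemma differentiable_local_map k i q : dom k q -> dom i (F q) ->
  differentiable (local_map k i) (chart_map k q).
Proof. by move=> kq iq; case: (local_map_smooth k i 1) => + _; apply; exists q. Qed.

(** [dmap] refers to the charts chosen at q and at F q, which may jump with q. In fixed charts k and
    i the middle factor varies smoothly and can be differentiated. *)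
Lemma dmap_local k i q : dom k q -> dom i (F q) ->
  dmap F q = transition_jac (chart_at q) k q *m jacobian (local_map k i) (chart_map k q) *m
             transition_jac i (chart_at (F q)) (F q).
Proof.
move=> kq iq; rewrite /dmap !transition_jacE.
have aq := dom_chart_at q; have aF := dom_chart_at (F q).
set a := chart_at q; set b := chart_at (F q).
have E1 : chart_map k q = (chart_map k \o chart_inv a) (chart_map a q).
  by rewrite /= chart_mapK.
have E2 : chart_map i (F q) = (local_map k i \o (chart_map k \o chart_inv a)) (chart_map a q).
  by rewrite /local_map /= !chart_mapK.
have d1 : differentiable (chart_map k \o chart_inv a) (chart_map a q).
  exact: differentiable_transition.
have d2 : differentiable (local_map k i) ((chart_map k \o chart_inv a) (chart_map a q)).
  by rewrite -E1; exact: differentiable_local_map.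
have d12 := differentiable_comp d1 d2.
have d3 : differentiable (chart_map b \o chart_inv i)
   ((local_map k i \o (chart_map k \o chart_inv a)) (chart_map a q)).
  by rewrite -E2; exact: differentiable_transition.
rewrite {1}E1 {1}E2 -(jacobian_comp d1 d2) -(jacobian_comp d12 d3).
apply/esym/near_eq_jacobian; last exact: differentiable_comp.
near=> u.
have [y [ay [ky iy]] <-] : (chart_map a @` (dom a `&` (dom k `&` F @^-1` dom i))) u.
  near: u; apply: near_chart => //; apply: filterI.
    by apply: open_nbhs_nbhs; split=> //; exact: dom_open.
  have cF : {for q, continuous F} by case: sF => + _; exact.
  by apply: cF; apply: open_nbhs_nbhs; split=> //; exact: dom_open.
by rewrite /local_map /= !chart_mapK.
Unshelve. all: by end_near. Qed.

End SmoothMaps.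

(** * The Levi-Civita connection *)

Section MatrixForms.
Variable R : realType.

Definition mxform m n (A : 'M[R]_(m, n)) (v : 'rV[R]_m) (w : 'rV[R]_n) : R :=
  (v *m A *m w^T) 0 0.

Lemma mxformE m n (A : 'M[R]_(m, n)) v w :
  mxform A v w = \sum_a \sum_b v 0 a * w 0 b * A a b.
Proof.
rewrite /mxform mxE exchange_big; apply: eq_bigr => b _ /=.
rewrite !mxE mulr_suml; apply: eq_bigr => a _; ring.
Qed.

Lemma mxformDl m n (A : 'M[R]_(m, n)) v v' w : mxform A (v + v') w = mxform A v w + mxform A v' w.
Proof. by rewrite /mxform !mulmxDl mxE. Qed.

Lemma mxformDr m n (A : 'M[R]_(m, n)) v w w' : mxform A v (w + w') = mxform A v w + mxform A v w'.
Proof. by rewrite /mxform linearD mulmxDr mxE. Qed.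

Lemma mxformZl m n (A : 'M[R]_(m, n)) a v w : mxform A (a *: v) w = a * mxform A v w.
Proof. by rewrite /mxform -!scalemxAl mxE. Qed.

Lemma mxformZr m n (A : 'M[R]_(m, n)) a v w : mxform A v (a *: w) = a * mxform A v w.
Proof. by rewrite /mxform linearZ -scalemxAr mxE. Qed.

Lemma mxformNl m n (A : 'M[R]_(m, n)) v w : mxform A (- v) w = - mxform A v w.
Proof. by rewrite -scaleN1r mxformZl mulN1r. Qed.

Lemma mxformNr m n (A : 'M[R]_(m, n)) v w : mxform A v (- w) = - mxform A v w.
Proof. by rewrite -scaleN1r mxformZr mulN1r. Qed.

Lemma mxform0l m n (A : 'M[R]_(m, n)) w : mxform A 0 w = 0.
Proof. by rewrite /mxform !mul0mx mxE. Qed.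

Lemma mxform0r m n (A : 'M[R]_(m, n)) v : mxform A v 0 = 0.
Proof. by rewrite /mxform trmx0 mulmx0 mxE. Qed.

Lemma mxform_mul m n p q (A : 'M[R]_(m, n)) (B : 'M[R]_(p, m)) (C : 'M[R]_(q, n)) v w :
  mxform A (v *m B) (w *m C) = mxform (B *m A *m C^T) v w.
Proof. by rewrite /mxform trmx_mul !mulmxA. Qed.

Lemma mxform_mulr m n q (A : 'M[R]_(m, n)) (C : 'M[R]_(q, n)) v w :
  mxform A v (w *m C) = mxform (A *m C^T) v w.
Proof. by rewrite /mxform trmx_mul !mulmxA. Qed.

Lemma mxformC m n (A : 'M[R]_(m, n)) v w : mxform A v w = mxform A^T w v.
Proof.
rewrite /mxform; have -> : w *m A^T *m v^T = (v *m A *m w^T)^T.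
  by rewrite !trmx_mul trmxK mulmxA.
by rewrite [RHS]mxE.
Qed.

Lemma mxform_delta m n (A : 'M[R]_(m, n)) a b : mxform A (delta_mx 0 a) (delta_mx 0 b) = A a b.
Proof. by rewrite /mxform -rowE trmx_delta -colE !mxE. Qed.

Lemma mxform_inj m n (A B : 'M[R]_(m, n)) :
  (forall v w, mxform A v w = mxform B v w) -> A = B.
Proof. by move=> H; apply/matrixP => a b; rewrite -!mxform_delta. Qed.

Lemma mxform_nondeg m (A : 'M[R]_m) v w : A \in unitmx ->
  (forall d, mxform A v d = mxform A w d) -> v = w.
Proof.
move=> uA H; rewrite -(mulmxK uA v) -(mulmxK uA w); congr (_ *m _).
apply/rowP => b; have := H (delta_mx 0 b).
by rewrite /mxform trmx_delta -!colE !mxE.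
Qed.

Lemma mxform_pos_unit m (A : 'M[R]_m) :
  (forall v, v != 0 -> 0 < mxform A v v) -> A \in unitmx.
Proof.
move=> H; rewrite -row_free_unit -kermx_eq0; apply/eqP/row_matrixP => i.
rewrite row0; apply/eqP; apply: contraT => /H.
by rewrite /mxform -row_mul mulmx_ker row0 mul0mx mxE ltxx.
Qed.

Lemma derive_mxform m n (V : normedModType R) (A : V -> 'M[R]_(m, n))
    (v : V -> 'rV[R]_m) (w : V -> 'rV[R]_n) x y dA dv dw :
  is_derive x y A dA -> is_derive x y v dv -> is_derive x y w dw ->
  is_derive x y (fun t => mxform (A t) (v t) (w t))
    (mxform dA (v x) (w x) + mxform (A x) dv (w x) + mxform (A x) (v x) dw).
Proof.
move=> HA Hv Hw.
have /is_derive_mxP/(_ 0 0) := is_derive_mulmx (is_derive_mulmx Hv HA) (is_derive_trmx Hw).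
move=> H; apply: is_derive_eq H _.
by rewrite mulmxDl [LHS]mxE [X in X + _]mxE [X in X + _ = _]addrC /mxform.
Qed.

End MatrixForms.

Section LeviCivita.
Variables (R : realType) (m : nat) (M : manifold R m) (g : M -> 'M[R]_m).
Hypothesis hg : riemannian_metric g.
Implicit Types (i k : chart M) (x : M) (u v w : 'rV[R]_m).

Lemma gram_sym i u : (gram g i u)^T = gram g i u.
Proof. by rewrite /gram !trmx_mul trmxK mulmxA; case: hg => -> . Qed.

Lemma metric_pos x v : v != 0 -> 0 < mxform (g x) v v.
Proof. by case: hg => _ + _; exact. Qed.

Lemma metric_unit x : g x \in unitmx.
Proof. by apply: mxform_pos_unit => v; exact: metric_pos. Qed.

Lemma gram_pos i x v : dom i x -> v != 0 -> 0 < mxform (gram g i (chart_map i x)) v v.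
Proof.
move=> ix v0; have ax := dom_chart_at x.
rewrite (gram_at _ ix) -mxform_mul; apply: metric_pos.
apply: contra v0 => /eqP E.
by rewrite -(mulmxK (transition_jac_unit ix ax) v) E mul0mx.
Qed.

Lemma gram_unit i x : dom i x -> gram g i (chart_map i x) \in unitmx.
Proof. by move=> ix; apply: mxform_pos_unit => v; exact: gram_pos. Qed.

Lemma differentiable_gram i x : dom i x -> differentiable (gram g i) (chart_map i x).
Proof. by move=> ix; case: hg => _ _ /(_ i 1%N)[+ _]; apply; exists x. Qed.

Lemma is_derive_gram i x v : dom i x ->
  is_derive (chart_map i x) v (gram g i) ('D_v (gram g i) (chart_map i x)).
Proof. by move=> ix; apply: derivableP; apply: diff_derivable; exact: differentiable_gram. Qed.

Fact dgram_key : unit. Proof. exact: tt. Qed.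
(** The derivative of the metric along the first vector, as a trilinear form on chart components.
    Kept opaque, it turns identities of Koszul type into linear arithmetic between its values. *)
Definition dgram : chart M -> M -> 'rV[R]_m -> 'rV[R]_m -> 'rV[R]_m -> R :=
  locked_with dgram_key (fun i x v => mxform ('D_v (gram g i) (chart_map i x))).

Lemma dgram_def i x v a b : dgram i x v a b = mxform ('D_v (gram g i) (chart_map i x)) a b.
Proof. by rewrite /dgram unlock. Qed.

Lemma dgramC i x v a b : dom i x -> dgram i x v a b = dgram i x v b a.
Proof.
move=> ix; rewrite !dgram_def [LHS]mxformC; congr mxform.
have [_ E] := is_derive_trmx (is_derive_gram v ix).
rewrite -[LHS]E; apply: (congr1 (fun f : _ -> 'M[R]_m => 'D_v f (chart_map i x))).
by apply/funext => y; rewrite gram_sym.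
Qed.

Lemma dgramE i x v a b : dom i x ->
  dgram i x v a b = \sum_c v 0 c * mxform (pd (gram g i) c (chart_map i x)) a b.
Proof.
move=> ix; rewrite dgram_def (derive_pd _ (differentiable_gram ix)) /mxform.
rewrite mulmx_sumr mulmx_suml summxE; apply: eq_bigr => c _.
by rewrite -scalemxAr -scalemxAl mxE.
Qed.

(** Koszul formula for vector fields with constant components. Lowering the index removes the
    inverse Gram matrix; symmetry, metric compatibility, the change of charts and the commutation
    with J are all read off from it by nondegeneracy. *)
Lemma christoffel_lowered i x v w d : dom i x ->
  mxform (gram g i (chart_map i x)) (christoffel_map g i (chart_map i x) v w) d =
  2^-1 * (dgram i x v w d + dgram i x w v d - dgram i x d v w).
Proof.
move=> ix; set G := gram g i _.
have uG : G \in unitmx by exact: gram_unit.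
have sG : (invmx G)^T = invmx G by rewrite trmx_inv gram_sym.
pose P c := pd (gram g i) c (chart_map i x).
pose s : 'rV[R]_m := \row_e \sum_a \sum_b (P a b e + P b a e - P e a b) * v 0 a * w 0 b.
have E : christoffel_map g i (chart_map i x) v w = 2^-1 *: s *m invmx G.
  apply/rowP => c; rewrite !mxE.
  transitivity (\sum_a \sum_b \sum_e 2^-1 * (P a b e + P b a e - P e a b) * v 0 a * w 0 b * invmx G e c).
    apply: eq_bigr => a _; apply: eq_bigr => b _.
    rewrite /christoffel -/G mulr_sumr !mulr_suml; apply: eq_bigr => e _.
    have -> : invmx G c e = invmx G e c.
      by rewrite -[in LHS]sG mxE.
    rewrite -/(P a) -/(P b) -/(P e).
    ring.
  under eq_bigr => a _ do rewrite exchange_big.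
  rewrite exchange_big; apply: eq_bigr => e _; rewrite !mxE.
  rewrite mulr_sumr mulr_suml; apply: eq_bigr => a _.
  rewrite mulr_sumr mulr_suml; apply: eq_bigr => b _.
  ring.
have -> : mxform G (christoffel_map g i (chart_map i x) v w) d = 2^-1 * (s *m d^T) 0 0.
  by rewrite E /mxform mulmxKV // -scalemxAl mxE.
congr (_ * _); rewrite !dgramE // -/(P _).
transitivity (\sum_a \sum_b \sum_e (P a b e + P b a e - P e a b) * v 0 a * w 0 b * d 0 e).
  rewrite mxE.
  transitivity (\sum_e \sum_a \sum_b (P a b e + P b a e - P e a b) * v 0 a * w 0 b * d 0 e).
    apply: eq_bigr => e _; rewrite !mxE mulr_suml; apply: eq_bigr => a _.
    by rewrite mulr_suml.
  rewrite exchange_big; apply: eq_bigr => a _; by rewrite exchange_big.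
have -> : \sum_c v 0 c * mxform (P c) w d = \sum_a \sum_b \sum_e P a b e * v 0 a * w 0 b * d 0 e.
  apply: eq_bigr => a _; rewrite mxformE mulr_sumr; apply: eq_bigr => b _.
  by rewrite mulr_sumr; apply: eq_bigr => e _; ring.
have -> : \sum_c w 0 c * mxform (P c) v d = \sum_a \sum_b \sum_e P b a e * v 0 a * w 0 b * d 0 e.
  rewrite exchange_big; apply: eq_bigr => a _; rewrite mxformE mulr_sumr; apply: eq_bigr => b _.
  by rewrite mulr_sumr; apply: eq_bigr => e _; ring.
have -> : \sum_c d 0 c * mxform (P c) v w = \sum_a \sum_b \sum_e P e a b * v 0 a * w 0 b * d 0 e.
  under [RHS]eq_bigr => a _ do rewrite exchange_big.
  rewrite exchange_big; apply: eq_bigr => a _; rewrite mxformE mulr_sumr; apply: eq_bigr => b _.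
  by rewrite mulr_sumr; apply: eq_bigr => e _; ring.
rewrite -big_split -sumrB; apply: eq_bigr => a _.
rewrite -big_split -sumrB; apply: eq_bigr => b _.
rewrite -big_split -sumrB; apply: eq_bigr => e _ /=; ring.
Qed.

Lemma christoffel_mapZl i u s v w :
  christoffel_map g i u (s *: v) w = s *: christoffel_map g i u v w.
Proof.
apply/rowP => c; rewrite !mxE mulr_sumr; apply: eq_bigr => a _ /=.
by rewrite mulr_sumr; apply: eq_bigr => b _ /=; rewrite mxE; ring.
Qed.

Definition christoffel_mx i u v : 'M[R]_m := \matrix_(b, c) \sum_a christoffel g i u c a b * v 0 a.

Lemma christoffel_mapE i u v w : christoffel_map g i u v w = w *m christoffel_mx i u v.
Proof.
apply/rowP => c; rewrite !mxE exchange_big; apply: eq_bigr => b _; rewrite mxE.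
by rewrite mulr_sumr; apply: eq_bigr => a _; ring.
Qed.

Lemma christoffel_mapC i x v w : dom i x ->
  christoffel_map g i (chart_map i x) v w = christoffel_map g i (chart_map i x) w v.
Proof.
move=> ix; apply: (mxform_nondeg (gram_unit ix)) => d.
by rewrite !christoffel_lowered // (dgramC d v w ix); ring.
Qed.

Lemma metric_compat i x c a b : dom i x ->
  dgram i x c a b =
  mxform (gram g i (chart_map i x)) (christoffel_map g i (chart_map i x) c a) b +
  mxform (gram g i (chart_map i x)) a (christoffel_map g i (chart_map i x) c b).
Proof.
move=> ix; rewrite [X in _ = _ + X]mxformC gram_sym !christoffel_lowered //.
by rewrite (dgramC c b a ix); field.
Qed.

(** Differentiating the transformation law of the Gram matrix expresses [dgram] in the chart i by
    [dgram] in the chart k plus two Hessian terms. In the Koszul combination the symmetry of the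
    Hessian cancels all of these except those pairing H v w with the test vector. *)
Lemma christoffel_transition i k x v w : dom i x -> dom k x ->
  christoffel_map g k (chart_map k x) (v *m transition_jac i k x) (w *m transition_jac i k x) =
  christoffel_map g i (chart_map i x) v w *m transition_jac i k x -
  'D_v ('D_w (chart_map k \o chart_inv i)) (chart_map i x).
Proof.
move=> ix kx.
pose psi := chart_map k \o chart_inv i; pose U := chart_map i @` (dom i `&` dom k).
have oU : open U by apply: open_chart_image; exact: dom_open.
have Ux : U (chart_map i x) by exists x.
have C2 : Ck 2 U psi by exact: transition_smooth.
pose H a b := 'D_a ('D_b psi) (chart_map i x).
have HC a b : H a b = H b a by exact: schwarz_rV oU Ux C2.
pose T := transition_jac i k x.
have psix : psi (chart_map i x) = chart_map k x by rewrite /psi /= chart_mapK.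
have key c a b : dgram i x c a b = mxform (gram g k (chart_map k x)) (H c a) (b *m T) +
    dgram k x (c *m T) (a *m T) (b *m T) + mxform (gram g k (chart_map k x)) (a *m T) (H c b).
  have dJ := derivableP (diff_derivable (v := c) (differentiable_jacobian oU C2 Ux)).
  have dpsi : is_derive (chart_map i x) c psi (c *m T).
    have d := C2_differentiable C2 Ux.
    by split; [exact: diff_derivable | rewrite (deriveEjacobian _ d) /T transition_jacE].
  have dG : is_derive (chart_map i x) c (gram g k \o psi) ('D_(c *m T) (gram g k) (chart_map k x)).
    rewrite -psix; apply: is_derive_comp dpsi; rewrite psix; exact: differentiable_gram.
  have := derive_mxform dG (is_derive_mulmxl a dJ) (is_derive_mulmxl b dJ).
  rewrite !(derive_jacobian oU C2 Ux) -/(H _ _) /= -/psi psix -/(H c b).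
  rewrite -transition_jacE -/T => -[_ E].
  have E' : 'D_c (fun t => mxform (gram g i t) a b) (chart_map i x) = dgram i x c a b.
    have [_ ->] := derive_mxform (is_derive_gram c ix) (is_derive_cst a _ _) (is_derive_cst b _ _).
    by rewrite mxform0l mxform0r !addr0 dgram_def.
  rewrite -E'; apply: (etrans _ (etrans E _)); last first.
    rewrite (dgram_def k); apply: (congr1 (fun X => X + _)); exact: addrC.
  apply: near_eq_derive; near=> t.
  have [y [iy ky] <-] : U t by near: t; exact: open_nbhs_nbhs.
  by rewrite (gram_transition _ iy ky) -mxform_mul transition_jacE /psi /= chart_mapK.
have uT : T \in unitmx by exact: transition_jac_unit.
apply: (mxform_nondeg (gram_unit kx)) => d.
(* The test vector is written as the image of a vector e of the chart i, so that the Koszul formulas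
   of both charts can be compared on it. *)
rewrite -(mulmxKV uT d); set e := d *m invmx T.
rewrite -/T -/psi -/(H v w).
clearbody H; rewrite mxformDl mxformNl.
have E1 := christoffel_lowered v w e ix.
have E2 := christoffel_lowered (v *m T) (w *m T) (e *m T) kx.
rewrite (gram_transition _ ix kx) -/T -mxform_mul in E1.
rewrite E1 E2 !key (HC w v) (HC e v) (HC e w).
rewrite [mxform _ (w *m T) (H v e)]mxformC [mxform _ (v *m T) (H w e)]mxformC gram_sym.
by field.
Unshelve. all: by end_near. Qed.

End LeviCivita.

(** * Kahler metrics *)

Section ComplexStructure.
Variables (R : realType) (n : nat).
Local Notation J := (@Jmx R n).

Lemma trmx_Jmx : J^T = - J.
Proof. by rewrite /Jmx tr_block_mx opp_block_mx !trmx0 linearN /= trmx1 !oppr0 opprK. Qed.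

Lemma Jmx_sqr : J *m J = - 1%:M.
Proof.
rewrite /Jmx mulmx_block !mul0mx !mulmx0 !mulNmx !mul1mx !add0r !addr0.
by rewrite scalar_mx_block opp_block_mx !oppr0.
Qed.

Lemma mulmxJJ m (A : 'M[R]_(m, n + n)) : A *m J *m J = - A.
Proof. by rewrite -mulmxA Jmx_sqr mulmxN mulmx1. Qed.

End ComplexStructure.

Section KahlerGeometry.
Variables (R : realType) (n : nat) (X : manifold R (n + n)).
Variable g : X -> 'M[R]_(n + n).
Hypothesis hK : kahler g.
Local Notation J := (@Jmx R n).
Implicit Types (i k : chart X) (x : X) (u v w : 'rV[R]_(n + n)).

Lemma kahler_riemannian : riemannian_metric g.
Proof. by case: hK. Qed.
Let hg := kahler_riemannian.

Lemma Jmx_transition i k x : dom i x -> dom k x ->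
  J *m transition_jac i k x = transition_jac i k x *m J.
Proof.
by move=> ix kx; rewrite transition_jacE; case: hK => + _ _ _; apply; exists x.
Qed.

Lemma metric_Jmx x : J *m g x *m J^T = g x.
Proof.
apply: mxform_inj => v w; rewrite -mxform_mul.
by case: hK => _ _ + _; exact.
Qed.

Lemma gram_Jmx i x : dom i x ->
  J *m gram g i (chart_map i x) *m J^T = gram g i (chart_map i x).
Proof.
move=> ix; have ax := dom_chart_at x; rewrite (gram_at _ ix); set T := transition_jac _ _ _.
rewrite !mulmxA Jmx_transition // -/T -[_ *m T^T *m _]mulmxA -trmx_mul Jmx_transition // -/T.
by rewrite trmx_mul -{2}(metric_Jmx x) !mulmxA.
Qed.

Lemma dgram_Jmx i x c a b : dom i x -> dgram g i x c (a *m J) (b *m J) = dgram g i x c a b.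
Proof.
move=> ix; rewrite !dgram_def mxform_mul; congr mxform.
have [_ <-] := is_derive_mulmxr J^T (is_derive_mulmxl J (is_derive_gram hg c ix)).
apply: near_eq_derive; near=> t.
have [y iy <-] : (chart_map i @` dom i) t by near: t; exact: near_dom.
exact: gram_Jmx.
Unshelve. all: by end_near. Qed.

Lemma dgramDlr i x c a : dom i x -> forall b, dgram g i x c a (- b) = - dgram g i x c a b.
Proof. by move=> ix b; rewrite !dgram_def mxformNr. Qed.

Lemma dgram_Jmxl i x c a b : dom i x -> dgram g i x c (a *m J) b = - dgram g i x c a (b *m J).
Proof.
move=> ix; rewrite -(dgram_Jmx c a (b *m J) ix) mulmxJJ !dgram_def mxformNr opprK //.
Qed.

(** Trilinear extension of the condition on coordinate vectors in [omega_closed], using that omega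
    (b, c) is the metric on b and c *m J with J constant in every chart. *)
Lemma dgram_closed i x a b c : dom i x ->
  dgram g i x a b (c *m J) + dgram g i x b c (a *m J) + dgram g i x c a (b *m J) = 0.
Proof.
move=> ix; set u := chart_map i x.
have dG := differentiable_gram hg ix.
have dO : differentiable (omega_coord g i) u.
  by apply: differentiable_mulmx.
have E v w d : dgram g i x v w (d *m J) =
    \sum_p \sum_q \sum_r v 0 p * w 0 q * d 0 r * pd (omega_coord g i) p u q r.
  rewrite dgram_def mxform_mulr.
  have -> : 'D_v (gram g i) u *m J^T = 'D_v (omega_coord g i) u.
    by have [_ <-] := is_derive_mulmxr J^T (is_derive_gram hg v ix).
  rewrite (derive_pd _ dO) mxformE exchange_big.
  under eq_bigr => r _.
    under eq_bigr => q _ do rewrite summxE mulr_sumr.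
    rewrite exchange_big.
    over.
  rewrite exchange_big; apply: eq_bigr => p _ /=.
  rewrite exchange_big; apply: eq_bigr => q _.
  by apply: eq_bigr => r _; rewrite !mxE; ring.
rewrite !E.
have -> : \sum_p \sum_q \sum_r b 0 p * c 0 q * a 0 r * pd (omega_coord g i) p u q r =
   \sum_p \sum_q \sum_r a 0 p * b 0 q * c 0 r * pd (omega_coord g i) q u r p.
  under eq_bigr => p _ do rewrite exchange_big.
  rewrite exchange_big; apply: eq_bigr => r _; apply: eq_bigr => p _.
  by apply: eq_bigr => q _; ring.
have -> : \sum_p \sum_q \sum_r c 0 p * a 0 q * b 0 r * pd (omega_coord g i) p u q r =
   \sum_p \sum_q \sum_r a 0 p * b 0 q * c 0 r * pd (omega_coord g i) r u p q.
  rewrite exchange_big; apply: eq_bigr => p _.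
  rewrite exchange_big; apply: eq_bigr => q _; apply: eq_bigr => r _; ring.
rewrite -!big_split big1 // => p _; rewrite -!big_split big1 // => q _.
rewrite -!big_split big1 // => r _ /=.
rewrite -!mulrDr; case: hK => _ _ _ H; rewrite H ?mulr0 //.
by exists x.
Qed.

(** This is nabla J = 0, checked against a test vector d after moving J across the metric, for which
    J is skew. *)
Lemma christoffel_Jmx i x v w : dom i x ->
  christoffel_map g i (chart_map i x) v (w *m J) = christoffel_map g i (chart_map i x) v w *m J.
Proof.
move=> ix; apply: (mxform_nondeg (gram_unit hg ix)) => d.
have -> : mxform (gram g i (chart_map i x)) (christoffel_map g i (chart_map i x) v w *m J) d =
   - mxform (gram g i (chart_map i x)) (christoffel_map g i (chart_map i x) v w) (d *m J).
  by rewrite -[in RHS](gram_Jmx ix) -mxform_mul mulmxJJ mxformNr opprK.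
rewrite !(christoffel_lowered hg) //.
(* For an integrable J, g((nabla_v J) w, d) is, up to a constant, d omega (v, J w, J d) - d omega
   (v, w, d). These two triples are used; the remaining facts are J-invariance and symmetry of the
   metric. *)
have h1 := dgram_closed d v w ix.
have h2 := dgram_closed v (w *m J) (d *m J) ix.
rewrite !mulmxJJ !dgramDlr // in h2.
have h3 := dgram_Jmx (w *m J) d v ix.
have h4 := dgram_Jmxl v w d ix.
have h5 := dgram_Jmxl w v d ix.
have h6 := dgramC hg (w *m J) v d ix.
have h7 := dgramC hg w d (v *m J) ix.
move: h1 h2 h3 h4 h5 h6 h7.
move: (dgram g i) => T *.
have h8 := dgramC hg d v w.
lra.
Qed.

Lemma christoffel_mx_Jmx i x v : dom i x ->
  J *m christoffel_mx g i (chart_map i x) v = christoffel_mx g i (chart_map i x) v *m J.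
Proof.
move=> ix; apply/row_matrixP => a; rewrite !rowE !mulmxA -[in RHS]christoffel_mapE.
by rewrite -christoffel_Jmx // christoffel_mapE.
Qed.

End KahlerGeometry.

(** * Parallel transport *)

Section Curves.
Variable R : realType.

Lemma open_preimage_on (S : topologicalType) (O : set R) (c : R -> S) (A : set S) :
  open O -> (forall t, O t -> {for t, continuous c}) -> open A -> open (O `&` c @^-1` A).
Proof.
move=> oO cc oA; rewrite openE => t [Ot At]; apply: filterI.
  exact: open_nbhs_nbhs.
by apply: cc => //; exact: open_nbhs_nbhs.
Qed.

Lemma smooth_curve_comp (l m : nat) (N : manifold R l) (M : manifold R m) (F : N -> M) c :
  smooth_map F -> smooth_curve c -> smooth_curve (F \o c).
Proof.
move=> sF [D [oO O01 cc sc]]; exists D.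
have cF : forall A, open A -> open (F @^-1` A).
  by move=> A oA; apply: open_comp oA => q _; case: sF => + _; exact.
split=> // [t Ot|i d].
  apply: continuous_comp; first exact: cc.
  by case: sF => + _; exact.
(* Smoothness of c and of F is given chart by chart, so near each t the composite is factored
   through a chart of N around c t. *)
apply: Ck_local => t [Ot it]; pose k := chart_at (c t).
pose U := D `&` c @^-1` (dom k `&` F @^-1` dom i).
have oU : open U.
  by apply: open_preimage_on => //; apply: openI; [exact: dom_open | apply: cF; exact: dom_open].
exists U; first by split=> //; split=> //; exact: dom_chart_at.
apply: (@Ck_eq _ d _ _ U (local_map F k i \o (chart_map k \o c))) => //.
  by move=> s [Os [ks is_]]; rewrite /local_map /= chart_mapK.
apply: (Ck_comp (U' := chart_map k @` (dom k `&` F @^-1` dom i)) oU).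
- exact: open_local_dom.
- by move=> s [Os Hs]; exists (c s).
- apply: Ck_subset (sc k d) => s [Os [ks _]] //.
- exact: local_map_smooth.
Qed.

Definition reverse_curve (S : Type) (c : R -> S) : R -> S := fun t => c (1 - t).

Lemma is_derive_reverse (t v : R) : is_derive t v (fun s : R => 1 - s) (- v).
Proof.
have -> : (fun s : R => 1 - s) = cst 1 - id by [].
by apply: is_derive_eq (is_deriveB _ _) _; rewrite sub0r.
Qed.

Lemma reverse_continuous : continuous (fun s : R => 1 - s).
Proof. by move=> t; apply: cvgB; [exact: cvg_cst | exact: cvg_id]. Qed.

Lemma continuous_reverse (S : topologicalType) (f : R -> S) t :
  {for 1 - t, continuous f} -> {for t, continuous (reverse_curve f)}.
Proof.
move=> cf; apply: (@continuous_comp _ _ _ (fun s : R => 1 - s) f) => //.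
exact: reverse_continuous.
Qed.

Lemma open_reverse (U : set R) : open U -> open (reverse_curve U).
Proof. by move=> oU; apply: (open_comp (f := fun t : R => 1 - t)) oU => t _; exact: reverse_continuous. Qed.

Lemma Ck_reverse k (W : normedModType R) (U : set R) (f : R -> W) : open U ->
  Ck k U f -> Ck k (reverse_curve U) (reverse_curve f).
Proof.
move=> oU; elim: k f => [|k IH] f.
  move=> cf t Ut.
  exact: continuous_reverse (cf _ Ut).
move=> [df Df]; have D t v : U (1 - t) -> is_derive t v (reverse_curve f) ('D_(- v) f (1 - t)).
  move=> Ut; exact: (is_derive_comp (h := fun s : R => 1 - s) (df _ Ut) (is_derive_reverse t v)).
split=> [t Ut|v].
  by apply/derivable1_diffP; case: (D t 1 Ut).
apply: Ck_eq (IH _ (Df (- v))); first exact: open_reverse.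
by move=> t Ut; case: (D t v Ut).
Qed.

End Curves.

Section ParallelTransport.
Variables (R : realType) (m : nat) (M : manifold R m) (g : M -> 'M[R]_m).
Hypothesis hg : riemannian_metric g.
Implicit Types (c : R -> M) (V : R -> 'rV[R]_m) (t : R).

Lemma smooth_curve_velocity c t : smooth_curve c -> 0 <= t <= 1 ->
  is_derive t 1 (chart_map (chart_at (c t)) \o c) (velocity c t).
Proof.
move=> [D [oO O01 cc sc]] t01; apply: derivableP; apply: diff_derivable.
have := sc (chart_at (c t)) 1%N; case=> + _; apply; split; first exact: O01.
exact: dom_chart_at.
Qed.

Lemma smooth_curve_near_dom c t : smooth_curve c -> 0 <= t <= 1 ->
  \forall s \near t, dom (chart_at (c t)) (c s).
Proof.
move=> [D [oO O01 cc sc]] /O01/cc ct; apply: ct.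
by apply: open_nbhs_nbhs; split; [exact: dom_open | exact: dom_chart_at].
Qed.

Lemma curve_field_coord_at c V t : curve_field_coord c V t t = V t.
Proof.
by rewrite /curve_field_coord dcoordE transition_jac_id ?mulmx1 //; exact: dom_chart_at.
Qed.

Lemma inner_curve_field c V t s : dom (chart_at (c t)) (c s) ->
  inner g (c s) (V s) (V s) =
  mxform (gram g (chart_at (c t)) (chart_map (chart_at (c t)) (c s)))
    (curve_field_coord c V t s) (curve_field_coord c V t s).
Proof.
move=> d; rewrite /curve_field_coord dcoordE mxform_mul.
by rewrite -(gram_transition g (dom_chart_at (c s)) d) gram_chart_at.
Qed.

(** Metric compatibility makes the derivative of the squared length vanish. Applied to a field
    ending at 0 it gives the invertibility of transport, and to a difference of two fields its
    uniqueness. *)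
Lemma parallel_along_inner c V : smooth_curve c -> parallel_along g c V ->
  inner g (c 1) (V 1) (V 1) = inner g (c 0) (V 0) (V 0).
Proof.
move=> sc pV; pose f s := inner g (c s) (V s) (V s).
suff H (s : R) : 0 <= s <= 1 -> is_derive s 1 f 0.
  have [s _ E] := MVT0 ltr01 H.
  by apply/eqP; rewrite -subr_eq0 -/(f 1) -/(f 0) E mul0r.
move=> t01; have [dW nW] := pV _ t01.
pose i := chart_at (c s); have ci := dom_chart_at (c s).
have hv := smooth_curve_velocity sc t01.
have dG : is_derive s 1 (gram g i \o (chart_map i \o c)) ('D_(velocity c s) (gram g i) (chart_map i (c s))).
  by apply: is_derive_comp hv; exact: differentiable_gram.
have D := derive_mxform dG (derivableP dW) (derivableP dW).
have E : 'D_1 (curve_field_coord c V s) s =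
   - christoffel_map g i (chart_map i (c s)) (velocity c s) (V s).
  by apply/eqP; rewrite -addr_eq0; apply/eqP.
have N' : \forall r \near s, mxform ((gram g i \o (chart_map i \o c)) r)
    (curve_field_coord c V s r) (curve_field_coord c V s r) = f r.
  apply: filterS (smooth_curve_near_dom sc t01) => r dr.
  by rewrite /f (inner_curve_field V dr).
apply: (near_eq_is_derive N'); apply: is_derive_eq D _.
rewrite E !curve_field_coord_at /= mxformNl mxformNr -(dgram_def g) (metric_compat hg) //.
by rewrite -/i; ring.
Qed.

Lemma transport_curve_unit c P : smooth_curve c -> transport_curve g c P -> P \in unitmx.
Proof.
move=> sc tP; rewrite -row_free_unit -kermx_eq0; apply/eqP/row_matrixP => a.
rewrite row0; set v := row a _.
have vP : v *m P = 0 by rewrite /v -row_mul mulmx_ker row0.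
have [V [pV V0 V1]] := tP v.
have := parallel_along_inner sc pV; rewrite V0 V1 vP.
rewrite /inner !mul0mx mxE => /esym E.
apply/eqP; apply: contraT => /(metric_pos hg (c 0)).
by rewrite /mxform E ltxx.
Qed.

Lemma reverse_smooth_curve c : smooth_curve c -> smooth_curve (reverse_curve c).
Proof.
move=> [D [oO O01 cc sc]]; exists (reverse_curve D); split.
- exact: open_reverse.
- by move=> t t01; apply: O01; move: t01; lra.
- move=> t Dt.
  exact: continuous_reverse (cc _ Dt).
- move=> i k; apply: (Ck_reverse _ (sc i k)).
  by apply: open_preimage_on => //; exact: dom_open.
Qed.

Lemma reverse_transport_curve c P : smooth_curve c -> transport_curve g c P ->
  transport_curve g (reverse_curve c) (invmx P).
Proof.
move=> sc tP v; have uP := transport_curve_unit sc tP.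
(* The field that starts at v *m invmx P ends at v, so read backwards it starts at v. *)
have [V [pV V0 V1]] := tP (v *m invmx P).
exists (reverse_curve V); split; rewrite /reverse_curve ?subr0 ?subrr //; last first.
  by rewrite V1 mulmxKV.
move=> t t01; have t01' : 0 <= 1 - t <= 1 by move: t01; lra.
have [dW nW] := pV _ t01'.
have E : curve_field_coord (reverse_curve c) (reverse_curve V) t =
   curve_field_coord c V (1 - t) \o (fun s => 1 - s) by [].
have dW' : differentiable (curve_field_coord c V (1 - t)) (1 - t) by exact/derivable1_diffP.
have D := is_derive_comp (h := fun s : R => 1 - s) dW' (is_derive_reverse t 1).
have dv : differentiable (chart_map (chart_at (c (1 - t))) \o c) (1 - t).
  by apply/derivable1_diffP; case: (smooth_curve_velocity sc t01').
have Dv := is_derive_comp (h := fun s : R => 1 - s) dv (is_derive_reverse t 1).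
have N1 (W : normedModType R) (f : R -> W) s : differentiable f s -> 'D_(-1) f s = - 'D_1 f s.
  by move=> df; rewrite -[in LHS](scaleN1r 1) deriveZr // scaleN1r.
split; first by rewrite -/(reverse_curve V) E; case: D.
have Ev : velocity (reverse_curve c) t = - velocity c (1 - t).
  by case: Dv => _; rewrite N1.
rewrite /nabla_curve -/(reverse_curve V) Ev.
have -> : 'D_1 (curve_field_coord (reverse_curve c) (reverse_curve V) t) t =
   - 'D_1 (curve_field_coord c V (1 - t)) (1 - t).
  by case: D => _ D; apply: (etrans D); exact: N1.
rewrite -[- velocity _ _]scaleN1r christoffel_mapZl scaleN1r -opprD.
by apply/eqP; rewrite oppr_eq0; apply/eqP; exact: nW.
Qed.

Lemma transport_cat s1 s2 P1 P2 : transport g s1 P1 -> transport g s2 P2 ->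
  transport g (s1 ++ s2) (P1 *m P2).
Proof.
elim: s1 P1 => [|c s1 IH] P1 /= => [->|[Pa [Pb [ta tb ->]]] t2]; first by rewrite mul1mx.
by exists Pa, (Pb *m P2); split=> //; [exact: IH | rewrite mulmxA].
Qed.

Lemma piecewise_smooth_cat p q r (s1 s2 : seq (R -> M)) :
  piecewise_smooth p s1 q -> piecewise_smooth q s2 r -> piecewise_smooth p (s1 ++ s2) r.
Proof.
by elim: s1 p => [|c s1 IH] p /= => [->//|[sc c0 ps] qs]; split=> //; exact: IH.
Qed.

Definition reverse_path (s : seq (R -> M)) := rev (map (@reverse_curve R M) s).

Lemma reverse_path_smooth p s q : piecewise_smooth p s q -> piecewise_smooth q (reverse_path s) p.
Proof.
elim: s p => [|c s IH] p /=; first by [].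
move=> [sc c0 ps]; rewrite /reverse_path /= rev_cons -cats1.
apply: piecewise_smooth_cat (IH _ ps) _; split.
- exact: reverse_smooth_curve.
- by rewrite /reverse_curve subr0.
- by rewrite /reverse_curve subrr.
Qed.

Lemma reverse_path_transport p s q P : piecewise_smooth p s q -> transport g s P ->
  P \in unitmx /\ transport g (reverse_path s) (invmx P).
Proof.
elim: s p P => [|c s IH] p P /=.
  by move=> _ ->; rewrite unitmx1 invmx1.
move=> [sc c0 ps] [P1 [P2 [t1 t2 ->]]].
have u1 := transport_curve_unit sc t1.
have [u2 r2] := IH _ _ ps t2.
split; first by rewrite unitmx_mul u1.
rewrite /reverse_path /= rev_cons -cats1.
have -> : invmx (P1 *m P2) = invmx P2 *m invmx P1.
  have u12 : P1 *m P2 \in unitmx by rewrite unitmx_mul u1.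
  by rewrite -[RHS]mulmx1 -(mulmxV u12) !mulmxA mulmxKV // mulVmx // mul1mx.
apply: transport_cat r2 _; exists (invmx P1), 1%:M.
by split; [exact: reverse_transport_curve | | rewrite mulmx1].
Qed.

End ParallelTransport.

Lemma piecewise_smooth_map (R : realType) (l m : nat) (N : manifold R l) (M : manifold R m)
    (F : N -> M) p s q : smooth_map F ->
  piecewise_smooth p s q -> piecewise_smooth (F p) [seq F \o c | c <- s] (F q).
Proof.
move=> sF; elim: s p => [|c s IH] p /= => [->//|[sc c0 ps]].
split; [exact: smooth_curve_comp | by rewrite /= c0 | exact: IH].
Qed.

(** * Linear differential equations *)

Section MatrixNorm.
Variable R : realType.

Lemma normr_mx_entry m n (A : 'M[R]_(m, n)) i j : `|A i j| <= `|A|.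
Proof. by rewrite [leRHS]/Num.norm /= mx_normrE; exact: (le_bigmax _ _ (i, j)). Qed.

Lemma normr_mx_le m n (A : 'M[R]_(m, n)) e : 0 <= e ->
  (forall i j, `|A i j| <= e) -> `|A| <= e.
Proof.
by move=> e0 H; rewrite [leLHS]/Num.norm /= mx_normrE bigmax_le // => -[i j] _; exact: H.
Qed.

(** The norm is the largest absolute value of an entry, which is submultiplicative only up to the
    inner dimension. *)
Lemma normr_mulmx m n p (A : 'M[R]_(m, n)) (B : 'M[R]_(n, p)) :
  `|A *m B| <= n%:R * (`|A| * `|B|).
Proof.
apply: normr_mx_le => [|i j]; first by rewrite !mulr_ge0.
rewrite mxE (le_trans (ler_norm_sum _ _ _)) //.
have -> : n%:R * (`|A| * `|B|) = \sum_(k < n) `|A| * `|B|.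
  by rewrite sumr_const card_ord mulr_natl.
by apply: ler_sum => k _; rewrite normrM ler_pM // normr_mx_entry.
Qed.

Lemma normr_mulmx_le m n p (A : 'M[R]_(m, n)) (B : 'M[R]_(n, p)) (a b : R) :
  `|A| <= a -> `|B| <= b -> `|A *m B| <= n%:R * (a * b).
Proof.
by move=> Aa Bb; rewrite (le_trans (normr_mulmx _ _)) // ler_wpM2l // ler_pM.
Qed.

Lemma mx_continuous m n (S : topologicalType) (f : S -> 'M[R]_(m, n)) x :
  (forall i j, {for x, continuous (fun y => f y i j)}) -> {for x, continuous f}.
Proof.
move=> H A /nbhs_ballP[e /= e0 He].
have : \forall y \near x, forall i j, ball (f x i j) e (f y i j).
  apply: filter_forall => i; apply: filter_forall => j.
  exact: H i j _ (nbhsx_ballx _ _ e0).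
by apply: filterS => y Hy; apply: He; split.
Qed.

Lemma continuous_sum n (S : topologicalType) (f : 'I_n -> S -> R) x :
  (forall k, {for x, continuous (f k)}) -> {for x, continuous (fun y => \sum_k f k y)}.
Proof.
elim: n f => [|n IH] f H.
  have -> : (fun y => \sum_k f k y) = cst 0 by apply/funext => y; rewrite big_ord0.
  exact: cvg_cst.
have -> : (fun y => \sum_k f k y) = f ord0 + (fun y => \sum_(k < n) f (lift ord0 k) y).
  by apply/funext => y; rewrite big_ord_recl.
by apply: cvgD; [exact: H | apply: IH => k; exact: H].
Qed.

Lemma mulmx_continuous m n p (S : topologicalType) (f : S -> 'M[R]_(m, n)) (g : S -> 'M[R]_(n, p)) x :
  {for x, continuous f} -> {for x, continuous g} -> {for x, continuous (fun y => f y *m g y)}.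
Proof.
move=> cf cg; apply: mx_continuous => i j.
have -> : (fun y => (f y *m g y) i j) = (fun y => \sum_k f y i k * g y k j).
  by apply/funext => y; rewrite mxE.
apply: continuous_sum => k; apply: cvgM.
  exact: (continuous_comp (g := fun M : 'M[R]_(m, n) => M i k) cf (@coord_continuous _ _ _ _ _ _)).
exact: (continuous_comp (g := fun M : 'M[R]_(n, p) => M k j) cg (@coord_continuous _ _ _ _ _ _)).
Qed.

Lemma normr_mx_mvt m n (D d : R -> 'M[R]_(m, n)) (a b s t C : R) :
  a < s -> s <= t -> t < b ->
  (forall r, a < r < b -> is_derive r 1 D (d r)) ->
  (forall r, s <= r <= t -> `|d r| <= C) ->
  `|D t - D s| <= C * (t - s).
Proof.
move=> as_ st tb dD dC.
have C0 : 0 <= C.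
  by apply: (le_trans (normr_ge0 (d s))); apply: dC; rewrite lexx.
apply: normr_mx_le => [|i j]; first by rewrite mulr_ge0 // subr_ge0.
have H r : s <= r <= t -> is_derive r 1 (fun r => D r i j) (d r i j).
  by move=> rst; apply: (is_derive_mxP _ _ _ _).1; apply: dD; move: rst as_ tb; lra.
have [|c|c] := @MVT_segment R (fun r => D r i j) (fun r => d r i j) s t st.
- by move=> r; rewrite in_itv /= => /andP[r1 r2]; apply: H; rewrite !ltW.
- apply: derivable_within_continuous => r; rewrite in_itv /= => rst.
  by case: (H r rst).
- rewrite in_itv /= => cst E; rewrite !mxE E normrM [X in _ * X]ger0_norm ?subr_ge0 //.
  by rewrite ler_wpM2r ?subr_ge0 // (le_trans (normr_mx_entry _ _ _)) // dC.
Qed.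

(** The factor 2 is the largest distance from 0 within [-1, 2], the range of [clamp]. *)
Lemma normr_mx_mvt0 m n (D d : R -> 'M[R]_(m, n)) (a b t C : R) :
  a < 0 -> 0 < b -> a < t < b -> `|t| <= 2 -> D 0 = 0 ->
  (forall r, a < r < b -> is_derive r 1 D (d r)) ->
  (forall r, `|d r| <= C) -> `|D t| <= 2 * C.
Proof.
move=> a0 b0 /andP[at_ tb] t2 D0 dD dC.
have C0 : 0 <= C by exact: le_trans (normr_ge0 (d 0)) (dC 0).
have [t0|t0] := leP 0 t.
  have := normr_mx_mvt a0 t0 tb dD (fun r _ => dC r).
  rewrite D0 !subr0 => /le_trans; apply; rewrite mulrC ler_wpM2r //.
  by rewrite (le_trans (ler_norm _)).
have := normr_mx_mvt at_ (ltW t0) b0 dD (fun r _ => dC r).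
rewrite D0 !sub0r normrN => /le_trans; apply; rewrite mulrC ler_wpM2r //.
by rewrite (le_trans _ t2) // -normrN ler_norm.
Qed.

End MatrixNorm.

Section Primitive.
Variable R : realType.
Local Notation mu := (@lebesgue_measure R).

(** The base point -2 lies to the left of every time in use, so that negative times are interior
    points for the fundamental theorem of calculus; the second integral normalizes the primitive to
    vanish at 0. *)
Definition prim (f : R -> R) (t : R) : R :=
  \int[mu]_(s in `[- 2, t]) f s - \int[mu]_(s in `[- 2, 0]) f s.

Lemma prim0 f : prim f 0 = 0.
Proof. by rewrite /prim subrr. Qed.

Lemma is_derive_prim (f : R -> R) (t : R) : continuous f -> - 2 < t < 3 -> is_derive t 1 (prim f) (f t).
Proof.
move=> cf /andP[t2 t3].
have int : mu.-integrable `[- 2, 3] (EFin \o f).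
  apply: continuous_compact_integrable; first exact: segment_compact.
  exact: continuous_subspaceT.
have [d D] := continuous_FTC1_closed t3 int t2 (cf t).
have -> : prim f = (fun y => \int[mu]_(s in `[- 2, y]) f s) - cst (\int[mu]_(s in `[- 2, 0]) f s).
  by [].
apply: is_derive_eq (is_deriveB (DeriveDef d _) (is_derive_cst _ t 1)) _; last first.
  by rewrite subr0.
by rewrite -derive1E D.
Qed.

Definition mxprim m n (f : R -> 'M[R]_(m, n)) (t : R) : 'M[R]_(m, n) :=
  \matrix_(i, j) prim (fun s => f s i j) t.

Lemma mxprim0 m n (f : R -> 'M[R]_(m, n)) : mxprim f 0 = 0.
Proof. by apply/matrixP => i j; rewrite !mxE prim0. Qed.

Lemma is_derive_mxprim m n (f : R -> 'M[R]_(m, n)) (t : R) : continuous f -> - 2 < t < 3 ->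
  is_derive t 1 (mxprim f) (f t).
Proof.
move=> cf t23; apply/is_derive_mxP => i j.
have -> : (fun y => mxprim f y i j) = prim (fun s => f s i j).
  by apply/funext => y; rewrite mxE.
apply: is_derive_prim => // s.
exact: (continuous_comp (g := fun M : 'M[R]_(m, n) => M i j) (cf s) (@coord_continuous _ _ _ _ _ _)).
Qed.

(** Truncation to [-1, 2], which contains [0, 1] in its interior. Composing with it makes the Picard
    iterates continuous and uniformly controlled on the whole line. *)
Definition clamp (t : R) : R := Num.max (- 1) (Num.min t 2).

Lemma clampP t : - 2 < clamp t < 3 /\ `|clamp t| <= 2.
Proof.
rewrite /clamp; case: (ltP t 2) => h; rewrite /Num.max.
  case: ifP => h'; split; rewrite ?ler_norml; lra.
case: ifP => h'; split; rewrite ?ler_norml; lra.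
Qed.

Lemma clamp_id t : - 1 <= t <= 2 -> clamp t = t.
Proof. by move=> /andP[t1 t2]; rewrite /clamp min_l // max_r. Qed.

Lemma clamp_continuous : continuous clamp.
Proof.
move=> t; have -> : clamp = cst (- 1) \max (id \min cst 2) by [].
apply: continuous_max; first exact: cvg_cst.
by apply: continuous_min; [exact: cvg_id | exact: cvg_cst].
Qed.

End Primitive.

(** * Picard iteration for a linear equation with small coefficients *)

Section LinearODE.
Variable R : realType.

(** The intervals of radius 2 * 2^-1 ^+ k about a k are nested, and the supremum of their left ends
    belongs to all of them. *)
Lemma geometric_limit (a : nat -> R) :
  (forall k, `|a k.+1 - a k| <= 2^-1 ^+ k) ->
  forall k, `|sup (range (fun j => a j - 2 * 2^-1 ^+ j)) - a k| <= 2 * 2^-1 ^+ k.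
Proof.
move=> H; set b := fun j => a j - 2 * 2^-1 ^+ j.
have step k : b k <= b k.+1 /\ a k.+1 + 2 * 2^-1 ^+ k.+1 <= a k + 2 * 2^-1 ^+ k.
  have := H k; rewrite /b exprS; move: (2^-1 ^+ k) => p; rewrite ler_norml; lra.
have nd : {homo b : i j / (i <= j)%N >-> i <= j}.
  by apply: homo_leq; [exact: lexx | exact: le_trans | move=> k; case: (step k)].
have ni : {homo (fun k => a k + 2 * 2^-1 ^+ k) : i j / (i <= j)%N >-> j <= i}.
  apply: homo_leq; [exact: lexx | move=> x y z h1 h2; exact: le_trans h2 h1 |].
  by move=> k; case: (step k).
have p0 k : 0 < 2 * (2^-1 : R) ^+ k by rewrite mulr_gt0 // exprn_gt0.
have ub k : ubound (range b) (a k + 2 * 2^-1 ^+ k).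
  move=> _ [j _ <-]; have [jk|kj] := leqP j k.
    apply: le_trans (nd _ _ jk) _; rewrite /b; have := p0 k; lra.
  apply: le_trans (ni _ _ (ltnW kj)); rewrite /b; have := p0 j; lra.
have hs : has_sup (range b) by split; [exists (b 0%N), 0%N | exists (a 0%N + 2 * 2^-1 ^+ 0); exact: ub].
move=> k; have h1 : b k <= sup (range b) by apply: ub_le_sup; [exact: hs.2 | exists k].
have h2 : sup (range b) <= a k + 2 * 2^-1 ^+ k by apply: ge_sup; [exact: hs.1 | exact: ub].
rewrite ler_norml; move: h1 h2; rewrite /b; lra.
Qed.

Lemma half_expn_small (e : R) : 0 < e -> exists k, 2^-1 ^+ k < e.
Proof.
move=> e0; have : (fun k => (2^-1 : R) ^+ k) @ \oo --> 0.
  by apply: cvg_expr; rewrite ger0_norm //; lra.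
move=> /cvgrPdist_lt/(_ _ e0)[N _ H]; exists N.
by have := H N (leqnn N); rewrite /= sub0r normrN ger0_norm // exprn_ge0.
Qed.

Let halves_le (e p : R) : 0 < e -> p < e / 8 -> 2 * (2^-1 * p) + 2^-1 * (2 * p) <= e.
Proof. lra. Qed.

Variables (m : nat) (B : R -> 'M[R]_m) (b : R).
Hypotheses (cB : continuous B) (Bb : forall t, `|B t| <= b) (small : 4 * m.+1%:R * b <= 1).

Let picard := fix picard k : R -> 'M[R]_m :=
  if k is k'.+1 then fun t => 1%:M + mxprim (fun s => picard k' s *m B s) (clamp t)
  else fun=> 1%:M.

Let b0 : 0 <= b. Proof. exact: le_trans (normr_ge0 _) (Bb 0). Qed.

(** The second bound makes the Picard operator contract by 1/2; the first bounds the initial step by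
    1. Having m.+1 in the smallness hypothesis yields both for every m, including 0. *)
Let b_small : 2 * b <= 1 /\ 2 * (m%:R * b) <= 2^-1.
Proof.
have := small; have -> : m.+1%:R = m%:R + 1 :> R by rewrite natr1.
have := b0; have : 0 <= m%:R * b by rewrite mulr_ge0.
by rewrite mulrDr mulrDl mulr1 -[4 * m%:R * b]mulrA; lra.
Qed.

Let mulmxB_continuous (u : R -> 'M[R]_m) : continuous u -> continuous (fun s => u s *m B s).
Proof. by move=> cu s; apply: mulmx_continuous; [exact: cu | exact: cB]. Qed.

Let primB_continuous (u : R -> 'M[R]_m) : continuous u ->
  continuous (fun t => 1%:M + mxprim (fun s => u s *m B s) (clamp t)).
Proof.
move=> cu t; apply: cvgD; first exact: cvg_cst.
apply: (@continuous_comp _ _ _ (@clamp R) (mxprim (fun s => u s *m B s))).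
  exact: clamp_continuous.
apply: differentiable_continuous; apply/derivable1_diffP.
by have [] := is_derive_mxprim (mulmxB_continuous cu) (clampP t).1.
Qed.

Let primB_dist (u v : R -> 'M[R]_m) (C : R) : continuous u -> continuous v ->
  (forall s, `|u s - v s| <= C) -> forall t,
  `|mxprim (fun s => u s *m B s) (clamp t) - mxprim (fun s => v s *m B s) (clamp t)|
    <= 2 * (m%:R * b) * C.
Proof.
move=> cu cv uv t; have [t23 t2] := clampP t.
have D (r : R) : - 2 < r < 3 -> is_derive r 1
  (mxprim (fun s => u s *m B s) - mxprim (fun s => v s *m B s)) (u r *m B r - v r *m B r).
  by move=> r23; apply: is_deriveB; apply: is_derive_mxprim => //; exact: mulmxB_continuous.
have := normr_mx_mvt0 (C := m%:R * (C * b)) _ _ t23 t2 _ D _.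
rewrite -!mulrA [b * C]mulrC; apply; [lra | lra | |].
- by rewrite !fctE !mxprim0 subrr.
- by move=> r; rewrite -mulmxBl; exact: normr_mulmx_le.
Qed.

Let picard_continuous k : continuous (picard k).
Proof.
elim: k => [|k IH]; first by move=> t; exact: cvg_cst.
exact: primB_continuous.
Qed.

Let picard_step k t : `|picard k.+1 t - picard k t| <= 2^-1 ^+ k.
Proof.
elim: k t => [|k IH] t.
  rewrite /= [_ - _]addrC addKr expr0.
  have [t23 t2] := clampP t.
  have c1 : continuous (fun s => 1%:M *m B s) by apply: mulmxB_continuous => s; exact: cvg_cst.
  have h := normr_mx_mvt0 (C := b) _ _ t23 t2 (mxprim0 _) (fun r => is_derive_mxprim c1) _.
  apply: le_trans (h _ _ _) b_small.1; [lra | lra |].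
  by move=> r; rewrite mul1mx.
rewrite [picard k.+2]/= [X in _ - X]/= opprD addrACA subrr add0r exprS.
apply: le_trans (primB_dist (@picard_continuous k.+1) (@picard_continuous k) IH t) _.
by rewrite ler_wpM2r ?exprn_ge0 //; exact: b_small.2.
Qed.

Let sol t : 'M[R]_m :=
  \matrix_(i, j) sup (range (fun k => picard k t i j - 2 * 2^-1 ^+ k)).

Let sol_dist k t : `|sol t - picard k t| <= 2 * 2^-1 ^+ k.
Proof.
apply: normr_mx_le => [|i j]; first by rewrite mulr_ge0 // exprn_ge0.
have sub (A C : 'M[R]_m) : (A - C) i j = A i j - C i j by rewrite !mxE.
rewrite sub [X in X - _]mxE; apply: (geometric_limit (a := fun k => picard k t i j)) => {}k.
by rewrite -sub; exact: le_trans (normr_mx_entry _ i j) (picard_step k t).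
Qed.

Let sol_continuous : continuous sol.
Proof.
move=> t; apply/cvgrPdist_le => e e0.
have e8 : 0 < e / 8 by rewrite divr_gt0.
have [k ke] := half_expn_small e8.
have e2 : 0 < e / 2 by rewrite divr_gt0.
apply: filterS ((cvgrPdist_le _ _).1 (@picard_continuous k t) _ e2) => s H.
have h1 := sol_dist k t; have h2 := sol_dist k s.
have -> : sol t - sol s = (sol t - picard k t) + (picard k t - picard k s) - (sol s - picard k s).
  by rewrite opprB addrA addrA !subrK.
apply: le_trans (ler_normB _ _) _; have := ler_normD (sol t - picard k t) (picard k t - picard k s).
move: H h1 h2 ke; lra.
Qed.

(** The iterate of index k.+1 is close to [sol], and by contraction also to the right-hand side,
    with both errors of order 2^-1 ^+ k. *)
Let sol_eq t : sol t = 1%:M + mxprim (fun s => sol s *m B s) (clamp t).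
Proof.
apply/eqP; rewrite -subr_eq0 -normr_le0; apply/ler_addgt0Pr => e e0; rewrite add0r.
have e8 : 0 < e / 8 by rewrite divr_gt0.
have [k ke] := half_expn_small e8.
have h1 := sol_dist k.+1 t.
have h2 := primB_dist (@picard_continuous k) sol_continuous (C := 2 * 2^-1 ^+ k) _ t.
set W := 1%:M + mxprim _ _.
have -> : sol t - W = (sol t - picard k.+1 t) + (picard k.+1 t - W) by rewrite addrA subrK.
have h3 : `|picard k.+1 t - W| <= 2 * (m%:R * b) * (2 * 2^-1 ^+ k).
  rewrite /W [picard k.+1]/= opprD addrACA subrr add0r; apply: h2 => s.
  by rewrite -normrN opprB; exact: sol_dist.
apply: le_trans (ler_normD _ _) _.
have h4 : 2 * (m%:R * b) * (2 * 2^-1 ^+ k) <= 2^-1 * (2 * 2^-1 ^+ k).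
  by rewrite ler_wpM2r ?mulr_ge0 ?exprn_ge0 //; exact: b_small.2.
apply: le_trans (lerD h1 (le_trans h3 h4)) _.
by rewrite exprS; exact: halves_le e0 ke.
Qed.

(** The unknown stands to the left of B because vectors are rows. The last bound, linear in b, is
    what makes the second-order error of transport along a short line controllable. *)
Theorem linear_ode : exists Q : R -> 'M[R]_m, [/\ Q 0 = 1%:M,
  forall t : R, - 1 < t < 2 -> is_derive t 1 Q (Q t *m B t) &
  forall t, `|Q t - 1%:M| <= 6 * m%:R * b].
Proof.
exists sol; split.
- by rewrite sol_eq clamp_id ?mxprim0 ?addr0 //; lra.
- move=> t /andP[t1 t2].
  have N : \forall s \near t, (cst 1%:M + mxprim (fun s => sol s *m B s)) s = sol s.
    near=> s; rewrite sol_eq clamp_id //; apply/andP; split; apply: ltW; near: s.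
      exact: lt_nbhsr.
    exact: lt_nbhsl.
  apply: (near_eq_is_derive N).
  apply: is_derive_eq (is_deriveD (is_derive_cst _ t 1) (is_derive_mxprim _ _)) _.
  + exact: mulmxB_continuous.
  + lra.
  + by rewrite add0r.
- move=> t; rewrite sol_eq [_ - _]addrC addKr.
  have [t23 t2] := clampP t.
  have := normr_mx_mvt0 (C := m%:R * (3 * b)) _ _ t23 t2 (mxprim0 _)
     (fun r => is_derive_mxprim (mulmxB_continuous sol_continuous)) _.
  (* The 3 bounds the norm of [sol], which stays within 2 of the identity matrix, and the 2 comes
     from [normr_mx_mvt0]. *)
  have -> : 6 * m%:R * b = 2 * (m%:R * (3 * b)) by ring.
  apply; [lra | lra |] => r; apply: normr_mulmx_le => //.
  have := sol_dist 0 r; rewrite expr0 mulr1 /= => h.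
  rewrite -(subrK 1%:M (sol r)); apply: le_trans (ler_normD _ _) _.
  have : `|1%:M : 'M[R]_m| <= 1.
    apply: normr_mx_le => // i j; rewrite mxE; by case: eqP; rewrite ?normr1 ?normr0.
  move: h; lra.
Unshelve. all: by end_near. Qed.

End LinearODE.

(** * Transport along coordinate lines *)

Section InverseContinuous.
Variables (R : realType) (S : topologicalType).

Lemma continuous_bigsum (I : Type) (r : seq I) (P : pred I) (f : I -> S -> R) x :
  (forall k, {for x, continuous (f k)}) ->
  {for x, continuous (fun y => \sum_(k <- r | P k) f k y)}.
Proof.
move=> H; elim: r => [|a r IH].
  have -> : (fun y => \sum_(k <- [::] | P k) f k y) = cst 0 by apply/funext => y; rewrite big_nil.
  exact: cvg_cst.
have -> : (fun y => \sum_(k <- a :: r | P k) f k y) =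
    (if P a then f a else cst 0) + (fun y => \sum_(k <- r | P k) f k y).
  by apply/funext => y; rewrite big_cons fctE; case: ifP => //; rewrite add0r.
by apply: cvgD => //; case: ifP => _; [exact: H | exact: cvg_cst].
Qed.

Lemma continuous_bigprod (I : Type) (r : seq I) (P : pred I) (f : I -> S -> R) x :
  (forall k, {for x, continuous (f k)}) ->
  {for x, continuous (fun y => \prod_(k <- r | P k) f k y)}.
Proof.
move=> H; elim: r => [|a r IH].
  have -> : (fun y => \prod_(k <- [::] | P k) f k y) = cst 1 by apply/funext => y; rewrite big_nil.
  exact: cvg_cst.
have -> : (fun y => \prod_(k <- a :: r | P k) f k y) =
    (if P a then f a else cst 1) * (fun y => \prod_(k <- r | P k) f k y).
  by apply/funext => y; rewrite big_cons fctE; case: ifP => //; rewrite mul1r.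
by apply: cvgM => //; case: ifP => _; [exact: H | exact: cvg_cst].
Qed.

Lemma det_continuous n (A : S -> 'M[R]_n) x :
  (forall i j, {for x, continuous (fun y => A y i j)}) -> {for x, continuous (fun y => \det (A y))}.
Proof.
move=> H; apply: continuous_bigsum => s; apply: cvgM; first exact: cvg_cst.
exact: continuous_bigprod.
Qed.

(** [invmx] is defined by cases on invertibility; near x it coincides with Cramer's formula, which
    is continuous. This is where continuity of the Christoffel symbols comes from. *)
Lemma invmx_continuous n (A : S -> 'M[R]_n) x : (\forall y \near x, A y \in unitmx) ->
  {for x, continuous A} -> {for x, continuous (fun y => invmx (A y))}.
Proof.
move=> uA cA.
have cE i j : {for x, continuous (fun y => A y i j)}.
  exact: (continuous_comp (g := fun M : 'M[R]_n => M i j) cA (@coord_continuous _ _ _ _ _ _)).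
have N : \forall y \near x, (\det (A y))^-1 *: \adj (A y) = invmx (A y).
  by apply: filterS uA => y uy; rewrite /invmx uy.
suff c : (fun y => (\det (A y))^-1 *: \adj (A y)) @ x --> invmx (A x).
  exact: cvg_trans (near_eq_cvg N) c.
rewrite -(nbhs_singleton N).
apply: (@mx_continuous _ _ _ _ (fun y => (\det (A y))^-1 *: \adj (A y))) => i j.
have -> : (fun y => ((\det (A y))^-1 *: \adj (A y)) i j) =
   (fun y => (\det (A y))^-1 * ((-1) ^+ (j + i) * \det (row' j (col' i (A y))))).
  by apply/funext => y; rewrite !mxE.
apply: cvgM.
  apply: cvgV; last exact: det_continuous.
  by move: (nbhs_singleton uA); rewrite unitmxE unitfE.
apply: cvgM; first exact: cvg_cst.
apply: det_continuous => a b.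
have -> : (fun y => row' j (col' i (A y)) a b) = (fun y => A y (lift j a) (lift i b)).
  by apply/funext => y; rewrite !mxE.
exact: cE.
Qed.

End InverseContinuous.

(** Splits the derivative of the error of transport: with B and A - 1 of the size of the
    displacement, the first term is of second order, and the second one measures the variation of
    the Christoffel symbols along the line. *)
Lemma addmulmxB1 (R : pzRingType) n (A B C : 'M[R]_n) :
  A *m B + C = (A - 1%:M) *m B + (B + C).
Proof. by rewrite mulmxBl mul1mx addrA subrK. Qed.

Lemma near_norm_le (R : realType) (V : normedModType R) (x0 : V) (C e : R) : 0 <= C -> 0 < e ->
  \forall x \near x0, C * `|x - x0| <= e.
Proof.
move=> C0 e0; have d0 : 0 < e / (C + 1) by rewrite divr_gt0 // ltr_wpDl.
apply: filterS (nbhsx_ballx x0 _ d0) => x; rewrite -ball_normE /= distrC.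
rewrite ltr_pdivlMr ?ltr_wpDl // => /ltW; apply: le_trans.
by rewrite mulrC ler_wpM2l // lerDl.
Qed.

Section LineTransport.
Variables (R : realType) (m : nat) (M : manifold R m) (g : M -> 'M[R]_m).
Hypothesis hg : riemannian_metric g.
Implicit Types (i k : chart M).

Lemma christoffel_continuous i y c a b : dom i y ->
  {for chart_map i y, continuous (fun u => christoffel g i u c a b)}.
Proof.
move=> iy.
have cg v : {for chart_map i y, continuous ('D_v (gram g i))}.
  by case: hg => _ _ /(_ i 1%N)[_ /(_ v)]; apply; exists y.
have ce (A : 'rV[R]_m -> 'M[R]_m) p q : {for chart_map i y, continuous A} ->
    {for chart_map i y, continuous (fun u => A u p q)}.
  move=> cA; exact: (continuous_comp (g := fun M : 'M[R]_m => M p q) cA (@coord_continuous _ _ _ _ _ _)).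
have -> : (fun u => christoffel g i u c a b) = cst 2^-1 * (fun u => \sum_d invmx (gram g i u) c d *
    (pd (gram g i) a u b d + pd (gram g i) b u a d - pd (gram g i) d u a b)) by [].
apply: continuousM; first exact: cst_continuous.
apply: continuous_bigsum => d; apply: continuousM.
  apply: (ce (fun u => invmx (gram g i u))); apply: invmx_continuous.
    by apply: filterS (near_dom iy) => u [z iz <-]; exact: gram_unit.
  by apply: differentiable_continuous; exact: differentiable_gram.
by apply: continuousB; [apply: continuousD|]; apply: (ce (pd (gram g i) _)); exact: cg.
Qed.

Lemma christoffel_mx_continuous i y v : dom i y ->
  {for chart_map i y, continuous (fun u => christoffel_mx g i u v)}.
Proof.
move=> iy; apply: mx_continuous => b c.
have -> : (fun u => christoffel_mx g i u v b c) = (fun u => \sum_a christoffel g i u c a b * v 0 a).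
  by apply/funext => u; rewrite mxE.
apply: continuous_bigsum => a.
apply: continuousM; [exact: christoffel_continuous | exact: cst_continuous].
Qed.

Lemma christoffel_mxN i u v : christoffel_mx g i u (- v) = - christoffel_mx g i u v.
Proof.
by apply/matrixP => b c; rewrite !mxE -sumrN; apply: eq_bigr => a _; rewrite mxE mulrN.
Qed.

Lemma near_christoffel_mx i y (e : R) : dom i y -> 0 < e ->
  \forall u \near chart_map i y, forall v,
    `|christoffel_mx g i u v - christoffel_mx g i (chart_map i y) v| <= e * `|v|.
Proof.
move=> iy e0; pose e1 := e / m.+1%:R.
have e10 : 0 < e1 by rewrite divr_gt0.
have N : \forall u \near chart_map i y, forall c a b,
    `|christoffel g i (chart_map i y) c a b - christoffel g i u c a b| < e1.
  pose P c a b u := `|christoffel g i (chart_map i y) c a b - christoffel g i u c a b| < e1.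
  have F : Filter (nbhs (chart_map i y)) by exact: nbhs_filter.
  have HP c a b : \forall u \near chart_map i y, P c a b u.
    by move/cvgrPdist_lt: (@christoffel_continuous i y c a b iy) => /(_ _ e10).
  exact (@filter_forall _ _ (fun c u => forall a b, P c a b u) _ F (fun c =>
    @filter_forall _ _ (fun a u => forall b, P c a b u) _ F (fun a =>
    @filter_forall _ _ (fun b u => P c a b u) _ F (HP c a)))).
apply: filterS N => u H v; apply: normr_mx_le => [|b c]; first by rewrite mulr_ge0 // ltW.
rewrite !mxE -sumrB; apply: le_trans (ler_norm_sum _ _ _) _.
apply: (@le_trans _ _ (\sum_(a < m) e1 * `|v|)).
  apply: ler_sum => a _; rewrite -mulrBl normrM ler_pM //; last exact: normr_mx_entry.
  by rewrite distrC ltW.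
rewrite sumr_const card_ord -mulr_natl mulrA ler_wpM2r //.
by rewrite /e1 mulrCA ger_pMr // ler_pdivrMr // mul1r ler_nat.
Qed.

Lemma christoffel_mx_bounded i u : exists2 K : R, 0 <= K &
  forall v, `|christoffel_mx g i u v| <= K * `|v|.
Proof.
exists (\sum_c \sum_a \sum_b `|christoffel g i u c a b|).
  by do 3![apply: sumr_ge0 => ? _].
move=> v; apply: normr_mx_le => [|b c].
  by rewrite mulr_ge0 //; do 3![apply: sumr_ge0 => ? _].
rewrite mxE; apply: le_trans (ler_norm_sum _ _ _) _.
apply: (@le_trans _ _ (\sum_a `|christoffel g i u c a b| * `|v|)).
  by apply: ler_sum => a _; rewrite normrM ler_wpM2l // normr_mx_entry.
rewrite -mulr_suml ler_wpM2r // [leRHS](bigD1 c) //= ler_wpDr //.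
  by do 3![apply: sumr_ge0 => ? _].
by apply: ler_sum => a _; rewrite [leRHS](bigD1 b) //= ler_wpDr // sumr_ge0.
Qed.

(** The line has velocity w and reaches y at time 1. The final estimate says that transport along it
    is the identity minus the Christoffel matrix at y applied to w, up to o(|w|). *)
Lemma line_ode i y (e : R) : dom i y -> 0 < e ->
  \forall x \near chart_map i y, exists Q : R -> 'M[R]_m,
    let w := chart_map i y - x in
    [/\ Q 0 = 1%:M,
      forall t : R, - 1 < t < 2 -> is_derive t 1 Q (- (Q t *m christoffel_mx g i (x + t *: w) w)),
      forall t, - 1 <= t <= 2 -> (chart_map i @` dom i) (x + t *: w) &
      `|Q 1 - 1%:M + christoffel_mx g i (chart_map i y) w| <= e * `|x - chart_map i y|].
Proof.
move=> iy e0; set x0 := chart_map i y.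
have [K K0 HK] := christoffel_mx_bounded i x0.
pose Mm : R := m%:R; have M0 : 0 <= Mm by [].
pose e1 := e / (2 * (Mm + 1)).
have e10 : 0 < e1 by rewrite divr_gt0 // mulr_gt0 // ltr_wpDl.
have N : nbhs x0 ((chart_map i @` dom i) `&` [set u | forall v,
    `|christoffel_mx g i u v - christoffel_mx g i x0 v| <= e1 * `|v|]).
  by apply: filterI; [exact: near_dom | exact: near_christoffel_mx].
have /nbhs_ballP[r /= r0 Hr] := N.
have r20 : 0 < r / 2 / 2 by rewrite !divr_gt0.
pose c1 := K + e1; have c10 : 0 <= c1 by rewrite addr_ge0 // ltW.
have e20 : 0 < e / 2 by rewrite divr_gt0.
(* Three conditions on the distance d from x to x0: the line over [-1, 2] stays in the ball of
   radius r, as |1 - t| is at most 2 there; [linear_ode] applies; and the quadratic error is at most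
   e / 2 * d. *)
have n1 := near_norm_le x0 ler01 r20.
have p2 : 0 <= 4 * m.+1%:R * c1 by rewrite !mulr_ge0.
have n2 := near_norm_le x0 p2 ltr01.
have p3 : 0 <= 6 * Mm * c1 * (Mm * c1) by rewrite !mulr_ge0.
have n3 := near_norm_le x0 p3 e20.
apply: filterS (filterI n1 (filterI n2 n3)) => x [dr0 [s1 s2]].
move: dr0 s1 s2; set w := x0 - x; set d := `|x - x0| => dr0 s1 s2.
have wd : `|w| = d by rewrite /w distrC.
have d0 : 0 <= d by exact: normr_ge0.
have dr : d * 2 < r by move: dr0; rewrite mul1r; lra.
have seg t : - 1 <= t <= 2 -> ball x0 r (x + t *: w).
  move=> t12; rewrite -ball_normE /=.
  have -> : x0 - (x + t *: w) = (1 - t) *: w.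
    by rewrite opprD addrA -/w scalerBl scale1r.
  rewrite normrZ wd; apply: le_lt_trans dr; rewrite mulrC ler_wpM2l //.
  by rewrite ler_norml; lra.
pose B t := - christoffel_mx g i (x + clamp t *: w) w.
have Hball t : ball x0 r (x + clamp t *: w).
  by apply: seg; rewrite /clamp; case: (ltP t 2) => ?; rewrite /Num.max; case: ifP => ?; lra.
have cB : continuous B.
  move=> t; apply: cvgN.
  have [y' iy' E] := (Hr _ (Hball t)).1.
  apply: (@continuous_comp _ _ _ (fun t => x + clamp t *: w) (fun u => christoffel_mx g i u w)).
    apply: cvgD; first exact: cvg_cst.
    by apply: cvgZr_tmp; exact: clamp_continuous.
  by rewrite -E; exact: christoffel_mx_continuous.
have dB t : `|B t + christoffel_mx g i x0 w| <= e1 * d.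
  by rewrite addrC distrC -wd; exact: (Hr _ (Hball t)).2.
have bB t : `|B t| <= c1 * d.
  have -> : B t = (B t + christoffel_mx g i x0 w) - christoffel_mx g i x0 w by rewrite addrK.
  apply: le_trans (ler_normB _ _) _; have := HK w; rewrite wd => h.
  by rewrite /c1 mulrDl addrC lerD.
have small : 4 * m.+1%:R * (c1 * d) <= 1 by rewrite mulrA.
have [Q [Q0 DQ bQ]] := linear_ode cB bB small.
exists Q; split => //.
- move=> t t12; have := DQ t t12; rewrite /B clamp_id ?mulmxN //.
  by move: t12 => /andP[? ?]; rewrite !ltW.
- by move=> t t12; exact: (Hr _ (seg t t12)).1.
pose G0 := christoffel_mx g i x0 w.
have DD (t : R) : - 1 < t < 2 -> is_derive t 1 (Q + (fun s : R => s *: G0)) (Q t *m B t + G0).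
  move=> t12; apply: is_deriveD; first exact: DQ.
  have -> : (fun s : R => s *: G0) = (fun s : R => 0 + s *: G0).
    by apply/funext => s; rewrite add0r.
  exact: is_derive_line.
have := normr_mx_mvt (s := 0) (t := 1) (C := Mm * (6 * Mm * (c1 * d) * (c1 * d)) + e1 * d) _ _ _ DD _.
rewrite !fctE Q0 scale0r addr0 scale1r subr0 mulr1 addrAC => H.
apply: le_trans (H _ _ _ _) _; [lra | lra | lra | |].
  move=> t t01.
  rewrite (addmulmxB1 (Q t) (B t) G0).
  apply: le_trans (ler_normD _ _) _; apply: lerD (dB t).
  exact: normr_mulmx_le (bQ t) (bB t).
rewrite [leRHS](_ : _ = e / 2 * d + e / 2 * d); last by rewrite -mulrDl -splitr.
apply: lerD.
  have -> : Mm * (6 * Mm * (c1 * d) * (c1 * d)) = (6 * Mm * c1 * (Mm * c1) * d) * d by ring.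
  by rewrite ler_wpM2r.
rewrite ler_wpM2r // /e1 invfM mulrA ger_pMr // invf_le1 ?ltr_wpDl // lerDr //.
Unshelve. all: by end_near. Qed.

Lemma Ck_line (d : nat) (U : set R) (x w : 'rV[R]_m) : open U -> Ck d U (fun t : R => x + t *: w).
Proof.
move=> oU; apply/Ck_mxP => // a b.
have -> : (fun t : R => (x + t *: w) a b) = (fun t => x a b + t * w a b).
  by apply/funext => t; rewrite !mxE.
apply: CkD => //; first exact: Ck_cst.
apply: CkM => //; last exact: Ck_cst.
case: d => [|d]; first by move=> t _; exact: cvg_id.
split=> // v; have -> : 'D_v (id : R -> R) = (fun=> v) by apply/funext => t; exact: derive_id.
exact: Ck_cst.
Qed.

Section Line.
Variables (i : chart M) (x w : 'rV[R]_m).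
Hypothesis seg : forall t, - 1 <= t <= 2 -> (chart_map i @` dom i) (x + t *: w).

Definition line_curve (t : R) : M := chart_inv i (x + t *: w).

Lemma line_curveP t : - 1 <= t <= 2 ->
  dom i (line_curve t) /\ chart_map i (line_curve t) = x + t *: w.
Proof. by move=> /seg/chart_invK. Qed.

Let D := [set t : R | - 1 < t < 2].

Let oD : open D.
Proof.
have -> : D = [set` `]-1, 2[ ] by apply/seteqP; split => t; rewrite /= in_itv.
exact: interval_open.
Qed.

Let DW t : D t -> - 1 <= t <= 2. Proof. by move=> /andP[? ?]; rewrite !ltW. Qed.

Lemma line_curve_continuous t : - 1 < t < 2 -> {for t, continuous line_curve}.
Proof.
move=> t12; apply: (@continuous_comp _ _ _ (fun t : R => x + t *: w) (chart_inv i)).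
  by apply: cvgD; [exact: cvg_cst | apply: cvgZr_tmp; exact: cvg_id].
by apply: chart_inv_continuous; apply: seg; exact: DW.
Qed.

Lemma line_curve_smooth : smooth_curve line_curve.
Proof.
exists D; split=> //; [by move=> t; rewrite /D /=; lra | exact: line_curve_continuous |].
move=> k d.
apply: (Ck_comp (f := chart_map k \o chart_inv i) (U' := chart_map i @` (dom i `&` dom k))).
- by apply: open_preimage_on => //; [exact: line_curve_continuous | exact: dom_open].
- by apply: open_chart_image; exact: dom_open.
- by move=> t [Dt kt]; have [it <-] := line_curveP (DW Dt); exists (line_curve t).
- by apply: Ck_line; apply: open_preimage_on => //; [exact: line_curve_continuous | exact: dom_open].
- exact: transition_smooth.
Qed.

(** Q solves the equation in the one chart i, while [nabla_curve] uses the chart chosen at each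
    point of the line. The derivative of the Jacobian of the chart change cancels the Hessian term
    of [christoffel_transition]. *)
Lemma line_transport (Q : R -> 'M[R]_m) : Q 0 = 1%:M ->
  (forall t : R, - 1 < t < 2 -> is_derive t 1 Q (- (Q t *m christoffel_mx g i (x + t *: w) w))) ->
  transport_curve g line_curve (dcoord i (line_curve 0) *m Q 1 *m dparam i (line_curve 1)).
Proof.
move=> Q0 DQ v'; have p0 : - 1 <= (0 : R) <= 2 by lra.
have [i0 _] := line_curveP p0.
pose v := v' *m dcoord i (line_curve 0).
exists (fun s => v *m Q s *m dparam i (line_curve s)); split; last by rewrite !mulmxA.
  move=> t t01; have t12 : - 1 < t < 2 by move: t01; lra.
  have [it ct] := line_curveP (DW t12).
  set c := line_curve; pose k := chart_at (c t); have kt : dom k (c t) by exact: dom_chart_at.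
  pose psi := chart_map k \o chart_inv i; pose U := chart_map i @` (dom i `&` dom k).
  have oU : open U by apply: open_chart_image; exact: dom_open.
  have Ux : U (x + t *: w) by rewrite -ct; exists (c t).
  have C2 : Ck 2 U psi by exact: transition_smooth.
  have DJ := is_derive_along (v := w) (differentiable_jacobian oU C2 Ux).
  have D1 := is_derive_mulmx (is_derive_mulmxl v (DQ t t12)) DJ.
  have N : \forall s \near t, v *m Q s *m jacobian psi (x + s *: w) =
     curve_field_coord c (fun s => v *m Q s *m dparam i (c s)) t s.
    have Nk : \forall s \near t, dom k (c s).
      apply: line_curve_continuous => //; apply: open_nbhs_nbhs; split=> //; exact: dom_open.
    have Nd : \forall s \near t, D s by exact: open_nbhs_nbhs.
    apply: filterS2 Nk Nd => s ks Ds; have [is_ cs] := line_curveP (DW Ds).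
    rewrite /curve_field_coord /= -/k dcoordE dparamE -[RHS]mulmxA transition_jac_comp //; last exact: dom_chart_at.
    by rewrite transition_jacE -/psi cs.
  have D2 := near_eq_is_derive N D1.
  split; first by case: D2.
  rewrite /nabla_curve -/k.
  have -> : velocity c t = w *m transition_jac i k (c t).
    have dpsi := C2_differentiable C2 Ux.
    have [_ E] := is_derive_along (v := w) dpsi.
    apply: (etrans E); rewrite (deriveEjacobian _ dpsi) transition_jacE ct //.
  have -> : v *m Q t *m dparam i (c t) = v *m Q t *m transition_jac i k (c t).
    by rewrite dparamE.
  rewrite (christoffel_transition hg _ _ it kt) -/psi.
  case: D2 => _ ->.
  rewrite (derive_jacobian oU C2 Ux) christoffel_mapE ct transition_jacE -/psi ct.
  by rewrite mulmxN mulNmx mulmxA [X in X + _ = _]addrC addrA subrK subrr.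
rewrite Q0 mulmx1 /v -mulmxA dcoordE dparamE transition_jac_comp //; try exact: dom_chart_at.
by rewrite transition_jac_id ?mulmx1 //; exact: dom_chart_at.
Qed.

End Line.
End LineTransport.

(** * Complex determinants *)

Section Complexification.
Variables (R : realType) (n : nat).
Local Notation J := (@Jmx R n).
Local Notation toC := (real_complex R).

(** For m = n the determinant of this matrix is the value of dz_1 ^ ... ^ dz_n on the rows of E. *)
Definition complexify m (E : 'M[R]_(m, n + n)) : 'M[R[i]]_(m, n) :=
  \matrix_(a, b) Complex (lsubmx E a b) (rsubmx E a b).

Lemma cdetE (A : 'M[R]_(n + n)) : cdet A = \det (complexify (usubmx A)).
Proof. by []. Qed.

Lemma complex_ReD (x y : R[i]) : Re (x + y) = Re x + Re y. Proof. by case: x y => ? ? []. Qed.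
Lemma complex_ImD (x y : R[i]) : Im (x + y) = Im x + Im y. Proof. by case: x y => ? ? []. Qed.
Lemma complex_ReM (x y : R[i]) : Re (x * y) = Re x * Re y - Im x * Im y. Proof. by case: x y => ? ? []. Qed.
Lemma complex_ImM (x y : R[i]) : Im (x * y) = Re x * Im y + Im x * Re y. Proof. by case: x y => ? ? []. Qed.

Lemma complex_Re_sum I (r : seq I) (P : pred I) (F : I -> R[i]) :
  Re (\sum_(k <- r | P k) F k) = \sum_(k <- r | P k) Re (F k).
Proof. by elim/big_rec2: _ => // k y x _ <-; rewrite complex_ReD. Qed.

Lemma complex_Im_sum I (r : seq I) (P : pred I) (F : I -> R[i]) :
  Im (\sum_(k <- r | P k) F k) = \sum_(k <- r | P k) Im (F k).
Proof. by elim/big_rec2: _ => // k y x _ <-; rewrite complex_ImD. Qed.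

Lemma complex_eq (x y : R[i]) : Re x = Re y -> Im x = Im y -> x = y.
Proof. by case: x y => ? ? [? ?] /= -> ->. Qed.

Lemma comm_Jmx_blocks (A : 'M[R]_(n + n)) : comm_mx A J ->
  dlsubmx A = - ursubmx A /\ drsubmx A = ulsubmx A.
Proof.
rewrite /comm_mx -{1 2}(submxK A) /Jmx !mulmx_block !mul0mx !mulmx0 !mulmxN !mulNmx !mulmx1 !mul1mx.
rewrite !addr0 !add0r => /eq_block_mx[H1 H2 H3 H4]; split=> //.
Qed.

Lemma complexify_mul m (E : 'M[R]_(m, n + n)) (A : 'M[R]_(n + n)) : comm_mx A J ->
  complexify (E *m A) = complexify E *m complexify (usubmx A).
Proof.
move=> /comm_Jmx_blocks[dl dr].
have E1 : E *m A = row_mx (lsubmx E *m ulsubmx A - rsubmx E *m ursubmx A)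
                          (lsubmx E *m ursubmx A + rsubmx E *m ulsubmx A).
  by rewrite -{1}(hsubmxK E) -{1}(submxK A) mul_row_block dl dr mulmxN.
apply/matrixP => a b; rewrite E1 mxE row_mxKl row_mxKr [RHS]mxE.
apply: complex_eq; rewrite /= ?complex_Re_sum ?complex_Im_sum !mxE.
  rewrite -sumrB; apply: eq_bigr => k _; by rewrite complex_ReM !mxE.
rewrite -big_split; apply: eq_bigr => k _; by rewrite complex_ImM !mxE.
Qed.

(** Left factors are real changes of frame, so they can affect a complex determinant by a real
    factor only. *)
Lemma complexify_mull m p (K : 'M[R]_(m, p)) (E : 'M[R]_(p, n + n)) :
  complexify (K *m E) = map_mx toC K *m complexify E.
Proof.
have E1 : K *m E = row_mx (K *m lsubmx E) (K *m rsubmx E) by rewrite -mul_mx_row hsubmxK.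
apply/matrixP => a b; rewrite E1 mxE row_mxKl row_mxKr [RHS]mxE.
apply: complex_eq; rewrite /= ?complex_Re_sum ?complex_Im_sum !mxE; apply: eq_bigr => k _.
  by rewrite complex_ReM !mxE /= mul0r subr0.
by rewrite complex_ImM !mxE /= mul0r addr0.
Qed.

(** The standard Hermitian product: its real part is the Euclidean product and its imaginary part
    pairs E with F *m J. Replacing E by E *m G brings in the metric and omega. *)
Lemma complexify_conj m p (E : 'M[R]_(m, n + n)) (F : 'M[R]_(p, n + n)) a b :
  (complexify E *m (map_mx conjc (complexify F))^T) a b =
  Complex ((E *m F^T) a b) ((E *m (F *m J)^T) a b).
Proof.
have FJ : F *m J = row_mx (- rsubmx F) (lsubmx F).
  by rewrite -{1}(hsubmxK F) /Jmx mul_row_block !mulmx0 !mulmx1 mulmxN mulmx1 addr0 add0r.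
have EF : E *m F^T = lsubmx E *m (lsubmx F)^T + rsubmx E *m (rsubmx F)^T.
  by rewrite -{1}(hsubmxK E) -{1}(hsubmxK F) tr_row_mx mul_row_col.
have EFJ : E *m (F *m J)^T = lsubmx E *m (- rsubmx F)^T + rsubmx E *m (lsubmx F)^T.
  by rewrite FJ -{1}(hsubmxK E) tr_row_mx mul_row_col.
rewrite EF EFJ.
apply: complex_eq; rewrite mxE ?complex_Re_sum ?complex_Im_sum /= !mxE -big_split; apply: eq_bigr => k _ /=.
  by rewrite complex_ReM !mxE /=; ring.
by rewrite complex_ImM !mxE /=; ring.
Qed.

Lemma complexify1 : complexify (usubmx (1%:M : 'M[R]_(n + n))) = 1%:M.
Proof.
apply/matrixP => a b; rewrite scalar_mx_block mxE.
rewrite -[block_mx _ _ _ _]/(col_mx (row_mx _ _) (row_mx _ _)) col_mxKu row_mxKl row_mxKr !mxE.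
by case: (a == b).
Qed.

Lemma cdetM (A B : 'M[R]_(n + n)) : comm_mx B J -> cdet (A *m B) = cdet A * cdet B.
Proof.
move=> cB; rewrite !cdetE.
have -> : usubmx (A *m B) = usubmx A *m B.
  by rewrite -{1}(vsubmxK A) mul_col_mx col_mxKu.
by rewrite complexify_mul // det_mulmx.
Qed.

Lemma cdet1 : cdet (1%:M : 'M[R]_(n + n)) = 1.
Proof. by rewrite cdetE complexify1 det1. Qed.

Lemma comm_invmx_Jmx (A : 'M[R]_(n + n)) : A \in unitmx -> comm_mx A J -> comm_mx (invmx A) J.
Proof.
move=> uA; rewrite /comm_mx => H.
by rewrite -[LHS](mulmxK uA) -[_ *m J *m A]mulmxA -H mulmxA mulVmx // mul1mx.
Qed.

Lemma cdet_unit (A : 'M[R]_(n + n)) : A \in unitmx -> comm_mx A J -> cdet A != 0.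
Proof.
move=> uA cA; apply/eqP => d0; have := cdet1.
by rewrite -(mulmxV uA) cdetM ?d0 ?mul0r; [move/esym/eqP; rewrite oner_eq0|exact: comm_invmx_Jmx].
Qed.

Lemma cdet_tr (A : 'M[R]_(n + n)) : comm_mx A J -> cdet A^T = conjc (cdet A).
Proof.
move=> /comm_Jmx_blocks[dl dr]; rewrite !cdetE -det_map_mx -det_tr.
congr (\det _); apply/matrixP => a b; rewrite !mxE.
have /matrixP/(_ a b) := dl; rewrite !mxE => dl'.
by rewrite /= dl'.
Qed.

End Complexification.

Section UnitaryDet.
Variables (R : realType) (n : nat).
Local Notation J := (@Jmx R n).

Lemma Jmx_comm (G : 'M[R]_(n + n)) : J *m G *m J^T = G -> comm_mx G J.
Proof.
by move=> H; rewrite /comm_mx -{1}H trmx_Jmx mulmxN mulNmx mulmxJJ opprK.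
Qed.

Lemma comm_mx_mulJ (A B : 'M[R]_(n + n)) : comm_mx A J -> comm_mx B J -> comm_mx (A *m B) J.
Proof. by rewrite /comm_mx => cA cB; rewrite -mulmxA cB !mulmxA cA. Qed.

Lemma comm_mx_trJ (A : 'M[R]_(n + n)) : comm_mx A J -> comm_mx A^T J.
Proof.
rewrite /comm_mx => cA; have := congr1 trmx cA.
by rewrite !trmx_mul trmx_Jmx mulmxN mulNmx => /oppr_inj ->.
Qed.

(** Taking [cdet] of the hypothesis, the transpose contributes the conjugate and the nonzero factor
    of G cancels. *)
Lemma unitary_cdet (A G : 'M[R]_(n + n)) : G \in unitmx -> comm_mx G J -> comm_mx A J ->
  A *m G *m A^T = G -> cdet A * conjc (cdet A) = 1.
Proof.
move=> uG cG cA H; have dG := cdet_unit uG cG.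
apply: (mulIf dG); rewrite mul1r -{2}H !cdetM //; last exact: comm_mx_trJ.
by rewrite cdet_tr // mulrAC.
Qed.

(** Lagrangian subspaces are totally real: on a Lagrangian frame the Hermitian Gram matrix has zero
    imaginary part, hence is the invertible real Gram matrix. *)
Lemma complexify_det_neq0 (E0 G : 'M[R]_(n + n)) (E : 'M[R]_(n, n + n)) :
  comm_mx G J -> E *m G *m E^T \in unitmx -> E *m G *m (E *m J)^T = 0 ->
  \det (complexify E) != 0.
Proof.
move=> cG uE lag; apply/eqP => d0.
have E1 : complexify (E *m G) *m (map_mx conjc (complexify E))^T =
    map_mx (real_complex R) (E *m G *m E^T).
  apply/matrixP => a b; rewrite complexify_conj lag [RHS]mxE.
  by rewrite [X in Complex _ X]mxE.
have := congr1 determinant E1.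
rewrite complexify_mul // !det_mulmx d0 !mul0r det_map_mx => /esym/eqP.
rewrite fmorph_eq0 => /eqP; move: uE; rewrite unitmxE unitfE.
by move=> /eqP.
Qed.

(* Entries of [N *m G *m (E *m J)^T] are the values of omega on the rows of N and E. *)
Lemma Im_trace_complexify (G : 'M[R]_(n + n)) (E N : 'M[R]_(n, n + n)) :
  comm_mx G J -> E *m G *m E^T \in unitmx -> E *m G *m (E *m J)^T = 0 ->
  Im (\tr (complexify N *m invmx (complexify E))) =
  \tr (N *m G *m (E *m J)^T *m invmx (E *m G *m E^T)).
Proof.
move=> cG uE lag; set Gm := E *m G *m E^T.
have uC : complexify E \in unitmx.
  by rewrite unitmxE unitfE; exact: complexify_det_neq0 cG uE lag.
pose H := (map_mx conjc (complexify E))^T.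
have EH : complexify (E *m G) *m H = map_mx (real_complex R) Gm.
  apply/matrixP => a b; rewrite complexify_conj lag [RHS]mxE.
  by rewrite [X in Complex _ X]mxE.
set K := complexify N *m invmx (complexify E).
have KE : K *m map_mx (real_complex R) Gm = complexify (N *m G) *m H.
  by rewrite -EH complexify_mul // mulmxA mulmxA /K mulmxKV // complexify_mul.
(* As the Hermitian Gram matrix of E is real, the inverse of [complexify E] is traded for the
   conjugate transpose of E and a real inverse. The imaginary part then falls on the Hermitian
   product of N and E alone. *)
have -> : K = complexify (N *m G) *m H *m map_mx (real_complex R) (invmx Gm).
  by rewrite -KE -mulmxA -map_mxM mulmxV // map_mx1 mulmx1.
rewrite /mxtrace complex_Im_sum; apply: eq_bigr => a _.
rewrite mxE complex_Im_sum [RHS]mxE; apply: eq_bigr => b _.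
by rewrite complexify_conj complex_ImM [map_mx _ _ _ _]mxE /= mulr0 add0r.
Qed.

End UnitaryDet.

(** * Derivatives of complex-valued functions and of determinants *)

Section ComplexDerivative.
Variables (R : realType) (V : normedModType R).
Implicit Types (f g : V -> R[i]) (x v : V).

(** Real and imaginary parts are kept as separate real functions, and full differentiability is
    recorded besides the directional value: this is the form that [circle_map_differentiable] and
    [maslov_form] consume. *)
Definition cderiv x v f (d : R[i]) : Prop :=
  [/\ differentiable (fun y => Re (f y)) x, differentiable (fun y => Im (f y)) x,
      'D_v (fun y => Re (f y)) x = Re d & 'D_v (fun y => Im (f y)) x = Im d].

Lemma cderiv_cst x v (c : R[i]) : cderiv x v (fun=> c) 0.
Proof.
by split; [exact: differentiable_cst | exact: differentiable_cst | exact: derive_cst | exact: derive_cst].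
Qed.

Lemma cderiv_eqd x v f d d' : cderiv x v f d -> d = d' -> cderiv x v f d'.
Proof. by move=> H <-. Qed.

Lemma cderiv_ext x v f g d : f =1 g -> cderiv x v f d -> cderiv x v g d.
Proof. by move=> /funext <-. Qed.

Lemma cderivD x v f g df dg : cderiv x v f df -> cderiv x v g dg ->
  cderiv x v (fun y => f y + g y) (df + dg).
Proof.
move=> [f1 f2 f3 f4] [g1 g2 g3 g4].
have ER : (fun y => Re (f y + g y)) = (fun y => Re (f y)) + (fun y => Re (g y)).
  by apply/funext => y; rewrite complex_ReD.
have EI : (fun y => Im (f y + g y)) = (fun y => Im (f y)) + (fun y => Im (g y)).
  by apply/funext => y; rewrite complex_ImD.
rewrite /cderiv ER EI; split.
- exact: differentiableD.
- exact: differentiableD.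
- by rewrite deriveD ?f3 ?g3 ?complex_ReD //; exact: diff_derivable.
- by rewrite deriveD ?f4 ?g4 ?complex_ImD //; exact: diff_derivable.
Qed.

Lemma cderivM x v f g df dg : cderiv x v f df -> cderiv x v g dg ->
  cderiv x v (fun y => f y * g y) (df * g x + f x * dg).
Proof.
move=> [f1 f2 f3 f4] [g1 g2 g3 g4].
have ER : (fun y => Re (f y * g y)) = (fun y => Re (f y)) * (fun y => Re (g y)) -
    (fun y => Im (f y)) * (fun y => Im (g y)).
  by apply/funext => y; rewrite complex_ReM.
have EI : (fun y => Im (f y * g y)) = (fun y => Re (f y)) * (fun y => Im (g y)) +
    (fun y => Im (f y)) * (fun y => Re (g y)).
  by apply/funext => y; rewrite complex_ImM.
have dr (h : V -> R) (dh : differentiable h x) : is_derive x v h ('D_v h x).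
  exact/derivableP/diff_derivable.
rewrite /cderiv ER EI; split.
- by apply: differentiableB; exact: differentiableM.
- by apply: differentiableD; exact: differentiableM.
- have [_ ->] := is_deriveB (is_deriveM (dr _ f1) (dr _ g1)) (is_deriveM (dr _ f2) (dr _ g2)).
  by rewrite f3 f4 g3 g4 complex_ReD !complex_ReM /GRing.scale /=; ring.
- have [_ ->] := is_deriveD (is_deriveM (dr _ f1) (dr _ g2)) (is_deriveM (dr _ f2) (dr _ g1)).
  by rewrite f3 f4 g3 g4 complex_ImD !complex_ImM /GRing.scale /=; ring.
Qed.

Lemma cderivMl x v c f df : cderiv x v f df -> cderiv x v (fun y => c * f y) (c * df).
Proof.
by move=> H; apply: cderiv_eqd (cderivM (cderiv_cst x v c) H) _; rewrite mul0r add0r.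
Qed.

Lemma cderiv_sum x v I (r : seq I) (P : pred I) (f : I -> V -> R[i]) (df : I -> R[i]) :
  (forall k, cderiv x v (f k) (df k)) ->
  cderiv x v (fun y => \sum_(k <- r | P k) f k y) (\sum_(k <- r | P k) df k).
Proof.
move=> H; elim: r => [|a r IH].
  rewrite big_nil; apply: cderiv_ext (cderiv_cst x v 0) => y; by rewrite big_nil.
rewrite big_cons; case: ifP => Pa.
  by apply: cderiv_ext (cderivD (H a) IH) => y; rewrite big_cons Pa.
by apply: cderiv_ext IH => y; rewrite big_cons Pa.
Qed.

(** The value of the derivative is left open: in [cderiv_det1] it is multiplied by two factors that
    vanish at x. *)
Lemma cderiv_prod x v I (r : seq I) (P : pred I) (f : I -> V -> R[i]) (df : I -> R[i]) :
  (forall k, cderiv x v (f k) (df k)) ->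
  exists d, cderiv x v (fun y => \prod_(k <- r | P k) f k y) d.
Proof.
move=> H; elim: r => [|a r [d IH]].
  by exists 0; apply: cderiv_ext (cderiv_cst x v 1) => y; rewrite big_nil.
case Pa : (P a); eexists.
  by apply: cderiv_ext (cderivM (H a) IH) => y; rewrite big_cons Pa.
by apply: cderiv_ext IH => y; rewrite big_cons Pa.
Qed.

Lemma cderiv_prod1 x v I (r : seq I) (f : I -> V -> R[i]) (df : I -> R[i]) :
  (forall k, cderiv x v (f k) (df k)) -> (forall k, f k x = 1) ->
  cderiv x v (fun y => \prod_(k <- r) f k y) (\sum_(k <- r) df k).
Proof.
move=> H f1; elim: r => [|a r IH].
  by rewrite big_nil; apply: cderiv_ext (cderiv_cst x v 1) => y; rewrite big_nil.
rewrite big_cons; apply: cderiv_eqd.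
  by apply: cderiv_ext (cderivM (H a) IH) => y; rewrite big_cons.
by rewrite /= f1 big1 ?mulr1 ?mul1r.
Qed.

(** Jacobi's formula at the identity matrix, read off the Leibniz expansion: only the identity
    permutation contributes to first order. *)
Lemma cderiv_det1 x v m (F : V -> 'M[R[i]]_m) (dF : 'M[R[i]]_m) :
  (forall a b, cderiv x v (fun y => F y a b) (dF a b)) -> F x = 1%:M ->
  cderiv x v (fun y => \det (F y)) (\tr dF).
Proof.
move=> H F1.
pose D (s : 'S_m) := if s == 1%g then \tr dF else 0.
have E : \sum_(s : 'S_m) (-1) ^+ s * D s = \tr dF.
  rewrite (bigD1 (1%g : 'S_m)) //= big1 => [|s s1]; last by rewrite /D (negPf s1) mulr0.
  by rewrite /D eqxx odd_perm1 expr0 mul1r addr0.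
rewrite -E; apply: cderiv_sum => s; apply: cderivMl; rewrite /D.
case: eqVneq => [->|s1].
  rewrite /mxtrace; apply: (cderiv_ext (f := fun y => \prod_k F y k k)).
    by move=> y; apply: eq_bigr => k _; rewrite perm1.
  by apply: cderiv_prod1 => // k; rewrite F1 mxE eqxx.
(* A permutation other than 1 moves some a and then also s a, so its product contains two
   off-diagonal entries, both zero at x, and has zero derivative there. *)
have [a sa] : exists a, s a != a.
  apply/existsP; apply: contraNT s1 => /existsPn Ns; apply/eqP/permP => a.
  by rewrite perm1; apply/eqP; move: (Ns a); rewrite negbK.
have sb : s (s a) != s a by rewrite (inj_eq perm_inj).
have [d Hd] := @cderiv_prod x v _ (index_enum 'I_m) (fun k => (k != a) && (k != s a))
   (fun k y => F y k (s k)) (fun k => dF k (s k)) (fun k => H _ _).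
have := cderivM (H a (s a)) (cderivM (H (s a) (s (s a))) Hd).
rewrite F1 !mxE [a == s a]eq_sym (negPf sa) [s a == s (s a)]eq_sym (negPf sb) !(mul0r, mulr0, addr0).
apply: cderiv_ext => y; rewrite [RHS](bigD1 a) //= [X in _ = _ * X](bigD1 (s a)) //=.
Qed.

End ComplexDerivative.

(** * Lagrangian frames *)

Lemma mxform_lagrangian (R : realType) n (G : 'M[R]_(n + n)) (E : 'M[R]_(n, n + n)) a b :
  E *m G *m (E *m Jmx)^T = 0 -> mxform G (a *m E) (b *m E *m Jmx) = 0.
Proof. by move=> H; rewrite -mulmxA mxform_mul H /mxform mulmx0 mul0mx mxE. Qed.

Section LagrangianFrame.
Variables (R : realType) (n : nat) (L : manifold R n) (X : manifold R (n + n)).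
Variables (g : X -> 'M[R]_(n + n)) (j : L -> X).
Hypotheses (hK : kahler g) (hj : lagrangian_embedding g j).
Local Notation J := (@Jmx R n).
Let hg := kahler_riemannian hK.

Lemma lagrangian_smooth : smooth_map j.
Proof. by case: hj => -[]. Qed.
Let sj := lagrangian_smooth.

Lemma dmap_row_free q : row_free (dmap j q).
Proof. by case: hj => -[]. Qed.

Lemma lagrangian_dmap q : dmap j q *m g (j q) *m (dmap j q *m J)^T = 0.
Proof.
apply: mxform_inj => v w; rewrite -mxform_mul.
case: hj => _ /(_ q v w) E.
by rewrite [RHS]/mxform mulmx0 mul0mx [RHS]mxE mulmxA; exact: E.
Qed.

(** In fixed charts the Lagrangian condition holds at all nearby points, so it can be
    differentiated; J passes through the chart change because the atlas is complex. *)
Lemma lagrangian_local k i q : dom k q -> dom i (j q) ->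
  let E := jacobian (local_map j k i) (chart_map k q) in
  E *m gram g i (chart_map i (j q)) *m (E *m J)^T = 0.
Proof.
move=> kq iq E; have ak := dom_chart_at q; have ai := dom_chart_at (j q).
pose T1 := transition_jac (chart_at q) k q; pose T2 := transition_jac i (chart_at (j q)) (j q).
have dE : dmap j q = T1 *m E *m T2 by exact: dmap_local.
have u1 : T1 \in unitmx by exact: transition_jac_unit.
have ET : E *m T2 = invmx T1 *m dmap j q by rewrite dE -mulmxA mulKmx.
rewrite (gram_at _ iq) -/T2.
have -> : E *m (T2 *m g (j q) *m T2^T) *m (E *m J)^T = (E *m T2) *m g (j q) *m (E *m T2 *m J)^T.
  by rewrite -[E *m T2 *m J]mulmxA -(Jmx_transition hK iq ai) -/T2 !trmx_mul !mulmxA.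
rewrite ET.
have -> : invmx T1 *m dmap j q *m g (j q) *m (invmx T1 *m dmap j q *m J)^T =
   invmx T1 *m (dmap j q *m g (j q) *m (dmap j q *m J)^T) *m (invmx T1)^T.
  by rewrite !trmx_mul !mulmxA.
by rewrite lagrangian_dmap mulmx0 mul0mx.
Qed.

Variable q : L.
Let k := chart_at q.
Let i := chart_at (j q).
Let u0 := chart_map k q.
Let x0 := chart_map i (j q).
Let phi := local_map j k i.
Let U := chart_map k @` (dom k `&` j @^-1` dom i).
Let E0 := jacobian phi u0.
Let G := gram g i x0.
Let kq : dom k q := dom_chart_at q.
Let iq : dom i (j q) := dom_chart_at (j q).
Let oU : open U := @open_local_dom _ _ _ _ _ _ sj k i.
Let Uu : U u0. Proof. by exists q. Qed.
Let C2 : Ck 2 U phi := local_map_smooth sj k i 2.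

Lemma local_map_chart : local_map j (chart_at q) (chart_at (j q)) (chart_map (chart_at q) q) =
  chart_map (chart_at (j q)) (j q).
Proof. by rewrite /local_map /= chart_mapK. Qed.
Let phiu : phi u0 = x0 := local_map_chart.

(* Row a of [frame_nabla Y] is the covariant derivative along Y of the a-th
   coordinate vector field of L, pushed forward to X. *)
Definition frame_nabla (Y : 'rV[R]_n) : 'M[R]_(n, n + n) :=
  'D_Y (jacobian (local_map j (chart_at q) (chart_at (j q)))) (chart_map (chart_at q) q) +
  dmap j q *m christoffel_mx g (chart_at (j q)) (chart_map (chart_at (j q)) (j q)) (Y *m dmap j q).

Let frame_nablaE Y a :
  a *m frame_nabla Y = 'D_Y ('D_a phi) u0 + christoffel_map g i x0 (Y *m E0) (a *m E0).
Proof.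
by rewrite /frame_nabla mulmxDr (derive_jacobian oU C2 Uu) christoffel_mapE mulmxA.
Qed.

Lemma frame_nablaC Y a : a *m frame_nabla Y = Y *m frame_nabla a.
Proof.
apply: (etrans (frame_nablaE _ _)); apply: (etrans _ (esym (frame_nablaE _ _))).
by apply: (congr2 +%R); [exact: schwarz_rV oU Uu C2 | exact: (@christoffel_mapC _ _ _ _ hg i (j q) _ _ iq)].
Qed.

(** The tensor omega (nabla_Y e_a, e_b). The two transpositions proved next generate its full
    symmetry. *)
Let cubic Y a b := mxform G (a *m frame_nabla Y) (b *m E0 *m J).

Let cubicC12 Y a b : cubic Y a b = cubic a Y b.
Proof. by rewrite /cubic (frame_nablaC Y a). Qed.

Let GJ v w : mxform G (v *m J) (w *m J) = mxform G v w.
Proof. by rewrite mxform_mul /G (gram_Jmx hK iq). Qed.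

(** Differentiate omega (e_a, e_b) = 0 along Y. Since the metric and J are parallel, omega (nabla_Y
    e_a, e_b) + omega (e_a, nabla_Y e_b) = 0, and omega is skew. *)
Let cubicC23 Y a b : cubic Y a b = cubic Y b a.
Proof.
have dphi := C2_differentiable C2 Uu.
have DE : is_derive u0 Y (jacobian phi) ('D_Y (jacobian phi) u0).
  exact/derivableP/diff_derivable/(differentiable_jacobian oU C2 Uu).
have Dphi : is_derive u0 Y phi (Y *m E0).
  by split; [exact: diff_derivable | rewrite (deriveEjacobian _ dphi)].
have DG : is_derive u0 Y (gram g i \o phi) ('D_(Y *m E0) (gram g i) x0).
  rewrite -phiu; apply: is_derive_comp Dphi; rewrite phiu; exact: differentiable_gram.
have [_ D] := derive_mxform DG (is_derive_mulmxl a DE) (is_derive_mulmxr J (is_derive_mulmxl b DE)).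
have Z : 'D_Y (fun t => mxform ((gram g i \o phi) t) (a *m jacobian phi t) (b *m jacobian phi t *m J)) u0 = 0.
  rewrite -(derive_cst (V := 'rV[R]_n) (0 : R) u0 Y); apply: near_eq_derive; near=> t.
  have [y [ky iy] <-] : U t by near: t; exact: open_nbhs_nbhs.
  have E1 := lagrangian_local ky iy.
  have E2 : phi (chart_map k y) = chart_map i (j y) by rewrite /phi /local_map /= chart_mapK.
  rewrite -E2 in E1; exact: mxform_lagrangian E1.
rewrite Z /= phiu -/G !(derive_jacobian oU C2 Uu) -!(deriveEjacobian _ dphi) in D.
have := D; rewrite -(dgram_def g) !(deriveEjacobian _ dphi) -/E0 (metric_compat hg) //.
rewrite (christoffel_Jmx hK) // -/G => D'.
rewrite /cubic [a *m frame_nabla Y]frame_nablaE [b *m frame_nabla Y]frame_nablaE.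
rewrite [in RHS]mxformC (gram_sym hg).
have -> w : mxform G (a *m E0 *m J) w = - mxform G (a *m E0) (w *m J).
  by rewrite -GJ mulmxJJ mxformNl.
apply/eqP; rewrite -addr_eq0 mulmxDl mxformDl mxformDr; apply/eqP.
move: D'; move: (mxform G ('D_Y _ _) _) (mxform G _ ('D_Y _ _ *m _)) => A1 A2 D'.
rewrite [RHS]D'; ring.
Unshelve. all: by end_near. Qed.

Let Gm := dmap j q *m g (j q) *m (dmap j q)^T.

Lemma pullback_gram_unit : dmap j q *m g (j q) *m (dmap j q)^T \in unitmx.
Proof.
apply: mxform_pos_unit => v v0; rewrite -mxform_mul; apply: (metric_pos hg).
apply: contra v0 => /eqP /(congr1 (mulmxr (pinvmx (dmap j q)))) /=.
by rewrite mulmxKp ?dmap_row_free // mul0mx => ->.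
Qed.

Let GE : G = g (j q). Proof. exact: gram_chart_at. Qed.

(** The intrinsic derivative of Z and the derivative of its components are both tangent to L, so
    omega annihilates them against tangent vectors. What remains depends only on the value of Z at
    q. *)
Lemma second_fundamental_form_normal (Y b : 'rV[R]_n) (Z : L -> 'rV[R]_n) (W : set L) :
  open_nbhs q W -> smooth_vector_field W Z ->
  omega g (j q) (second_fundamental_form g j Y Z q) (b *m dmap j q) =
  mxform (frame_nabla Y *m g (j q) *m (dmap j q *m J)^T) (Z q) b.
Proof.
move=> [oW Wq] sZ.
have tang v : mxform (g (j q)) (v *m dmap j q) (b *m dmap j q *m J) = 0.
  exact: mxform_lagrangian (lagrangian_dmap q).
rewrite /omega -[inner _ _ _ _]/(mxform _ _ _) /second_fundamental_form mxformDl mxformNl tang subr0.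
pose z u := Z (chart_inv k u) *m dcoord k (chart_inv k u).
have dz : differentiable z u0.
  by case: (sZ k 1%N) => + _; apply; exists q.
have DE : is_derive u0 Y (jacobian phi) ('D_Y (jacobian phi) u0).
  exact/derivableP/diff_derivable/(differentiable_jacobian oU C2 Uu).
have [_ D] := is_derive_mulmx (derivableP (diff_derivable (v := Y) dz)) DE.
have z0 : z u0 = Z q.
  by rewrite /z /u0 chart_mapK // dcoordE transition_jac_id // mulmx1.
have N : \forall u \near u0, z u *m jacobian phi u =
   (fun u => Z (chart_inv k u) *m dmap j (chart_inv k u) *m dcoord i (j (chart_inv k u))) u.
  near=> u; have [y [ky iy] <-] : U u by near: u; exact: open_nbhs_nbhs.
  have ay := dom_chart_at (j y).
  rewrite /z chart_mapK // (dmap_local sj ky iy) !dcoordE -!mulmxA transition_jac_comp //.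
  by rewrite transition_jac_id // mulmx1.
have -> : nabla g j Y (fun q' => Z q' *m dmap j q') q =
   'D_Y z u0 *m dmap j q + Z q *m frame_nabla Y.
  rewrite /nabla -/k -/i -/u0 -/x0; have <- := near_eq_derive Y N; rewrite D z0 -/E0.
  by rewrite /frame_nabla mulmxDr christoffel_mapE !mulmxA addrA.
rewrite mxformDl tang add0r -mulmxA mxform_mul //.
Unshelve. all: by end_near. Qed.

Lemma mean_curvature_trace (H : L -> 'rV[R]_(n + n)) (Y : 'rV[R]_n) : mean_curvature g j H ->
  omega g (j q) (H q) (Y *m dmap j q) =
  Im (\tr (complexify (frame_nabla Y) *m invmx (complexify (dmap j q)))).
Proof.
move=> /(_ q)[W [e [qW [sE oE] ->]]].
have -> : omega g (j q) (\sum_a second_fundamental_form g j (e a q) (e a) q) (Y *m dmap j q) =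
   \sum_a omega g (j q) (second_fundamental_form g j (e a q) (e a) q) (Y *m dmap j q).
  by rewrite /omega /inner !mulmx_suml summxE.
pose Om := \matrix_a e a q.
have cubE Y' a b : mxform (frame_nabla Y' *m g (j q) *m (dmap j q *m J)^T) a b = cubic Y' a b.
  by rewrite /cubic GE -mxform_mul mulmxA.
transitivity (\sum_a cubic Y (e a q) (e a q)).
  apply: eq_bigr => a _; rewrite (second_fundamental_form_normal _ _ qW (sE a)) cubE.
  (* The full symmetry moves Y from the last slot, where omega (H, Y) has it, to the slot of
     differentiation, where the Maslov form has it. *)
  by rewrite cubicC23 cubicC12.
have OmG : Om *m Gm *m Om^T = 1%:M.
  apply/matrixP => a b; rewrite -mxform_delta -mxform_mul -!rowE !rowK mxE.
  by case: qW => _ /oE/(_ a b).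
(* Summing over an orthonormal frame is contracting with the inverse Gram matrix. *)
have Om2 : Om^T *m Om = invmx Gm.
  have /mulmx1C E1 := OmG.
  by rewrite -[LHS](mulmxK pullback_gram_unit) -/Gm -[_ *m Om *m Gm]mulmxA E1 mul1mx.
rewrite (@Im_trace_complexify _ _ (g (j q))) ?pullback_gram_unit ?lagrangian_dmap //; last first.
  by apply: Jmx_comm; exact: metric_Jmx.
rewrite -/Gm -Om2 mulmxA mxtrace_mulC mulmxA /mxtrace; apply: eq_bigr => a _.
rewrite -cubE -[RHS]mxform_delta -mulmxA -mxform_mul -!rowE !rowK //.
Qed.

End LagrangianFrame.

(** * The Maslov map *)

Section TransportUnique.
Variables (R : realType) (m : nat) (M : manifold R m) (g : M -> 'M[R]_m).
Hypothesis hg : riemannian_metric g.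

Lemma parallel_alongB (c : R -> M) V W : parallel_along g c V -> parallel_along g c W ->
  parallel_along g c (fun s => V s - W s).
Proof.
move=> pV pW t t01; have [dV nV] := pV t t01; have [dW nW] := pW t t01.
have E : curve_field_coord c (fun s => V s - W s) t = curve_field_coord c V t - curve_field_coord c W t.
  by apply/funext => s; rewrite /curve_field_coord mulmxBl.
split; first by rewrite E; exact: derivableB.
rewrite /nabla_curve E (deriveB dV dW) christoffel_mapE mulmxBl -!christoffel_mapE.
rewrite addrACA -opprD.
have := nV; have := nW; rewrite /nabla_curve => -> ->.
by rewrite subr0.
Qed.

Lemma transport_curve_unique (c : R -> M) P P' : smooth_curve c ->
  transport_curve g c P -> transport_curve g c P' -> P = P'.
Proof.
move=> sc tP tP'; apply/row_matrixP => a; rewrite !rowE.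
have [V [pV V0 V1]] := tP (delta_mx 0 a); have [W [pW W0 W1]] := tP' (delta_mx 0 a).
have := parallel_along_inner hg sc (parallel_alongB pV pW).
rewrite V0 W0 V1 W1 subrr => E; apply/eqP; rewrite -subr_eq0; apply: contraT => /(metric_pos hg (c 1)).
by rewrite -[mxform _ _ _]/(inner _ _ _ _) E /inner !mul0mx mxE ltxx.
Qed.

End TransportUnique.

(** * Complex-linear parallel transport along short chart lines *)

Section KahlerLine.
Variables (R : realType) (n : nat) (X : manifold R (n + n)) (g : X -> 'M[R]_(n + n)).
Hypothesis hK : kahler g.
Local Notation J := (@Jmx R n).
Let hg := kahler_riemannian hK.
Variable y : X.
Let i := chart_at y.
Let x0 := chart_map i y.

Definition line_to (x : 'rV[R]_(n + n)) : R -> X :=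
  line_curve (chart_at y) x (chart_map (chart_at y) y - x).

(* Q is, in the chart at y, the parallel transport along the straight line
   from the point with coordinates x to y. *)
Definition line_parallel (x : 'rV[R]_(n + n)) (Q : 'M[R]_(n + n)) : Prop :=
  [/\ smooth_curve (line_to x), line_to x 0 = chart_inv (chart_at y) x, line_to x 1 = y,
      comm_mx Q J &
      transport_curve g (line_to x) (dcoord (chart_at y) (chart_inv (chart_at y) x) *m Q)].

Lemma line_parallel_unique x Q Q' : (chart_map i @` dom i) x ->
  line_parallel x Q -> line_parallel x Q' -> Q = Q'.
Proof.
move=> /chart_invK[ix _] [sc _ _ _ tQ] [_ _ _ _ tQ'].
have := transport_curve_unique hg sc tQ tQ'.
have u : dcoord i (chart_inv i x) \in unitmx.
  by rewrite dcoordE transition_jac_unit //; exact: dom_chart_at.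
by move=> /(congr1 (mulmx (invmx (dcoord i (chart_inv i x))))); rewrite !mulKmx.
Qed.

(* The J-linear part of a solution of the transport equation is again a solution,
   which makes parallel transport J-linear without a uniqueness argument. *)
Definition Jlinear_part (A : 'M[R]_(n + n)) : 'M[R]_(n + n) := 2^-1 *: (A - J *m A *m J).

Lemma Jlinear_part_comm A : comm_mx (Jlinear_part A) J.
Proof.
rewrite /comm_mx /Jlinear_part -scalemxAl -scalemxAr; congr (_ *: _).
by rewrite mulmxBl mulmxBr mulmxJJ !mulmxA Jmx_sqr mulNmx mul1mx mulNmx !opprK addrC.
Qed.

Lemma Jlinear_part_id A : comm_mx A J -> Jlinear_part A = A.
Proof.
rewrite /comm_mx /Jlinear_part => cA; rewrite -cA mulmxJJ opprK.
have -> : A + A = 2 *: A by rewrite scaler_nat mulr2n.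
by rewrite scalerA mulVf // scale1r.
Qed.

Lemma Jlinear_partM A B : comm_mx B J -> Jlinear_part (A *m B) = Jlinear_part A *m B.
Proof.
rewrite /comm_mx /Jlinear_part => cB; rewrite -scalemxAl mulmxBl; congr (_ *: (_ - _)).
by rewrite -!mulmxA cB.
Qed.

Lemma Jlinear_partD A B : Jlinear_part (A + B) = Jlinear_part A + Jlinear_part B.
Proof. by rewrite /Jlinear_part mulmxDr mulmxDl opprD addrACA scalerDr. Qed.

Lemma Jlinear_partN A : Jlinear_part (- A) = - Jlinear_part A.
Proof. by rewrite /Jlinear_part mulmxN mulNmx -opprD scalerN. Qed.

Lemma is_derive_Jlinear_part (Q : R -> 'M[R]_(n + n)) (t : R) dQ :
  is_derive t 1 Q dQ -> is_derive t 1 (Jlinear_part \o Q) (Jlinear_part dQ).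
Proof.
move=> D.
have -> : Jlinear_part \o Q = 2^-1 *: (Q - (fun s => J *m Q s *m J)) by [].
apply: is_deriveZ; apply: is_deriveB.
exact: is_derive_mulmxr (is_derive_mulmxl _ D).
Qed.

Lemma Jlinear_part_bounded : exists2 K : R, 0 < K & forall A, `|Jlinear_part A| <= K * `|A|.
Proof.
pose N : R := (n + n)%:R; exists (1 + N * (N * `|J| * `|J|)).
  by rewrite ltr_pwDl // !mulr_ge0.
move=> A; rewrite /Jlinear_part normrZ ger0_norm //.
apply: (@le_trans _ _ `|A - J *m A *m J|).
  by rewrite ler_piMl // invf_le1 // ler1n.
apply: le_trans (ler_normB _ _) _; rewrite mulrDl mul1r lerD2l.
apply: le_trans (normr_mulmx_le (normr_mulmx J A) (lexx _)) _.
by rewrite -/N le_eqVlt; apply/orP; left; apply/eqP; ring.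
Qed.

Lemma comm_mx1J : comm_mx (1%:M : 'M[R]_(n + n)) J.
Proof. by rewrite /comm_mx mul1mx mulmx1. Qed.

Lemma near_line_parallel (e : R) : 0 < e ->
  \forall x \near x0, exists2 Q, line_parallel x Q &
    `|Q - 1%:M - christoffel_mx g i x0 (x - x0)| <= e * `|x - x0|.
Proof.
move=> e0; have iy : dom i y := dom_chart_at y.
have [K K0 HK] := Jlinear_part_bounded.
(* Passing to the J-linear part can enlarge the error by the factor K. *)
have eK : 0 < e / K by rewrite divr_gt0.
apply: filterS (line_ode hg iy eK) => x [Q /= [Q0 DQ seg bQ]].
pose c := line_to x; pose w := x0 - x.
have cG t : - 1 <= t <= 2 -> comm_mx (christoffel_mx g i (x + t *: w) w) J.
  by move=> /seg[z iz <-]; rewrite /comm_mx -(christoffel_mx_Jmx hK).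
have cG0 : comm_mx (christoffel_mx g i x0 w) J by rewrite /comm_mx -(christoffel_mx_Jmx hK).
pose Q' := Jlinear_part \o Q.
have Q'0 : Q' 0 = 1%:M by rewrite /Q' /= Q0 Jlinear_part_id //; exact: comm_mx1J.
have DQ' (t : R) : - 1 < t < 2 -> is_derive t 1 Q' (- (Q' t *m christoffel_mx g i (x + t *: w) w)).
  move=> t12; apply: is_derive_eq (is_derive_Jlinear_part (DQ t t12)) _.
  apply: (etrans (Jlinear_partN _)); apply: (congr1 -%R); apply: Jlinear_partM; apply: cG.
  by move: t12 => /andP[? ?]; rewrite !ltW.
have c1 : c 1 = y by rewrite /c /line_to /line_curve scale1r addrC subrK chart_mapK.
have c0 : c 0 = chart_inv i x by rewrite /c /line_to /line_curve scale0r addr0.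
exists (Q' 1).
  split=> //; [exact: line_curve_smooth seg | exact: Jlinear_part_comm |].
  have := line_transport hg seg Q'0 DQ'.
  rewrite -/(line_to x) -/c c0 c1 dparamE -[chart_at y]/i transition_jac_id // mulmx1.
  exact.
have -> : Q' 1 - 1%:M - christoffel_mx g i x0 (x - x0) =
    Jlinear_part (Q 1 - 1%:M + christoffel_mx g i x0 w).
  rewrite !Jlinear_partD Jlinear_partN (Jlinear_part_id comm_mx1J) (Jlinear_part_id cG0).
  by rewrite -[x - x0]opprB christoffel_mxN opprK.
apply: le_trans (HK _) _.
apply: le_trans (ler_wpM2l (ltW K0) bQ) _.
by rewrite mulrA mulrCA divff ?gt_eqF // mulr1.
Qed.

End KahlerLine.

(** Both tangent frames are expressed through the frame at p. Eliminating it compares the frame at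
    q0, moved by the holonomy S, with the frame at q carried to q0 by Q. *)
Lemma frame_transport (F : fieldType) m p (Dp Dq D0 E : 'M[F]_(m, p))
    (K K0 T1 : 'M[F]_m) (P P0 A A0 S T2 T3 Q : 'M[F]_p) :
  Dq = K *m (Dp *m P *m A) -> D0 = K0 *m (Dp *m P0 *m A0) -> Dq = T1 *m E *m T2 ->
  K \in unitmx -> A \in unitmx -> A0 \in unitmx -> P *m (T3 *m Q) = P0 *m S ->
  D0 *m invmx A0 *m S = K0 *m invmx K *m T1 *m (E *m (T2 *m invmx A *m T3 *m Q)).
Proof.
move=> DqE -> DqT uK uA uA0 PQ.
have -> : K0 *m invmx K *m T1 *m (E *m (T2 *m invmx A *m T3 *m Q)) =
    K0 *m invmx K *m (T1 *m E *m T2) *m invmx A *m T3 *m Q by rewrite !mulmxA.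
rewrite -DqT DqE !mulmxA mulmxK // mulmxK // mulmxKV //.
by rewrite -[in LHS]mulmxA -PQ !mulmxA.
Qed.

Lemma cdet_invmx (R : realType) n (B : 'M[R]_(n + n)) :
  B \in unitmx -> comm_mx B Jmx -> cdet (invmx B) = (cdet B)^-1.
Proof.
move=> uB cB; have nB := cdet_unit uB cB.
by apply: (mulIf nB); rewrite mulVf // -cdetM // mulVmx // cdet1.
Qed.

(** The witness r is the determinant of the real matrix K. Its sign depends on the orientations of
    the frames, which is why the relation is stated for squares. *)
Lemma cdet_frame_relation (R : realType) n (D E : 'M[R]_(n, n + n)) (K : 'M[R]_n)
    (A A0 S T2 T3 Q : 'M[R]_(n + n)) :
  D *m invmx A0 *m S = K *m (E *m (T2 *m invmx A *m T3 *m Q)) ->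
  A \in unitmx -> A0 \in unitmx -> T2 *m T3 = 1%:M -> cdet S = 1 ->
  comm_mx A Jmx -> comm_mx A0 Jmx -> comm_mx S Jmx -> comm_mx T2 Jmx -> comm_mx T3 Jmx ->
  comm_mx Q Jmx -> \det (complexify D) != 0 ->
  exists r : R, cdet A ^+ 2 = real_complex R (r ^+ 2) * cdet A0 ^+ 2 *
    (\det (complexify (E *m Q) *m invmx (complexify D))) ^+ 2.
Proof.
move=> main uA uA0 T23 dS cA cA0 cS cT2 cT3 cQ nD.
have cAi := comm_invmx_Jmx uA cA; have cA0i := comm_invmx_Jmx uA0 cA0.
have H := congr1 (fun B => \det (complexify B)) main.
move: H; rewrite /= complexify_mul // complexify_mul // complexify_mull complexify_mul; last first.
  by do ![apply: comm_mx_mulJ => //].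
rewrite !det_mulmx -!cdetE !cdetM // det_map_mx dS mulr1.
have -> : cdet T2 * cdet (invmx A) * cdet T3 = cdet (invmx A).
  by rewrite mulrAC -cdetM // T23 cdet1 mul1r.
rewrite !cdet_invmx // => H; exists (\det K).
rewrite complexify_mul // !det_mulmx det_inv -cdetE.
have a0 := cdet_unit uA0 cA0; have a1 := cdet_unit uA cA.
move: H nD; move: (\det (complexify D)) (\det (complexify E)) => d0 d H n0.
have Ha : cdet A = real_complex R (\det K) * cdet A0 * (d * cdet Q / d0).
  apply: (mulIf n0); apply: (mulIf (invr_neq0 a1)); apply: (mulIf (invr_neq0 a0)).
  rewrite [LHS](_ : _ = d0 * (cdet A0)^-1); last by field; rewrite a0 a1.
  by rewrite H; field; rewrite a0 a1 n0.
by rewrite {1}Ha rmorphXn; ring.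
Qed.

(** * Maslov values compared through holonomy *)

Section MaslovRelation.
Variables (R : realType) (n : nat) (L : manifold R n) (X : manifold R (n + n)).
Variables (g : X -> 'M[R]_(n + n)) (j : L -> X).
Hypotheses (hX : calabi_yau g) (hj : lagrangian_embedding g j).
Local Notation J := (@Jmx R n).
Local Notation toC := (real_complex R).

Lemma calabi_yau_kahler : kahler g. Proof. by case: hX. Qed.
Let hK := calabi_yau_kahler.
Let hg := kahler_riemannian hK.

Lemma unitary_cdet_norm x A : unitary g x A -> cdet A * conjc (cdet A) = 1.
Proof.
move=> [cA HA]; apply: unitary_cdet HA => //; first exact: metric_unit.
by apply: Jmx_comm; exact: metric_Jmx.
Qed.

Lemma eqmx_row_free_factor m p (D E : 'M[R]_(m, p)) : row_free E -> (E == D)%MS ->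
  exists2 K, K \in unitmx & E = K *m D.
Proof.
move=> fE /andP[/submxP[K EK] _]; exists K => //.
rewrite -row_free_unit -row_leq_rank; move: fE; rewrite -row_leq_rank => /leq_trans; apply.
by rewrite EK mxrankM_maxl.
Qed.

Variables (p q0 q : L) (s0 s : seq (R -> L)) (P0 P A0 A : 'M[R]_(n + n)).
Let k := chart_at q0.
Let i := chart_at (j q0).
Hypotheses (ps0 : piecewise_smooth p s0 q0) (ps : piecewise_smooth p s q).
Hypotheses (tP0 : transport g [seq j \o c | c <- s0] P0) (tP : transport g [seq j \o c | c <- s] P).
Hypotheses (uA0 : unitary g (j q0) A0) (uA : unitary g (j q) A).
Hypotheses (D0 : (dmap j q0 == dmap j p *m P0 *m A0)%MS) (D : (dmap j q == dmap j p *m P *m A)%MS).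
Hypotheses (kq : dom k q) (iq : dom i (j q)).
Variable Q : 'M[R]_(n + n).
Hypothesis lQ : line_parallel g (j q0) (chart_map i (j q)) Q.

Lemma maslov_relation : exists r : R,
  cdet A ^+ 2 = toC (r ^+ 2) * cdet A0 ^+ 2 *
   (\det (complexify (jacobian (local_map j k i) (chart_map k q) *m Q) *m
          invmx (complexify (dmap j q0)))) ^+ 2.
Proof.
have sj := lagrangian_smooth hj.
have [sc c0 c1 cQ tQ] := lQ; rewrite chart_mapK // in c0 tQ.
set c := line_to _ _ in sc c0 c1 tQ.
have js0 := piecewise_smooth_map sj ps0; have js := piecewise_smooth_map sj ps.
have [u0 r0] := reverse_path_transport hg js0 tP0.
pose Qc := dcoord i (j q) *m Q.
have lt1 : transport g [:: c] (Qc *m 1%:M) by exists Qc, 1%:M.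
have loop : piecewise_smooth (j q0) (reverse_path [seq j \o c | c <- s0] ++ ([seq j \o c | c <- s] ++ [:: c])) (j q0).
  apply: piecewise_smooth_cat; first exact: reverse_path_smooth js0.
  by apply: piecewise_smooth_cat js _.
(* The holonomy of the loop from q0 back to p along s0, on to q along s, and home along the chart
   line. Transport along s and the line is transport along s0 followed by S, and [cdet S] is 1. *)
pose S := invmx P0 *m (P *m (Qc *m 1%:M)).
have tS := transport_cat r0 (transport_cat tP lt1).
have [uS dS] : unitary g (j q0) S /\ cdet S = 1.
  by case: hX => _ _ _ _ hol; exact: hol loop tS.
have PQ : P *m Qc = P0 *m S by rewrite /S mulKVmx // mulmx1.
clearbody S.
have [K Ku EK] := eqmx_row_free_factor (dmap_row_free hj q) D.
have [K0 K0u EK0] := eqmx_row_free_factor (dmap_row_free hj q0) D0.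
have [cA gA] := uA; have [cA0 gA0] := uA0; have [cS gS] := uS.
have unitA x B : unitary g x B -> B \in unitmx.
  move=> [_ HB]; have := metric_unit hg x.
  by rewrite -HB !unitmx_mul => /andP[/andP[-> _] _].
have uAm := unitA _ _ uA; have uA0m := unitA _ _ uA0.
pose k' := chart_at q; pose i' := chart_at (j q).
have ai := dom_chart_at (j q); have ak := dom_chart_at q.
pose T1 := transition_jac k' k q; pose T2 := transition_jac i i' (j q).
pose T3 := transition_jac i' i (j q).
have T1u : T1 \in unitmx by exact: transition_jac_unit.
have T23 : T2 *m T3 = 1%:M by exact: transition_jacK.
pose E := jacobian (local_map j k i) (chart_map k q).
have dE : dmap j q = T1 *m E *m T2 by exact: dmap_local.
have main : dmap j q0 *m invmx A0 *m S = K0 *m invmx K *m T1 *m (E *m (T2 *m invmx A *m T3 *m Q)).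
  by apply: (frame_transport EK EK0 dE) => //; rewrite -PQ /Qc dcoordE.
have cT2 : comm_mx T2 J by rewrite /comm_mx -(Jmx_transition hK).
have cT3 : comm_mx T3 J by rewrite /comm_mx -(Jmx_transition hK).
apply: (cdet_frame_relation main) => //.
apply: (@complexify_det_neq0 _ _ 0 (g (j q0))); [|exact: pullback_gram_unit|exact: lagrangian_dmap].
by apply: Jmx_comm; exact: metric_Jmx.
Qed.

End MaslovRelation.

Lemma near_continuous (S T : topologicalType) (f : S -> T) x (P : T -> Prop) :
  {for x, continuous f} -> (\forall y \near f x, P y) -> \forall y \near x, P (f y).
Proof. by move=> cf H; exact: cf H. Qed.

(** * The derivative of the Maslov map *)

Section MaslovDerivative.
Variables (R : realType) (n : nat) (L : manifold R n) (X : manifold R (n + n)).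
Variables (g : X -> 'M[R]_(n + n)) (j : L -> X) (M : L -> R[i]).
Hypotheses (hX : calabi_yau g) (hj : lagrangian_embedding g j) (hM : maslov_map g j M).
Local Notation J := (@Jmx R n).
Local Notation toC := (real_complex R).
Let hK := calabi_yau_kahler hX.
Let hg := kahler_riemannian hK.
Let sj := lagrangian_smooth hj.

Lemma maslov_map_norm q : M q * conjc (M q) = 1.
Proof.
have [p [gamma [P [A H]]]] := hM; have [_ _ uA _ ->] := H q.
by rewrite rmorphXn -exprMn (unitary_cdet_norm hX uA) expr1n.
Qed.

Variable q0 : L.
Let k := chart_at q0.
Let i := chart_at (j q0).
Let u0 := chart_map k q0.
Let x0 := chart_map i (j q0).
Let phi := local_map j k i.
Let U := chart_map k @` (dom k `&` j @^-1` dom i).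
Let kq : dom k q0 := dom_chart_at q0.
Let iq : dom i (j q0) := dom_chart_at (j q0).
Let oU : open U := @open_local_dom _ _ _ _ _ _ sj k i.
Let Uu : U u0. Proof. by exists q0. Qed.
Let C2 : Ck 2 U phi := @local_map_smooth _ _ _ _ _ _ sj k i 2.
Let phiu : phi u0 = x0 := local_map_chart j q0.

(** The default value is taken only where [line_parallel] has no solution. Near the base point a
    solution exists and is unique, so the choice is forced there. *)
Definition line_transport_mx (x : 'rV[R]_(n + n)) : 'M[R]_(n + n) :=
  xget 1%:M [set Q | line_parallel g (j q0) x Q].

Lemma near_line_transport_mx (e : R) : 0 < e ->
  \forall x \near chart_map (chart_at (j q0)) (j q0),
    line_parallel g (j q0) x (line_transport_mx x) /\
    `|line_transport_mx x - 1%:M - christoffel_mx g (chart_at (j q0)) (chart_map (chart_at (j q0)) (j q0))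
        (x - chart_map (chart_at (j q0)) (j q0))| <= e * `|x - chart_map (chart_at (j q0)) (j q0)|.
Proof.
move=> e0; apply: filterS2 (near_line_parallel hK (j q0) e0) (near_dom iq) => x [Q lQ bQ] ix.
have lP : line_parallel g (j q0) x (line_transport_mx x).
  by apply: (@xgetPex _ 1%:M [set Q | line_parallel g (j q0) x Q]); exists Q.
by split=> //; rewrite (line_parallel_unique hK ix lP lQ).
Qed.

Lemma christoffel_mx0 u : christoffel_mx g i u 0 = 0.
Proof.
by apply/matrixP => b c; rewrite !mxE big1 // => a _; rewrite mxE mulr0.
Qed.

Lemma line_transport_mx_at : line_transport_mx x0 = 1%:M.
Proof.
have [_] := nbhs_singleton (near_line_transport_mx ltr01).
rewrite subrr normr0 mulr0 normr_le0 christoffel_mx0 subr0 subr_eq0.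
by move/eqP.
Qed.

Lemma christoffel_mx_linear u : linear (christoffel_mx g i u).
Proof.
move=> a v w; apply/matrixP => b c; rewrite !mxE mulr_sumr -big_split.
by apply: eq_bigr => d _; rewrite !mxE /=; ring.
Qed.

Lemma differentiable_line_transport_mx : differentiable line_transport_mx x0 /\
  forall v, 'D_v line_transport_mx x0 = christoffel_mx g i x0 v.
Proof.
pose LM := GRing.isLinear.Build _ _ _ _ _ (christoffel_mx_linear x0).
pose F : {linear 'rV[R]_(n + n) -> 'M[R]_(n + n)} := HB.pack (christoffel_mx g i x0) LM.
have cF : continuous F.
  move=> v; apply: mx_continuous => b c.
  have -> : (fun y => F y b c) = (fun y : 'rV[R]_(n + n) => \sum_a christoffel g i x0 c a b * y 0 a).
    by apply/funext => y; rewrite /F /= mxE.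
  apply: continuous_bigsum => a; apply: continuousM; first exact: cst_continuous.
  exact: coord_continuous.
have [d D] : differentiable line_transport_mx x0 /\ 'd line_transport_mx x0 = F :> (_ -> _).
  apply: differentiable_eps => // e e0.
  have := near_line_transport_mx e0; rewrite -/i -/x0 (near_shift 0) /=.
  by apply: filterS => h; rewrite /= subr0 line_transport_mx_at addrK => -[].
by split=> // v; rewrite (deriveE _ d) D.
Qed.

Definition transported_frame (u : 'rV[R]_n) : 'M[R]_(n, n + n) :=
  jacobian (local_map j (chart_at q0) (chart_at (j q0))) u *m
  line_transport_mx (local_map j (chart_at q0) (chart_at (j q0)) u).

Lemma differentiable_transported_frame : differentiable transported_frame u0.
Proof.
have d1 : differentiable (jacobian phi) u0 := differentiable_jacobian oU C2 Uu.
have d2 : differentiable (line_transport_mx \o phi) u0.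
  have dphi : differentiable phi u0 := C2_differentiable C2 Uu.
  have dQ : differentiable line_transport_mx (phi u0).
    by rewrite phiu; case: differentiable_line_transport_mx.
  exact: differentiable_comp dphi dQ.
exact: differentiable_mulmx d1 d2.
Qed.

(** The covariant derivative is the ordinary derivative of the frame carried back to q0: the
    Christoffel term is the derivative of the transport in the product rule. *)
Lemma derive_transported_frame Y : 'D_Y transported_frame u0 = frame_nabla g j q0 Y.
Proof.
have dphi := C2_differentiable C2 Uu.
have DE : is_derive u0 Y (jacobian phi) ('D_Y (jacobian phi) u0).
  exact/derivableP/diff_derivable/(differentiable_jacobian oU C2 Uu).
have Dphi : is_derive u0 Y phi (Y *m dmap j q0).
  by split; [exact: diff_derivable | rewrite (deriveEjacobian _ dphi)].
have [dQ DQ] := differentiable_line_transport_mx.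
have dQ' : differentiable line_transport_mx (phi u0) by rewrite phiu.
have DQ' := is_derive_comp dQ' Dphi.
have [_ D] := is_derive_mulmx DE DQ'.
apply: (etrans D); rewrite /= phiu DQ line_transport_mx_at mulmx1.
by [].
Qed.

Lemma transported_frame_at : transported_frame u0 = dmap j q0.
Proof.
have E : transported_frame u0 = jacobian phi u0 *m line_transport_mx (phi u0) by [].
by rewrite E phiu line_transport_mx_at mulmx1.
Qed.

(** The zeta of the overview. It equals 1 at the base point; elsewhere its modulus is arbitrary and
    gets divided out in [near_maslov_map]. *)
Definition relative_phase (u : 'rV[R]_n) : R[i] :=
  \det (complexify (transported_frame u) *m invmx (complexify (dmap j q0))).

Lemma complexify_dmap_unit : complexify (dmap j q0) \in unitmx.
Proof.
rewrite unitmxE unitfE.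
apply: (@complexify_det_neq0 _ _ 0 (g (j q0))); [|exact: pullback_gram_unit|exact: lagrangian_dmap].
by apply: Jmx_comm; exact: metric_Jmx.
Qed.

Lemma relative_phase_at : relative_phase u0 = 1.
Proof. by rewrite /relative_phase transported_frame_at mulmxV ?det1 // complexify_dmap_unit. Qed.

Lemma cderiv_relative_phase Y : cderiv u0 Y relative_phase
  (\tr (complexify (frame_nabla g j q0 Y) *m invmx (complexify (dmap j q0)))).
Proof.
apply: cderiv_det1; last by rewrite transported_frame_at mulmxV // complexify_dmap_unit.
move=> a b; set C := invmx _.
have dF := (differentiable_mxP _ _).1 differentiable_transported_frame.
have DF : forall a b, 'D_Y (fun u => transported_frame u a b) u0 = frame_nabla g j q0 Y a b.
  move=> a' b'; rewrite -derive_transported_frame derive_mx ?mxE //.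
  exact: diff_derivable differentiable_transported_frame.
have E1 : (fun u => (complexify (transported_frame u) *m C) a b) =
   (fun u => \sum_c complexify (transported_frame u) a c * C c b).
  by apply/funext => u; rewrite mxE.
rewrite E1 [X in cderiv _ _ _ X]mxE; apply: cderiv_sum => c.
apply: cderiv_eqd (cderivM _ (cderiv_cst _ _ (C c b))) _; last by rewrite mulr0 addr0.
split.
- have -> : (fun u => Re (complexify (transported_frame u) a c)) = (fun u => transported_frame u a (lshift n c)).
    by apply/funext => u; rewrite !mxE.
  exact: dF.
- have -> : (fun u => Im (complexify (transported_frame u) a c)) = (fun u => transported_frame u a (rshift n c)).
    by apply/funext => u; rewrite !mxE.
  exact: dF.
- have -> : (fun u => Re (complexify (transported_frame u) a c)) = (fun u => transported_frame u a (lshift n c)).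
    by apply/funext => u; rewrite !mxE.
  by apply: (etrans (DF _ _)); rewrite [complexify _ _ _]mxE /= [in RHS]mxE.
- have -> : (fun u => Im (complexify (transported_frame u) a c)) = (fun u => transported_frame u a (rshift n c)).
    by apply/funext => u; rewrite !mxE.
  by apply: (etrans (DF _ _)); rewrite [complexify _ _ _]mxE /= [in RHS]mxE.
Qed.

(** Comparing moduli gives r^2 |z|^2 = 1, so the number r, chosen without any regularity, is
    replaced by a smooth function of z. *)
Lemma unimodular_scaling (m m0 z : R[i]) (r : R) :
  m * conjc m = 1 -> m0 * conjc m0 = 1 -> m = toC (r ^+ 2) * m0 * z ^+ 2 ->
  m = m0 * (z * z) * toC ((Re z ^+ 2 + Im z ^+ 2)^-1).
Proof.
move=> hm hm0 E; pose N := Re z ^+ 2 + Im z ^+ 2.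
have N0 : 0 <= N by rewrite addr_ge0 // sqr_ge0.
have zz : z * conjc z = toC N.
  by apply: complex_eq; rewrite ?complex_ReM ?complex_ImM /N; case: (z) => a b /=; ring.
have rN : (r ^+ 2 * N) ^+ 2 = 1.
  have toCM a b : toC (a * b) = toC a * toC b by exact: rmorphM.
  have cM (a b : R[i]) : conjc (a * b) = conjc a * conjc b by exact: rmorphM.
  apply: (@complexI R); rewrite expr2 !toCM -zz -[toC 1]/(1 : R[i]) -[RHS]hm.
  rewrite -[LHS]mul1r -hm0 E [z ^+ 2]expr2 !cM conjc_real; ring.
(* Nonnegativity selects the root 1 rather than -1. *)
have rN1 : r ^+ 2 * N = 1.
  apply/eqP; rewrite -(@eqrXn2 _ 2) ?rN ?expr1n //.
  by rewrite mulr_ge0 // sqr_ge0.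
have Nn0 : N != 0 by apply/eqP => Nz; move: rN1; rewrite Nz mulr0 => /esym/eqP; rewrite oner_eq0.
have -> : (Re z ^+ 2 + Im z ^+ 2)^-1 = r ^+ 2.
  by rewrite -/N -[LHS]mul1r -rN1 mulfK.
by rewrite E; ring.
Qed.

Lemma near_maslov_map : \forall u \near u0,
  M (chart_inv k u) = M q0 * (relative_phase u * relative_phase u) *
    toC ((Re (relative_phase u) ^+ 2 + Im (relative_phase u) ^+ 2)^-1).
Proof.
have cphi : {for u0, continuous phi}.
  exact: differentiable_continuous (C2_differentiable C2 Uu).
have Np : \forall u \near u0, line_parallel g (j q0) (phi u) (line_transport_mx (phi u)).
  have Nx : nbhs (phi u0) [set x | line_parallel g (j q0) x (line_transport_mx x)].
    by rewrite phiu; apply: filterS (near_line_transport_mx ltr01) => x [].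
  exact: near_continuous cphi Nx.
have NU : \forall u \near u0, U u by exact: open_nbhs_nbhs.
apply: filterS2 Np NU => u lQ [q [kq' iq'] qu]; subst u.
have cu : chart_inv k (chart_map k q) = q by rewrite chart_mapK.
rewrite cu.
have [p [gamma [P [A H]]]] := hM.
have [ps tP uA D Mq] := H q; have [ps0 tP0 uA0 D0 Mq0] := H q0.
have phiq : phi (chart_map k q) = chart_map i (j q) by rewrite /phi /local_map /= chart_mapK.
have lQ' := lQ; rewrite {1}phiq in lQ'.
have [r E] := maslov_relation hX hj ps0 ps tP0 tP uA0 uA D0 D kq' iq' lQ'.
apply: (@unimodular_scaling _ _ _ r); [exact: maslov_map_norm | exact: maslov_map_norm |].
rewrite Mq Mq0; exact: E.
Qed.

Lemma cderiv_maslov_map Y : cderiv u0 Y (fun u => M (chart_inv k u))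
  (M q0 * Complex 0 (2 * Im (\tr (complexify (frame_nabla g j q0 Y) *m invmx (complexify (dmap j q0)))))).
Proof.
set t := \tr _; have cz := cderiv_relative_phase Y; rewrite -/t in cz.
pose h u := Re (relative_phase u) ^+ 2 + Im (relative_phase u) ^+ 2.
have [dr di Dr Di] := cz.
have dh : differentiable h u0.
  have -> : h = (fun u => Re (relative_phase u)) * (fun u => Re (relative_phase u)) +
     (fun u => Im (relative_phase u)) * (fun u => Im (relative_phase u)) by [].
  by apply: differentiableD; exact: differentiableM.
have h1 : h u0 = 1 by rewrite /h relative_phase_at /= expr1n expr0n addr0.
have Dh : 'D_Y h u0 = 2 * Re t.
  have -> : h = (fun u => Re (relative_phase u)) * (fun u => Re (relative_phase u)) +
     (fun u => Im (relative_phase u)) * (fun u => Im (relative_phase u)) by [].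
  have d1 := DeriveDef (diff_derivable (v := Y) dr) Dr.
  have d2 := DeriveDef (diff_derivable (v := Y) di) Di.
  have [_ ->] := is_deriveD (is_deriveM d1 d1) (is_deriveM d2 d2).
  by rewrite relative_phase_at /GRing.scale /=; ring.
have ch : cderiv u0 Y (fun u => toC (h u)^-1) (toC (- (2 * Re t))).
  split=> /=; [ | exact: differentiable_cst | | exact: derive_cst].
    by apply: differentiableV => //; rewrite h1 oner_eq0.
  rewrite deriveV ?h1 ?oner_eq0 ?Dh //; last exact: diff_derivable.
  by rewrite expr1n invr1 /GRing.scale /=; ring.
have := cderivM (cderivMl (M q0) (cderivM cz cz)) ch.
rewrite relative_phase_at h1 => D.
have {}D : cderiv u0 Y (fun u => M q0 * (relative_phase u * relative_phase u) * toC (h u)^-1)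
    (M q0 * Complex 0 (2 * Im t)).
  apply: cderiv_eqd D _; rewrite -[RHS]mulr1 !mulr1 !mul1r invr1.
  (* At zeta = 1 the two factors zeta contribute t + t and 1/|zeta|^2 contributes -2 Re t, which
     leaves a purely imaginary number. *)
  have -> : Complex 0 (2 * Im t) = t + t + toC (- (2 * Re t)).
    by apply: complex_eq; rewrite ?complex_ReD ?complex_ImD /=; ring.
  by rewrite [toC 1]rmorph1; ring.
case: D => [d1 d2 D1 D2].
have N := near_maslov_map.
have NR : \forall u \near u0, Re (M q0 * (relative_phase u * relative_phase u) * toC (h u)^-1) = Re (M (chart_inv k u)).
  by apply: filterS N => u ->.
have NI : \forall u \near u0, Im (M q0 * (relative_phase u * relative_phase u) * toC (h u)^-1) = Im (M (chart_inv k u)).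
  by apply: filterS N => u ->.
split.
- exact: near_eq_differentiable NR d1.
- exact: near_eq_differentiable NI d2.
- by rewrite -D1; apply/esym; exact: near_eq_derive.
- by rewrite -D2; apply/esym; exact: near_eq_derive.
Qed.

End MaslovDerivative.

Theorem mainTheorem1 (R : realType) (n : nat)
    (X : manifold R (n + n)) (g : X -> 'M[R]_(n + n)) (hX : calabi_yau g)
    (L : manifold R n) (hL : connected [set: L])
    (j : L -> X) (hj : lagrangian_embedding g j)
    (H : L -> 'rV[R]_(n + n)) (hH : mean_curvature g j H)
    (M : L -> R[i]) (hM : maslov_map g j M) :
  circle_map_differentiable M /\
  forall (q : L) (Y : 'rV[R]_n),
    maslov_form M q Y = pi^-1 * omega g (j q) (H q) (Y *m dmap j q).
Proof.
have cM q Y := cderiv_maslov_map hX hj hM q Y.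
split=> [q|q Y]; first by case: (cM q 0).
have [_ _ D1 D2] := cM q Y.
rewrite (mean_curvature_trace (calabi_yau_kahler hX) hj q Y hH).
move: D1 D2; set t := Im _ => D1 D2.
have Mq : M (chart_inv (chart_at q) (chart_map (chart_at q) q)) = M q.
  by rewrite chart_mapK //; exact: dom_chart_at.
rewrite /maslov_form /re_coord /im_coord Mq.
rewrite [X in _ * X - _](_ : _ = Im (M q * Complex 0 (2 * t))) //.
rewrite [X in _ - _ * X](_ : _ = Re (M q * Complex 0 (2 * t))) //.
have nM : Re (M q) ^+ 2 + Im (M q) ^+ 2 = 1.
  have := congr1 (@complex.Re R) (maslov_map_norm hX hM q).
  by rewrite complex_ReM; case: (M q) => a b /= <-; ring.
rewrite complex_ReM complex_ImM /= invfM.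
(* Since dM = M * 2 i t, the form x dy - y dx evaluates to |M|^2 * 2 t; the modulus is 1, and the 2
   cancels against that of 2 pi. *)
have -> : Re (M q) * (Re (M q) * (2 * t) + Im (M q) * 0) - Im (M q) * (Re (M q) * 0 - Im (M q) * (2 * t))
  = (Re (M q) ^+ 2 + Im (M q) ^+ 2) * (2 * t) by ring.
rewrite nM; move: (pi^-1) => c; by field.
Qed.
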